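(* The period determinant of $\nabla_\Sigma$ is $$per(U,\Sigma,\nabla_\Sigma)=per(U,\nabla)\times per(\Sigma,\nabla)$$ in $\mathbb{C}^*/k^*$.
   Context: Let $k\subset\mathbb{C}$ be the field of definition of the curve below (so $\lambda\in k$), with $\lambda\ne 0,1$ and $\lambda^2-\lambda+1\neq0$. Put $f(x)=x(x-1)(x-\lambda)$, let $U$ be the affine curve $y^2=f(x)$ and $X=U\cup\{\infty\}$ its completion in $\mathbb{P}^2$. Let $\nabla=d+dy$ on $\mathcal{O}_U$ and $\nabla^*=d-dy$ its dual, with horizontal section $\exp y$. Let $x_1,x_2$ be the roots of $f'(x)$, $D=\{\pm\sqrt{f(x_1)},\pm\sqrt{f(x_2)}\}\subset\mathbb{A}^1$, $\pi:U\to\mathbb{A}^1$, $(x,y)\mapsto y$, and $\Sigma=\pi^{-1}(D)\subset U$ (a finite set of points, regarded as a reduced divisor; it is defined over $k$). Let $\nabla_\Sigma$ be the restriction of $\nabla$ to $\mathcal{O}_U(-\Sigma)\to\Omega_U(-\Sigma)(\log\Sigma)=\Omega_U$. De Rham cohomology ($k$-vector spaces): $H^1_{dR}(U,\nabla)=\Gamma(U,\Omega_U)/\nabla\Gamma(U,\mathcal{O}_U)$ and $H^1_{dR}(U,\nabla_\Sigma)=\Gamma(U,\Omega_U)/\nabla\Gamma(U,\mathcal{O}_U(-\Sigma))$. Homology (Bloch--Esnault): $H_*^{irreg}(U,\nabla^* )$ is the homology of the complex of $\mathbb{C}$-linear combinations of $\sigma\otimes s$, where $\sigma$ is a (piecewise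 smooth) singular simplex in $X(\mathbb{C})$ meeting $\infty$ at most in a face and $s$ is a horizontal section of $\nabla^*$ along the part of $\sigma$ in $U$ that decays rapidly (faster than every power of a local parameter) as $\infty$ is approached along $\sigma$; chains supported in $\{\infty\}$ are set to zero. $H_*^{irreg}(\Sigma,\nabla^* )$ is the homology of the subcomplex of chains supported in $\Sigma$; $H_0^{irreg}(\Sigma,\nabla^* )$ has the basis $\{p\otimes\exp y : p\in\Sigma\}$. $H_*^{irreg}(U,\Sigma,\nabla^* )$ is the homology of the quotient complex. Period determinants: each is the determinant of the matrix of the pairing between a basis of the homology group, consisting of classes $\gamma\otimes\exp y$ with $\gamma$ an integral chain and generating the lattice of all such integral classes, and a $k$-basis of the cohomology group; it is regarded in $\mathbb{C}^*/k^*$. Namely: $per(U,\nabla)$ is for $H_1^{irreg}(U,\nabla^* )$ and $H^1_{dR}(U,\nabla)$ with pairing $\int_\gamma\exp y\cdot\omega$; $per(U,\Sigma,\nabla_\Sigma)$ is for $H_1^{irreg}(U,\Sigma,\nabla^* )$ and $H^1_{dR}(U,\nabla_\Sigma)$ with pairing $\int_\gamma\exp y\cdot\omega$; $per(\Sigma,\nabla)$ is for $H_0^{irreg}(\Sigma,\nabla^* )$ with basis $\{p\otimes\exp y\}_{p\in\Sigma}$ and $H^0(U,\mathcal{O}_\Sigma)$ with pairing $\langle p\otimes\exp y,g\rangle=g(p)\exp(y(p))$. *)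

(* Defs.v *)
From HB Require Import structures.
From mathcomp Require Import all_boot all_order all_algebra.
From mathcomp Require Import polyXY.
From mathcomp Require Import freeg.
From mathcomp Require Import complex.
From mathcomp Require Import all_classical all_reals all_analysis.

Set Implicit Arguments.
Unset Strict Implicit.
Unset Printing Implicit Defensive.

Import Order.TTheory GRing.Theory Num.Theory.
Import numFieldNormedType.Exports.

Local Open Scope ring_scope.
Local Open Scope complex_scope.
Local Open Scope classical_set_scope.

Definition cubic (A : comNzRingType) (l : A) : {poly A} :=
  'X * ('X - 1) * ('X - l%:P).

Section Complex.
Context {R : realType}.
Local Notation C := R[i].

Definition cexp (z : C) : C :=
  (expR (complex.Re z))%:C * (cos (complex.Im z) +i* sin (complex.Im z)).

Definition cderive (h : R -> C) (s : R) : C :=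
  (fun u => complex.Re (h u))^`() s +i* (fun u => complex.Im (h u))^`() s.

Definition cintegral (D : set R) (h : R -> C) : C :=
  (\int[lebesgue_measure]_(s in D) complex.Re (h s)) +i*
  (\int[lebesgue_measure]_(s in D) complex.Im (h s)).

(* [curve l] is U(C), for U : y^2 = x (x - 1) (x - l).  A point of
   X(C) = U(C) + {oo} is encoded in [option (C * C)], with [None] for oo. *)
Definition curve (l : C) : set (C * C) :=
  [set p | p.2 ^+ 2 = (cubic l).[p.1]].

(* The critical values of y : U -> A^1. *)
Definition critval (l : C) : set C :=
  [set y | exists2 e, root (cubic l)^`() e & y ^+ 2 = (cubic l).[e]].

Definition Sigma (l : C) : set (C * C) :=
  [set p | curve l p /\ critval l p.2].

Fixpoint diffclass m (r : nat) (g : 'rV[R]_m.+1 -> R) : Prop :=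
  continuous g /\
  if r is r'.+1 then
    forall v, (forall w, derivable g w v) /\ diffclass r' (fun w => 'D_v g w)
  else True.

Definition Csmooth m (g : 'rV[R]_m.+1 -> C) : Prop :=
  forall r, diffclass r (fun w => complex.Re (g w)) /\
            diffclass r (fun w => complex.Im (g w)).

Definition in_splx n (v : 'rV[R]_n.+1) : bool :=
  [forall i, 0 <= v 0 i] && (\sum_i v 0 i == 1).

Definition splx n := {v : 'rV[R]_n.+1 | in_splx v}.

Definition face_row n (i : 'I_n.+2) (v : 'rV[R]_n.+1) : 'rV[R]_n.+2 :=
  \row_j (if unlift i j is Some j' then v 0 j' else 0).

Lemma face_rowP n (i : 'I_n.+2) (v : splx n) : in_splx (face_row i (val v)).
Proof.
case: v => v /= /andP[/forallP v0 /eqP v1]; apply/andP; split.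
  by apply/forallP => j; rewrite mxE; case: unlift.
rewrite (bigD1_ord i) //= mxE unlift_none add0r.
by rewrite -v1; apply/eqP/eq_bigr => j _; rewrite mxE liftK.
Qed.

Definition face_splx n (i : 'I_n.+2) (v : splx n) : splx n.+1 :=
  Sub (face_row i (val v)) (face_rowP i v).

(* Maps from the standard n-simplex to X(C); the conditions that single out
   the simplices of the complex are in [admissible]. *)
Definition sing n := splx n -> option (C * C).

(* The chart (t, w) = (x / y, 1 / y) = (x : y : 1) of P^2 at oo = (0 : 1 : 0),
   as a relation; it has no value at the points with y = 0. *)
Definition chart_oo (q : option (C * C)) (t w : C) : Prop :=
  if q is Some p then [/\ p.2 != 0, t = p.1 / p.2 & w = p.2^-1]
  else t = 0 /\ w = 0.

(* s is smooth on K: near every point of K, its restriction to K, read in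
   one of the two charts of P^2, extends to a smooth function. *)
Definition smooth_on n (K : set (splx n)) (s : sing n) : Prop :=
  forall v, K v -> exists a b : 'rV[R]_n.+1 -> C,
    [/\ Csmooth a, Csmooth b &
        (\forall w \near nbhs (val v), forall u : splx n,
           val u = w -> K u -> s u = Some (a w, b w)) \/
        (\forall w \near nbhs (val v), forall u : splx n,
           val u = w -> K u -> chart_oo (s u) (a w) (b w))].

Definition affine_splx n (a : 'I_n.+1 -> splx n) : set (splx n) :=
  [set v | exists u : splx n, val v = \sum_i val u 0 i *: val (a i)].

(* s is smooth on each piece of a finite cover by closed affine simplices;
   continuity of s follows. *)
Definition piecewise_smooth n (s : sing n) : Prop :=
  exists m (a : 'I_m -> 'I_n.+1 -> splx n),
    (forall v, exists j, affine_splx (a j) v) /\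
    (forall j, smooth_on (affine_splx (a j)) s).

(* F = set0 is the case of a simplex that does not meet oo. *)
Definition oo_in_face n (s : sing n) : Prop :=
  exists F : {set 'I_n.+1}, forall v : splx n,
    s v = None <-> (forall i, i \notin F -> val v 0 i = 0).

Definition const_oo n (s : sing n) : Prop := forall v, s v = None.

(* x / y is a local parameter at oo, and y -> oo at oo. *)
Definition rapid_decay n (s : sing n) : Prop :=
  forall N : nat, exists M : R, forall v p, s v = Some p ->
    M%:C <= `|p.2| -> `|cexp p.2| <= `|p.1 / p.2| ^+ N.

Definition admissible (l : C) n (s : sing n) : Prop :=
  [/\ forall v p, s v = Some p -> curve l p,
      piecewise_smooth s,
      oo_in_face s,
      ~ const_oo s &
      rapid_decay s].

(* The horizontal sections of the dual connection along a simplex are the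
   c * exp y with c in C, so that << c *g s >> stands for s (x) (c * exp y).
   Simplices contained in {oo} are zero: they do not occur in chains and are
   dropped from boundaries. *)
Definition chain (A : nzRingType) n := {freeg (sing n) / A}.

Definition bd (A : nzRingType) n (c : chain A n.+1) : chain A n :=
  fglift (fun s : sing n.+1 => \sum_(i < n.+2)
    (if `[< const_oo (s \o face_splx i) >] then 0
     else << (-1) ^+ i *g (s \o face_splx i : sing n) >>)) c.

Definition complexify n (c : chain int n) : chain C n :=
  \sum_(s <- dom c) << (coeff s c)%:~R *g s >>.

Definition admissible_chain (A : nzRingType) (l : C) n (c : chain A n) : Prop :=
  forall s, s \in dom c -> admissible l s.

Definition supported (A : nzRingType) (S : set (C * C)) n (c : chain A n)
    : Prop :=
  forall s, s \in dom c -> forall v, exists2 p, S p & s v = Some p.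

(* Degree 1 cycles and boundaries of the quotient of the complex of U by the
   complex of S.  For S = set0 this is the homology of U itself. *)
Definition rel_cycle (l : C) (S : set (C * C)) (c : chain C 1) : Prop :=
  admissible_chain l c /\ supported S (bd c).

Definition rel_boundary (l : C) (S : set (C * C)) (c : chain C 1) : Prop :=
  exists (b : chain C 2) (e : chain C 1),
    [/\ admissible_chain l b, admissible_chain l e, supported S e &
        c = bd b + e].

(* The gam i (x) exp y are a C-basis of H_1 and their Z-span contains the class
   of every integral cycle c (x) exp y. *)
Definition integral_basis (l : C) (S : set (C * C)) n
    (gam : 'I_n -> chain int 1) : Prop :=
  [/\ forall i, rel_cycle l S (complexify (gam i)),
      forall c, rel_cycle l S c -> exists! a : {ffun 'I_n -> C},
        rel_boundary l S (c - \sum_i a i *: complexify (gam i)) &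
      forall c : chain int 1, rel_cycle l S (complexify c) ->
        exists a : 'I_n -> int,
        rel_boundary l S (complexify c - \sum_i complexify (gam i) *~ a i)].

Context (k : fieldType) (iota : {rmorphism k -> C}) (lam : k).

(* Polynomials in x (outer variable) and y (inner variable) over k. *)
Local Notation P := {poly {poly k}}.

Definition ev (g : P) (p : C * C) : C :=
  (map_poly (map_poly iota) g).[p.1, p.2].

Definition curve_eq : P := 'Y ^+ 2 - (cubic lam) ^:P.

Definition dx (g : P) : P := g^`().
Definition dy (g : P) : P := map_poly (@deriv k) g.

(* (a, b) stands for a dx + b dy. *)
Definition form := (P^o * P^o)%type.

(* The kernel of k[x,y] dx + k[x,y] dy -> Gamma(U, Omega_U). *)
Definition form_rel (om : form) : Prop :=
  exists c e1 e2 : P,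
    om = (c * dx curve_eq + curve_eq * e1, c * dy curve_eq + curve_eq * e2).

Definition nabla (g : P) : form := (dx g, dy g + g).

(* The polynomials whose restriction to U is a section of O_U(-S). *)
Definition vanishing (S : set (C * C)) (g : P) : Prop :=
  forall p, S p -> ev g p = 0.

(* The kernel of k[x,y] dx + k[x,y] dy -> H^1_dR(U, nabla_S). *)
Definition dR_trivial (S : set (C * C)) (om : form) : Prop :=
  exists2 g : P, vanishing S g & form_rel (om - nabla g).

(* The classes of the v i form a k-basis of V / W. *)
Definition kbasis_mod (V : lmodType P) (W : V -> Prop) n (v : 'I_n -> V)
    : Prop :=
  forall u : V, exists! c : {ffun 'I_n -> k},
    W (u - \sum_i (c i)%:P%:P *: v i).

(* The s-th point of a path, s in [0, 1], and [None] for other s. *)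
Definition path_pt (sg : sing 1) (s : R) : option (C * C) :=
  obind sg (insub (\row_j (if j == 0 then 1 - s else s))).

Definition path_x (sg : sing 1) (s : R) : C :=
  if path_pt sg s is Some p then p.1 else 0.

Definition path_y (sg : sing 1) (s : R) : C :=
  if path_pt sg s is Some p then p.2 else 0.

(* If an end of the path is at oo, the integral is still absolutely convergent,
   by rapid decay. *)
Definition path_integral (om : form) (sg : sing 1) : C :=
  cintegral `]0, 1[%classic (fun s =>
    cexp (path_y sg s) *
    (ev om.1 (path_x sg s, path_y sg s) * cderive (path_x sg) s +
     ev om.2 (path_x sg s, path_y sg s) * cderive (path_y sg) s)).

Definition period (c : chain C 1) (om : form) : C :=
  fglift (path_integral om : sing 1 -> C^o) c.

(* d represents per(U, S, nabla_S), which is per(U, nabla) for S = set0. *)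
Definition is_per (S : set (C * C)) (d : C) : Prop :=
  exists n (gam : 'I_n -> chain int 1) (om : 'I_n -> form),
    [/\ integral_basis (iota lam) S gam, kbasis_mod (dR_trivial S) om &
        d = \det (\matrix_(i, j) period (complexify (gam i)) (om j))].

(* d represents per(S, nabla), for a finite set S of points of U. *)
Definition is_per_pts (S : set (C * C)) (d : C) : Prop :=
  exists n (pt : 'I_n -> C * C) (g : 'I_n -> P^o),
    [/\ injective pt, range pt = S, kbasis_mod (vanishing S : P^o -> Prop) g &
        d = \det (\matrix_(i, j) (ev (g j) (pt i) * cexp (pt i).2))].

End Complex.

(* Main.v *)
Require Import Defs.
From mathcomp Require Import all_boot all_order all_algebra.
From mathcomp Require Import polyXY.
From mathcomp Require Import freeg.
From mathcomp Require Import complex.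
From mathcomp Require Import all_classical all_reals all_analysis.
From mathcomp Require Import ring lra.

(** The period matrix is block triangular in bases that are adapted to Sigma.

    In homology, every p in U with y != 0 can be joined to oo by a path along which
    exp y decays; this gives an integral chain delta_p with boundary p
    ([delta_exists]). A critical value of y is not 0 since the curve is smooth, so
    there is such a chain for each p in Sigma. If c is an integral relative cycle,
    its boundary is an integral combination of the points of Sigma, and c minus the
    same combination of the delta_p is a cycle of U. Hence the delta_p and an
    integral basis of H_1(U) generate the integral classes of H_1(U, Sigma) over
    the integers ([chainB_span]).

    In cohomology, the forms nabla g_j, for a basis g_j of the functions on Sigma,
    and a basis of H^1(U, nabla) form a basis of H^1(U, nabla_Sigma)
    ([formB_basis]). They generate it by definition; for the independence one needs
    that h vanishes on Sigma if nabla h is zero on U, and this holds because the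
    period of nabla h along delta_p is h(p) exp(y(p)).

    The period of nabla g along c is the value of g exp y on the boundary of c
    ([period_nabla]). So the period of nabla g_j is zero on the cycles of U and is
    g_j(p) exp(y(p)) on delta_p, and in these bases the determinant is
    per(Sigma) per(U). Passing to the given bases multiplies it by the determinant
    of an invertible matrix over k and by that of an integral matrix. The two
    cohomology bases show that both families have the same length; the integral
    matrix has an integral inverse, since the given homology basis expresses the
    adapted family and conversely ([change_mx1]), so its determinant is 1 or -1.

    The analytic content is that a period depends only on the homology class
    ([period_bd]), that is, Stokes' theorem for simplices that are only piecewise
    smooth and have a face at oo. Near a point of the curve one of x and y is a
    coordinate z, in which a form exp y (A dx + B dy) is a uniform limit of forms
    H dz with H a polynomial ([curve_local_exact], by Newton iteration); hence its
    integral along the boundary of a small square vanishes ([rect_local]). Cousin's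
    lemma ([cousin_lr]) stacks small squares to a large one whose bottom side tends
    to oo. There the integrand tends to 0, because rapid decay beats the poles of A,
    B, dx and dy ([chart_oo_bound], [bottom_small]). A triangle is swept by segments
    that start at a vertex or at a side, chosen so that its part at oo is the bottom
    of the square ([stokes_triangle]). *)

Set Implicit Arguments.
Unset Strict Implicit.
Unset Printing Implicit Defensive.

Import Order.TTheory GRing.Theory Num.Theory.
Import numFieldNormedType.Exports.
Import Normc.

Local Open Scope ring_scope.
Local Open Scope complex_scope.
Local Open Scope classical_set_scope.

Local Notation re := complex.Re.
Local Notation im := complex.Im.

(** * Complex functions: norm, continuity, derivative along the real line *)

Section ComplexCalculus.
Context {R : realType}.
Local Notation C := R[i].
Implicit Types (x y z : C) (u : R).

Lemma normE (z : C) : `|z| = (normc z)%:C.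
Proof. by case: z. Qed.

Lemma normc_ge0 (z : C) : 0 <= normc z.
Proof. by case: z => a b; exact: sqrtr_ge0. Qed.

Lemma normc_eq0 (z : C) : (normc z == 0) = (z == 0).
Proof.
by apply/eqP/eqP => [/eq0_normc //|->]; exact: normc0.
Qed.

Lemma normc_gt0 (z : C) : (0 < normc z) = (z != 0).
Proof. by rewrite lt_neqAle normc_ge0 andbT eq_sym normc_eq0. Qed.

Lemma normcX (z : C) n : normc (z ^+ n) = normc z ^+ n.
Proof.
by elim: n => [|n IH]; rewrite ?expr0 ?normc1 // !exprS normcM IH.
Qed.

Lemma normcR (a : R) : normc a%:C = `|a|.
Proof. by rewrite /= expr0n /= addr0 sqrtr_sqr. Qed.

Lemma normcB (x y : C) : normc (x - y) = normc (y - x).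
Proof. by rewrite -normcN opprB. Qed.

Lemma le_normcB (x y : C) : normc (x - y) <= normc x + normc y.
Proof. by rewrite -(normcN y) le_normcD. Qed.

Lemma le_norm_re (z : C) : `|re z| <= normc z.
Proof. by rewrite -lecR -normE; exact: normc_ge_Re. Qed.

Lemma le_norm_im (z : C) : `|im z| <= normc z.
Proof.
have := le_norm_re (z * 'i); rewrite ReiNIm normrN normcM.
by rewrite [normc 'i]/= expr0n expr1n add0r sqrtr1 mulr1.
Qed.

Lemma normc_le_reim (z : C) : normc z <= `|re z| + `|im z|.
Proof.
rewrite {1}(complexE z); apply: (le_trans (le_normcD _ _)).
rewrite normcM !normcR [normc 'i]/= expr0n expr1n add0r sqrtr1 mul1r.
by rewrite lexx.
Qed.

Lemma reD x y : re (x + y) = re x + re y. Proof. by case: x; case: y. Qed.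
Lemma imD x y : im (x + y) = im x + im y. Proof. by case: x; case: y. Qed.
Lemma reN x : re (- x) = - re x. Proof. by case: x. Qed.
Lemma imN x : im (- x) = - im x. Proof. by case: x. Qed.
Lemma reM x y : re (x * y) = re x * re y - im x * im y.
Proof. by case: x; case: y. Qed.
Lemma imM x y : im (x * y) = re x * im y + im x * re y.
Proof. by case: x => a b; case: y => c d /=; rewrite [a * d + _]addrC addrC. Qed.

Lemma normc_cexp z : normc (cexp z) = expR (re z).
Proof.
rewrite /cexp normcM normcR ger0_norm ?expR_ge0 //=.
by rewrite cos2Dsin2 sqrtr1 mulr1.
Qed.

Lemma cexp_neq0 z : cexp z != 0.
Proof. by rewrite -normc_gt0 normc_cexp expR_gt0. Qed.

Lemma cexp0 : cexp (0 : C) = 1.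
Proof. by rewrite /cexp /= expR0 cos0 sin0 mul1r. Qed.

Lemma cexpD x y : cexp (x + y) = cexp x * cexp y.
Proof.
apply/eqP; rewrite eq_complex; apply/andP; split; apply/eqP.
  by rewrite !(reM, imM) !reD !imD expRD cosD sinD /=; ring.
by rewrite !(reM, imM) !reD !imD expRD cosD sinD /=; ring.
Qed.

Definition ccont (T : topologicalType) (h : T -> C) (t : T) :=
  {for t, continuous (fun w => re (h w))} /\
  {for t, continuous (fun w => im (h w))}.

Section Ccont.
Variable T : topologicalType.
Implicit Types (h f g : T -> C) (t : T).

Lemma ccontP h t :
  ccont h t <-> forall e : R, 0 < e -> \forall w \near t, normc (h w - h t) < e.
Proof.
split => [[h1 h2] e e0|H].
  have e20 : 0 < e / 2 by rewrite divr_gt0.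
  move/cvgrPdist_lt/(_ _ e20): h1 => h1.
  move/cvgrPdist_lt/(_ _ e20): h2 => h2.
  near=> w; apply: (le_lt_trans (normc_le_reim _)).
  rewrite reD imD reN imN (splitr e); apply: ltrD; rewrite distrC; near: w.
    exact: h1.
  exact: h2.
split; apply/cvgrPdist_lt => e /H; apply: filterS => w hw; rewrite distrC.
  by apply: le_lt_trans hw; rewrite -reN -reD le_norm_re.
by apply: le_lt_trans hw; rewrite -imN -imD le_norm_im.
Unshelve. all: by end_near. Qed.

Lemma ccont_cst (c : C) t : ccont (fun=> c) t.
Proof. by split; exact: cst_continuous. Qed.

Lemma ccontD f g t : ccont f t -> ccont g t -> ccont (fun w => f w + g w) t.
Proof.
move=> [f1 f2] [g1 g2]; split.
  rewrite (_ : (fun _ => _) = (fun w => re (f w) + re (g w))).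
    exact: continuousD f1 g1.
  by apply/funext => w; rewrite reD.
rewrite (_ : (fun _ => _) = (fun w => im (f w) + im (g w))).
  exact: continuousD f2 g2.
by apply/funext => w; rewrite imD.
Qed.

Lemma ccontN f t : ccont f t -> ccont (fun w => - f w) t.
Proof.
move=> [f1 f2]; split.
  rewrite (_ : (fun _ => _) = (fun w => - re (f w))).
    exact: continuousN f1.
  by apply/funext => w; rewrite reN.
rewrite (_ : (fun _ => _) = (fun w => - im (f w))).
  exact: continuousN f2.
by apply/funext => w; rewrite imN.
Qed.

Lemma ccontM f g t : ccont f t -> ccont g t -> ccont (fun w => f w * g w) t.
Proof.
move=> [f1 f2] [g1 g2]; split.
  rewrite (_ : (fun _ => _) = (fun w => re (f w) * re (g w) - im (f w) * im (g w))).
    exact: continuousB (continuousM f1 g1) (continuousM f2 g2).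
  by apply/funext => w; rewrite reM.
rewrite (_ : (fun _ => _) = (fun w => re (f w) * im (g w) + im (f w) * re (g w))).
  exact: continuousD (continuousM f1 g2) (continuousM f2 g1).
by apply/funext => w; rewrite imM.
Qed.

Lemma ccontX f n t : ccont f t -> ccont (fun w => f w ^+ n) t.
Proof.
move=> cf; elim: n => [|n IH]; first exact: ccont_cst.
by under [X in ccont X]funext do rewrite exprS; exact: ccontM.
Qed.

Lemma ccont_exp f t : ccont f t -> ccont (fun w => cexp (f w)) t.
Proof.
move=> [f1 f2].
have e1 : {for t, continuous (fun w => expR (re (f w)))}.
  by apply: (continuous_comp f1); exact: continuous_expR.
have e2 : {for t, continuous (fun w => cos (im (f w)))}.
  by apply: (continuous_comp f2); exact: continuous_cos.
have e3 : {for t, continuous (fun w => sin (im (f w)))}.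
  by apply: (continuous_comp f2); exact: continuous_sin.
by apply: ccontM; split => //=; exact: cst_continuous.
Qed.

Lemma ccont_poly (p : {poly C}) f t :
  ccont f t -> ccont (fun w => p.[f w]) t.
Proof.
move=> cf; elim/poly_ind: p => [|p c IH].
  by under [X in ccont X]funext do rewrite horner0; exact: ccont_cst.
under [X in ccont X]funext do rewrite hornerMXaddC.
by apply: ccontD; [exact: ccontM|exact: ccont_cst].
Qed.

Lemma near_ccont_neq0 f t : ccont f t -> f t != 0 -> \forall w \near t, f w != 0.
Proof.
move=> /ccontP cf f0; have := cf (normc (f t)).
rewrite normc_gt0 => /(_ f0); apply: filterS => w.
by apply: contraTneq => ->; rewrite sub0r normcN ltxx.
Qed.

Lemma ccontV f t : f t != 0 -> ccont f t -> ccont (fun w => (f w)^-1) t.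
Proof.
move=> f0 cf; apply/ccontP => e e0.
have nf0 : 0 < normc (f t) by rewrite normc_gt0.
have h1 : 0 < normc (f t) / 2 by rewrite divr_gt0.
have h2 : 0 < e * (normc (f t) ^+ 2 / 2) by rewrite mulr_gt0 // divr_gt0 // exprn_gt0.
move/ccontP: (cf) => /(_ _ h1) N1.
move/ccontP: (cf) => /(_ _ h2) N2.
have N3 := near_ccont_neq0 cf f0.
near=> w.
have fw0 : f w != 0 by near: w.
have -> : (f w)^-1 - (f t)^-1 = (f t - f w) / (f w * f t).
  by rewrite invfM; field; rewrite fw0 f0.
rewrite normcM normcV normcM normcB ltr_pdivrMr; last first.
  by rewrite mulr_gt0 ?normc_gt0.
have : normc (f w - f t) < e * (normc (f t) ^+ 2 / 2) by near: w.
move/lt_le_trans; apply; rewrite ler_pM2l //.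
have : normc (f w - f t) < normc (f t) / 2 by near: w.
have := le_normcD (f t - f w) (f w); rewrite subrK normcB => A B.
have : normc (f t) / 2 <= normc (f w) by lra.
by move=> D; rewrite expr2 mulrAC ler_pM2r.
Unshelve. all: by end_near. Qed.

Lemma ccont_near f g t :
  (\forall w \near t, f w = g w) -> ccont f t -> ccont g t.
Proof.
move=> fg /ccontP cf; apply/ccontP => e /cf cfe.
near=> w.
have <- : f w = g w by near: w.
have <- : f t = g t by exact: nbhs_singleton fg.
by near: w.
Unshelve. all: by end_near. Qed.

End Ccont.

Lemma ccont_comp (T U : topologicalType) (f : T -> U) (h : U -> C) t :
  {for t, continuous f} -> ccont h (f t) -> ccont (fun w => h (f w)) t.
Proof.
move=> cf [h1 h2]; split.
  exact: (continuous_comp cf h1).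
exact: (continuous_comp cf h2).
Qed.

Definition cder (h : R -> C) (u : R) (d : C) :=
  is_derive u 1 (fun v => re (h v)) (re d) /\
  is_derive u 1 (fun v => im (h v)) (im d).

Lemma cder_eq h u d d' : cder h u d -> d = d' -> cder h u d'.
Proof. by move=> H <-. Qed.

Lemma cder_near f g u d :
  (\forall w \near u, f w = g w) -> cder f u d -> cder g u d.
Proof.
by move=> fg [d1 d2]; split; [move: d1|move: d2]; apply: near_eq_is_derive;
  apply: filterS fg => w ->.
Qed.

Lemma cder_cont h u d : cder h u d -> ccont h u.
Proof.
move=> [[d1 _] [d2 _]]; split.
  exact: (differentiable_continuous ((derivable1_diffP _ _).1 d1)).
exact: (differentiable_continuous ((derivable1_diffP _ _).1 d2)).
Qed.

Lemma cder_derive h u d : cder h u d -> cderive h u = d.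
Proof.
by case=> d1 d2; rewrite /cderive !derive1E !derive_val; case: (d).
Qed.

Lemma cder_cst (c : C) u : cder (fun=> c) u 0.
Proof. by split; exact: is_derive_cst. Qed.

Lemma cder_id u : cder (fun v => v%:C) u 1.
Proof. by split => /=; [exact: is_derive_id|exact: is_derive_cst]. Qed.

Lemma cderD f g u df dg :
  cder f u df -> cder g u dg -> cder (fun w => f w + g w) u (df + dg).
Proof.
move=> [f1 f2] [g1 g2]; split.
  under [X in is_derive _ _ X _]funext do rewrite reD.
  by rewrite reD; exact: is_deriveD.
under [X in is_derive _ _ X _]funext do rewrite imD.
by rewrite imD; exact: is_deriveD.
Qed.

Lemma cderN f u df : cder f u df -> cder (fun w => - f w) u (- df).
Proof.
move=> [f1 f2]; split.
  under [X in is_derive _ _ X _]funext do rewrite reN.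
  by rewrite reN; exact: is_deriveN.
under [X in is_derive _ _ X _]funext do rewrite imN.
by rewrite imN; exact: is_deriveN.
Qed.

Lemma cderM f g u df dg :
  cder f u df -> cder g u dg ->
  cder (fun w => f w * g w) u (df * g u + f u * dg).
Proof.
move=> [f1 f2] [g1 g2]; split.
  under [X in is_derive _ _ X _]funext do rewrite reM.
  apply: (is_derive_eq (is_deriveB (is_deriveM f1 g1) (is_deriveM f2 g2))).
  by rewrite /GRing.scale /= reD !reM; ring.
under [X in is_derive _ _ X _]funext do rewrite imM.
apply: (is_derive_eq (is_deriveD (is_deriveM f1 g2) (is_deriveM f2 g1))).
by rewrite /GRing.scale /= imD !imM; ring.
Qed.

Lemma cder_exp f u df : cder f u df -> cder (fun w => cexp (f w)) u (df * cexp (f u)).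
Proof.
move=> [f1 f2].
have e1 : is_derive u 1 (fun w => expR (re (f w))) (re df * expR (re (f u))).
  have h := is_derive1_comp (is_derive_expR (re (f u))) f1.
  by rewrite mulrC.
have e2 : is_derive u 1 (fun w => cos (im (f w))) (- im df * sin (im (f u))).
  have h := is_derive1_comp (is_derive_cos (im (f u))) f2.
  by rewrite mulNr mulrC -mulNr.
have e3 : is_derive u 1 (fun w => sin (im (f w))) (im df * cos (im (f u))).
  have h := is_derive1_comp (is_derive_sin (im (f u))) f2.
  by rewrite mulrC.
have h1 : cder (fun w => (expR (re (f w)))%:C) u (re df * expR (re (f u)))%:C.
  by split => //=; exact: is_derive_cst.
have h2 : cder (fun w => cos (im (f w)) +i* sin (im (f w))) u
   ((- im df * sin (im (f u))) +i* (im df * cos (im (f u)))).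
  by split.
apply: cder_eq (cderM h1 h2) _.
rewrite /cexp; apply/eqP; rewrite eq_complex; apply/andP; split; apply/eqP.
  by rewrite !(reD, reM, imM) /=; ring.
by rewrite !(imD, reM, imM) /=; ring.
Qed.

Lemma cder_poly (p : {poly C}) f u df :
  cder f u df -> cder (fun w => p.[f w]) u (p^`().[f u] * df).
Proof.
move=> cf; elim/poly_ind: p => [|p c IH].
  under [X in cder X]funext do rewrite horner0.
  by rewrite linear0 horner0 mul0r; exact: cder_cst.
under [X in cder X]funext do rewrite hornerMXaddC.
apply: (cder_eq (cderD (cderM IH cf) (cder_cst c u))).
rewrite derivD derivM derivX derivC hornerD hornerD !hornerM hornerX !hornerE.
by ring.
Qed.

Lemma cderX f u df n : cder f u df ->
  cder (fun w => f w ^+ n) u (n%:R * f u ^+ n.-1 * df).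
Proof.
move=> cf; have := cder_poly 'X^n cf.
under [X in cder X]funext do rewrite hornerXn.
by rewrite derivXn hornerMn hornerXn -mulr_natl.
Qed.

Lemma cderV f u df : f u != 0 -> cder f u df ->
  cder (fun w => (f w)^-1) u (- df / f u ^+ 2).
Proof.
move=> f0 [f1 f2].
have n0 : re (f u) ^+ 2 + im (f u) ^+ 2 != 0.
  move: f0; apply: contraNneq => /eqP.
  rewrite paddr_eq0 ?sqr_ge0 // !expf_eq0 /= => /andP[/eqP a0 /eqP b0].
  by case: (f u) a0 b0 => a b /= -> ->.
have nn : is_derive u 1 (fun w => re (f w) ^+ 2 + im (f w) ^+ 2)
    (2 * (re (f u) * re df + im (f u) * im df)).
  have h := is_deriveD (is_deriveM f1 f1) (is_deriveM f2 f2).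
  apply: (is_derive_eq h).
  by rewrite /GRing.scale /=; ring.
have nV : is_derive u 1 (fun w => (re (f w) ^+ 2 + im (f w) ^+ 2)^-1)
    (- (re (f u) ^+ 2 + im (f u) ^+ 2) ^- 2 *
       (2 * (re (f u) * re df + im (f u) * im df))).
  have h := @is_deriveV _ (fun w => re (f w) ^+ 2 + im (f w) ^+ 2) _ _ _ n0 nn.
  exact: h.
have E w : (f w)^-1 = (re (f w) * (re (f w) ^+ 2 + im (f w) ^+ 2)^-1) +i*
             (- (im (f w) * (re (f w) ^+ 2 + im (f w) ^+ 2)^-1)).
  by case: (f w).
under [X in cder X]funext do rewrite E.
have D : - df / f u ^+ 2 = (re (f u) *: (- (re (f u) ^+ 2 + im (f u) ^+ 2) ^- 2 *
       (2 * (re (f u) * re df + im (f u) * im df))) +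
   (re (f u) ^+ 2 + im (f u) ^+ 2)^-1 *: re df) +i*
  - (im (f u) *: (- (re (f u) ^+ 2 + im (f u) ^+ 2) ^- 2 *
       (2 * (re (f u) * re df + im (f u) * im df))) +
   (re (f u) ^+ 2 + im (f u) ^+ 2)^-1 *: im df).
  rewrite -exprVn E /GRing.scale /=.
  move: n0; case: (f u) => a b /= n0; case: (df) => c d /=.
  apply/eqP; rewrite eq_complex /=; apply/andP; split; apply/eqP; by field.
split; rewrite D /=; first exact: is_deriveM.
by apply: is_deriveN; exact: is_deriveM.
Qed.

End ComplexCalculus.

(** * Real integrals off a finite exceptional set *)

Section RealTools.
Context {R : realType}.
Implicit Types (a b c d u : R) (f F h : R -> R) (B : seq R).

(** The supremum of the points that P reaches from a is reached, by the intervals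
    that end there, and is b, by those that start there.  Two one-sided hypotheses
    in place of one on intervals around u suit relations that are controlled only
    between a and b, or off finitely many points. *)
Lemma cousin_lr (P : R -> R -> Prop) a b : a < b ->
  (forall x y z, a <= x -> x < y -> y < z -> z <= b -> P x y -> P y z -> P x z) ->
  (forall u, a <= u -> u < b ->
     exists2 e, 0 < e & forall c, u < c -> c < u + e -> c <= b -> P u c) ->
  (forall u, a < u -> u <= b ->
     exists2 e, 0 < e & forall c, u - e < c -> c < u -> a <= c -> P c u) ->
  P a b.
Proof.
move=> ab Ptr Pr Pl.
pose S := [set c | a < c /\ c <= b /\ P a c].
have hS : has_sup S.
  split; last by exists b => c -[_ []].
  have [e e0 He] := Pr a (lexx _) ab.
  exists (Num.min b (a + e / 2)); split.
    by rewrite lt_min ab ltrDl divr_gt0.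
  split; first by rewrite ge_min lexx.
  apply: He; rewrite ?lt_min ?ab ?ltrDl ?divr_gt0 // ?ge_min ?lexx //.
  by rewrite gt_min; apply/orP; right; rewrite ltrD2l; lra.
have [c0 Sc0] := hS.1.
have as_ : a < sup S.
  by apply: lt_le_trans (sup_upper_bound hS Sc0); case: Sc0.
have sb : sup S <= b by apply: ge_sup; [exact: hS.1|move=> c [_ []]].
have Ps : P a (sup S).
  have [e e0 He] := Pl _ as_ sb.
  have [c Sc ce] := sup_adherent e0 hS.
  have cs : c <= sup S by apply: sup_upper_bound.
  move: Sc => [ac [cb Pac]].
  move: cs; rewrite le_eqVlt => /orP[/eqP <- //|cs].
  by apply: (Ptr _ c) => //; apply: He => //; exact: ltW.
move: (sb); rewrite le_eqVlt => /orP[/eqP <- //|sb'].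
have [e e0 He] := Pr _ (ltW as_) sb'.
pose c := Num.min b (sup S + e / 2).
have sc : sup S < c by rewrite lt_min sb' ltrDl divr_gt0.
have cb : c <= b by rewrite ge_min lexx.
have Pc : P (sup S) c.
  by apply: He => //; rewrite gt_min; apply/orP; right; rewrite ltrD2l; lra.
have Sc : S c.
  split; first exact: lt_trans sc.
  by split => //; apply: (Ptr _ (sup S)).
have := sup_upper_bound hS Sc.
by rewrite leNgt sc.
Qed.

Lemma right_free B u : exists2 e, 0 < e & forall v, u < v -> v < u + e -> v \notin B.
Proof.
elim: B => [|x B [e e0 He]]; first by exists 1.
have [xu|ux] := leP x u.
  exists e => // v uv ve; rewrite inE negb_or He // andbT.
  by rewrite gt_eqF // (le_lt_trans xu).
exists (Num.min e (x - u)); first by rewrite lt_min e0 subr_gt0.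
move=> v uv; rewrite -ltrBlDl lt_min => /andP[ve vx].
rewrite inE negb_or He //; last by rewrite -ltrBlDl.
by rewrite andbT lt_eqF //; lra.
Qed.

Lemma left_free B u : exists2 e, 0 < e & forall v, u - e < v -> v < u -> v \notin B.
Proof.
have [e e0 He] := right_free (map (fun x => - x) B) (- u).
exists e => // v v1 v2; have := He (- v).
rewrite (mem_map oppr_inj); apply; lra.
Qed.

(** On the short intervals that start or end at a given point this is the usual
    mean value inequality, since such an interval contains no point of B in its
    interior; Cousin's lemma assembles them. *)
Lemma mvt_off_finite F h B (M : R) a b : a <= b ->
  {within `[a, b], continuous F} ->
  (forall u, a < u -> u < b -> u \notin B -> is_derive u 1 F (h u)) ->
  (forall u, a < u -> u < b -> u \notin B -> `|h u| <= M) ->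
  `|F b - F a| <= M * (b - a).
Proof.
rewrite le_eqVlt => /orP[/eqP <-|ab]; first by rewrite !subrr normr0 mulr0.
move=> cF dF hM.
have piece c d : a <= c -> c < d -> d <= b ->
    (forall v, c < v -> v < d -> v \notin B) -> `|F d - F c| <= M * (d - c).
  move=> ac cd db cdB.
  have [||v vcd ->] := @MVT R F h c d cd.
  - move=> v; rewrite in_itv /= => /andP[cv vd]; apply: dF.
    + exact: le_lt_trans cv.
    + exact: lt_le_trans db.
    + exact: cdB.
  - apply: continuous_subspaceW cF => v /=; rewrite !in_itv /= => /andP[cv vd].
    by rewrite (le_trans ac cv) (le_trans vd db).
  move: vcd; rewrite in_itv /= => /andP[cv vd].
  rewrite normrM (gtr0_norm (x := d - c)) ?subr_gt0 // ler_pM2r ?subr_gt0 //.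
  apply: hM; [exact: le_lt_trans cv|exact: lt_le_trans db|exact: cdB].
apply: (cousin_lr (P := fun c d => `|F d - F c| <= M * (d - c))) => //.
- move=> x y z _ _ _ _ H1 H2.
  have -> : F z - F x = (F y - F x) + (F z - F y) by ring.
  have -> : M * (z - x) = M * (y - x) + M * (z - y) by ring.
  by apply: le_trans (ler_normD _ _) _; exact: lerD.
- move=> u au ub; have [e e0 He] := right_free B u.
  exists e => // c uc ce cb; apply: piece => // v uv vc.
  by apply: He => //; exact: lt_trans ce.
- move=> u au ub; have [e e0 He] := left_free B u.
  exists e => // c uc ce cb; apply: piece => // v uv vc.
  by apply: He => //; exact: lt_trans uv.
Qed.

Notation mu := lebesgue_measure.

(** Along a path that is only piecewise smooth, or that ends at oo, the integrands
    are continuous and bounded off a finite set, and nothing is known on it. *)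
Definition pwc f B (M : R) a b := forall u, a < u -> u < b -> u \notin B ->
  {for u, continuous f} /\ `|f u| <= M.

Lemma set_seq_cons (x : R) B : [set` x :: B] = [set x] `|` [set` B].
Proof.
apply/seteqP; split => y /=; rewrite inE; first by case/orP => [/eqP|]; [left|right].
by case=> [->|->]; rewrite ?eqxx ?orbT.
Qed.

Lemma measurable_seq B : measurable ([set` B] : set R).
Proof.
elim: B => [|x B IH]; first by rewrite classical_sets.set_nil; exact: measurable0.
by rewrite set_seq_cons; apply: measurableU.
Qed.

Lemma measurable_fun_seq f B : measurable_fun ([set` B] : set R) f.
Proof.
elim: B => [|x B IH].
  by rewrite classical_sets.set_nil; exact: measurable_fun_set0.
rewrite set_seq_cons; apply/measurable_funU; [by []|exact: measurable_seq|].
by split => //; exact: measurable_fun_set1.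
Qed.

Lemma closed_seq B : closed ([set` B] : set R).
Proof.
elim: B => [|x B IH]; first by rewrite classical_sets.set_nil; exact: closed0.
by rewrite set_seq_cons; apply: closedU => //; exact: closed_eq.
Qed.

Lemma pwc_integrable f B M a b : pwc f B M a b -> mu.-integrable `[a, b] (EFin \o f).
Proof.
move=> H; pose D := a :: b :: B.
pose O := `]a, b[ `\` [set` D].
have oO : open O.
  by apply: openI; [exact: interval_open|apply: closed_openC; exact: closed_seq].
have sub : `[a, b] `<=` O `|` [set` D].
  move=> u /=; rewrite in_itv /= => /andP[au ub].
  have [uD|uD] := boolP (u \in D); [by right|left].
  split; last exact/negP.
  move: uD; rewrite /= in_itv /= !inE !negb_or => /and3P[ua uub _].
  by rewrite !lt_neqAle au ub uub eq_sym ua.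
apply: measurable_bounded_integrable => //.
- rewrite /= lebesgue_measure_itv /=; case: ifP => _ //.
  by rewrite -EFinB ltry.
- apply: (@measurable_funS _ _ _ _ (O `|` [set` D])) => //.
    by apply: measurableU; [exact: measurable_realfun.open_measurable|exact: measurable_seq].
  apply/measurable_funU; [exact: measurable_realfun.open_measurable|exact: measurable_seq|].
  split; last exact: measurable_fun_seq.
  apply: measurable_realfun.open_continuous_measurable_fun => // u.
  rewrite inE => -[/=]; rewrite in_itv /= => /andP[au ub] /negP.
  by rewrite !inE !negb_or => /and3P[_ _ uB]; case: (H u au ub uB).
- have [M' HM'] : exists M', forall u, u \in D -> `|f u| <= M'.
    elim: (D) => [|x s [N HN]]; first by exists 0.
    exists (Num.max N `|f x|) => u; rewrite inE => /orP[/eqP ->|/HN uN].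
      by rewrite le_max lexx orbT.
    by rewrite le_max uN.
  exists (Num.max M M'); split; first by rewrite num_real.
  move=> x xM u /= /sub [[/=]|/= uD].
    rewrite in_itv /= => /andP[au ub] /negP.
    rewrite !inE !negb_or => /and3P[_ _ uB].
    have [_ fM] := H u au ub uB.
    by apply: (le_trans fM); apply: ltW; apply: le_lt_trans xM; rewrite le_max lexx.
  by apply: (le_trans (HM' _ uD)); apply: ltW; apply: le_lt_trans xM; rewrite le_max lexx orbT.
Qed.

Lemma pwc_primitive f B M a b : a <= b -> pwc f B M a b ->
  let G x := \int[mu]_(t in `[a, x]) f t in
  {within `[a, b], continuous G} /\
  forall u, a < u -> u < b -> u \notin B -> is_derive u 1 G (f u).
Proof.
move=> ab H; have fi := pwc_integrable H; split.
  exact: parameterized_integral_continuous.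
move=> u au ub uB; have [cf _] := H u au ub uB.
have [d1 d2] := continuous_FTC1_closed ub fi au cf.
by apply: DeriveDef d1 _; rewrite -d2 derive1E.
Qed.

Lemma pwc_int_bound f B M a b : a <= b -> pwc f B M a b ->
  `|\int[mu]_(t in `[a, b]) f t| <= M * (b - a).
Proof.
move=> ab H; have [cG dG] := pwc_primitive ab H.
have := mvt_off_finite ab cG dG (fun u au ub uB => (H u au ub uB).2).
by rewrite set_itv1 Rintegral_set1 subr0.
Qed.

Lemma pwc_FTC F f B M a b : a <= b -> pwc f B M a b ->
  {within `[a, b], continuous F} ->
  (forall u, a < u -> u < b -> u \notin B -> is_derive u 1 F (f u)) ->
  \int[mu]_(t in `[a, b]) f t = F b - F a.
Proof.
move=> ab H cF dF; have [cG dG] := pwc_primitive ab H.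
pose G x := \int[mu]_(t in `[a, x]) f t.
have cFG : {within `[a, b], continuous (fun x => F x - G x)}.
  by move=> x; apply: cvgB; [exact: cF|exact: cG].
have dFG u : a < u -> u < b -> u \notin B -> is_derive u 1 (fun x => F x - G x) 0.
  move=> au ub uB; rewrite -(subrr (f u)).
  by apply: is_deriveB; [exact: dF|exact: dG].
have := @mvt_off_finite _ (fun=> 0) B 0 a b ab cFG dFG.
rewrite normr0 mul0r => /(_ (fun _ _ _ _ => lexx _)).
rewrite normr_le0 [G a]/G set_itv1 Rintegral_set1 subr0 -[\int[mu]_(t in _) f t]/(G b).
by rewrite subr_eq0 => /eqP <-; ring.
Qed.

End RealTools.

(** * Integrals of complex functions *)

Section ComplexIntegrals.
Context {R : realType}.
Local Notation C := R[i].
Local Notation mu := lebesgue_measure.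
Implicit Types (a b c u : R) (F h g : R -> C) (B : seq R) (M : R).

Definition cint a b h : C := cintegral `[a, b]%classic h.

Definition pwcc h B M a b := forall u, a < u -> u < b -> u \notin B ->
  ccont h u /\ normc (h u) <= M.

(** Continuity of F on [a, b] with its one-sided meaning at a and b, in a form that
    comes from estimates; ccont_within is the same in the subspace topology, as
    the fundamental theorem of calculus asks for it. *)
Definition ccont_itv F a b := forall u, a <= u <= b -> forall e, 0 < e ->
  exists2 d, 0 < d & forall v, a <= v <= b -> `|v - u| < d ->
    normc (F v - F u) < e.

Definition ccont_within F a b :=
  forall u : subspace `[a, b], ccont (F : subspace `[a, b] -> C) u.

Lemma ccont_itv_within F a b : ccont_itv F a b -> ccont_within F a b.
Proof.
move=> H.
suff [h1 h2] : {within `[a, b], continuous (fun u => re (F u))} /\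
    {within `[a, b], continuous (fun u => im (F u))}.
  by move=> u; split; [exact: h1|exact: h2].
split; apply/subspace_continuousP => u /= uab; apply/cvgrPdist_lt => e e0;
  have [d d0 Hd] := H u uab e e0; apply/nbhs_ballP; exists d => //= v vd vab;
  rewrite distrC -?reN -?reD -?imN -?imD.
- by apply: (le_lt_trans (le_norm_re _)); apply: Hd => //; rewrite distrC.
- by apply: (le_lt_trans (le_norm_im _)); apply: Hd => //; rewrite distrC.
Qed.

Lemma pwcc_pwc h B M a b : pwcc h B M a b ->
  pwc (fun u => re (h u)) B M a b /\ pwc (fun u => im (h u)) B M a b.
Proof.
move=> H; split => u au ub uB; have [[c1 c2] hM] := H u au ub uB; split => //.
  exact: le_trans (le_norm_re _) hM.
exact: le_trans (le_norm_im _) hM.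
Qed.

Lemma pwccW h B B' M M' a b a' b' : a <= a' -> b' <= b -> M <= M' -> {subset B <= B'} ->
  pwcc h B M a b -> pwcc h B' M' a' b'.
Proof.
move=> aa bb MM BB H u au ub uB.
have [|? ?] := H u (le_lt_trans aa au) (lt_le_trans ub bb).
  by apply: contra uB => /BB.
by split => //; apply: le_trans MM.
Qed.

Lemma cint_bound h B M a b : a <= b -> pwcc h B M a b ->
  normc (cint a b h) <= 2 * M * (b - a).
Proof.
move=> ab /pwcc_pwc [H1 H2]; apply: (le_trans (normc_le_reim _)).
have -> : 2 * M * (b - a) = M * (b - a) + M * (b - a) by ring.
exact: lerD (pwc_int_bound ab H1) (pwc_int_bound ab H2).
Qed.

Lemma cint_FTC F h B M a b : a <= b -> pwcc h B M a b -> ccont_within F a b ->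
  (forall u, a < u -> u < b -> u \notin B -> cder F u (h u)) ->
  cint a b h = F b - F a.
Proof.
move=> ab /pwcc_pwc [H1 H2] cF dF.
have := pwc_FTC ab H1 (fun u => (cF u).1) (fun u au ub uB => (dF u au ub uB).1).
have := pwc_FTC ab H2 (fun u => (cF u).2) (fun u au ub uB => (dF u au ub uB).2).
rewrite /cint /cintegral => -> ->.
by apply/eqP; rewrite eq_complex /= reD imD reN imN !eqxx.
Qed.

Lemma cint_split h B M a b c : a <= b -> b <= c -> pwcc h B M a c ->
  cint a c h = cint a b h + cint b c h.
Proof.
move=> ab bc H.
have split_re (f : R -> R) : pwc f B M a c ->
    \int[mu]_(t in `[a, c]) f t =
    \int[mu]_(t in `[a, b]) f t + \int[mu]_(t in `[b, c]) f t.
  move=> Hf; have fi := pwc_integrable Hf.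
  have fbc : mu.-integrable `]b, c] (EFin \o f).
    apply: integrableS fi => //; exact: subset_itvr.
  rewrite -(Rintegral_itv_obnd_cbnd fbc) -(@Rintegral_itvB _ _ _ _ b fi) ?bnd_simp //.
  by rewrite addrC subrK.
have [H1 H2] := pwcc_pwc H.
apply/eqP; rewrite eq_complex reD imD /=.
by rewrite (split_re _ H1) (split_re _ H2) !eqxx.
Qed.

Lemma cintegral_oo h B M a b : pwcc h B M a b ->
  cintegral `]a, b[%classic h = cint a b h.
Proof.
have oo (f : R -> R) : pwc f B M a b ->
    \int[mu]_(t in `]a, b[) f t = \int[mu]_(t in `[a, b]) f t.
  move=> Hf; have fi := pwc_integrable Hf.
  have fi1 : mu.-integrable `]a, b] (EFin \o f).
    by apply: integrableS fi => //; apply: subset_itvr; rewrite bnd_simp.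
  have fi2 : mu.-integrable `]a, b[ (EFin \o f).
    by apply: integrableS fi1 => //; apply: subset_itvl; rewrite bnd_simp.
  by rewrite (Rintegral_itv_bndo_bndc fi2) (Rintegral_itv_obnd_cbnd fi1).
by move=> /pwcc_pwc [H1 H2]; rewrite /cint /cintegral oo // oo.
Qed.

Lemma pwccZ (k : C) h B M a b : pwcc h B M a b ->
  pwcc (fun u => k * h u) B (normc k * M) a b.
Proof.
move=> H u au ub uB; have [c1 m1] := H u au ub uB.
split; first by apply: ccontM => //; exact: ccont_cst.
by rewrite normcM ler_wpM2l // normc_ge0.
Qed.

Lemma cintD h g B M M' a b : pwcc h B M a b -> pwcc g B M' a b ->
  cint a b (fun u => h u + g u) = cint a b h + cint a b g.
Proof.
move=> /pwcc_pwc [H1 H2] /pwcc_pwc [G1 G2]; apply/eqP; rewrite eq_complex reD imD /=.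
rewrite -(RintegralD _ (pwc_integrable H1) (pwc_integrable G1)) //.
rewrite -(RintegralD _ (pwc_integrable H2) (pwc_integrable G2)) //.
apply/andP; split; apply/eqP; apply: eq_Rintegral => u _; first by rewrite reD.
by rewrite imD.
Qed.

Lemma cintZ (k : C) h B M a b : pwcc h B M a b ->
  cint a b (fun u => k * h u) = k * cint a b h.
Proof.
move=> H; have [H1 H2] := pwcc_pwc H.
have i1 := pwc_integrable H1; have i2 := pwc_integrable H2.
have Z (r : R) (f : R -> R) : mu.-integrable `[a, b] (EFin \o f) ->
    mu.-integrable `[a, b] (EFin \o (fun u => r * f u)).
  move=> fi.
  rewrite (_ : EFin \o _ = (fun x => r%:E * (EFin \o f) x)%E) //.
  by apply: integrableZl.
apply/eqP; rewrite eq_complex reM imM /=.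
rewrite -!(RintegralZl _ _ i1) // -!(RintegralZl _ _ i2) //.
rewrite -(RintegralB _ (Z _ _ i1) (Z _ _ i2)) //.
rewrite -(RintegralD _ (Z _ _ i2) (Z _ _ i1)) //.
apply/andP; split; apply/eqP; apply: eq_Rintegral => u _; first by rewrite reM.
by rewrite imM.
Qed.

Lemma cintB h g B M M' a b : pwcc h B M a b -> pwcc g B M' a b ->
  cint a b (fun u => h u - g u) = cint a b h - cint a b g.
Proof.
move=> H G; have G' := pwccZ (-1) G.
rewrite -[X in _ = _ + X]mulN1r -(cintZ _ G) -(cintD H G').
by congr cintegral; apply/funext => u; rewrite mulN1r.
Qed.

Lemma cint_eq0 h B a b : a <= b ->
  (forall u, a < u -> u < b -> u \notin B -> \forall v \near u, h v = 0) ->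
  cint a b h = 0.
Proof.
move=> ab H; have : pwcc h B 0 a b.
  move=> u au ub uB; have N := H u au ub uB; split.
    by apply: ccont_near (ccont_cst 0 u); apply: filterS N => v.
  by rewrite (nbhs_singleton N) normc0.
move=> /(cint_bound ab); rewrite mulr0 mul0r => h0.
by apply: eq0_normc; apply: le_anti; rewrite h0 normc_ge0.
Qed.

Lemma cint_primitive h B M a b : a <= b -> pwcc h B M a b ->
  ccont_itv (fun x => cint a x h) a b /\
  forall u, a < u -> u < b -> u \notin B -> cder (fun x => cint a x h) u (h u).
Proof.
move=> ab H; have M0 : 0 <= `|M| by [].
have MM : M <= `|M| by exact: ler_norm.
have H' := pwccW (lexx a) (lexx b) MM (fun x xB => xB) H.
split; last first.
  move=> u au ub uB; have [H1 H2] := pwcc_pwc H.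
  have [_ d1] := pwc_primitive ab H1; have [_ d2] := pwc_primitive ab H2.
  by split => /=; [exact: d1|exact: d2].
move=> u /andP[au ub] e e0; exists (e / (2 * `|M| + 1)).
  by rewrite divr_gt0 // ltr_wpDl // mulr_ge0.
have lip x y : a <= x -> x <= y -> y <= b ->
    normc (cint a y h - cint a x h) <= 2 * `|M| * (y - x).
  move=> ax xy yb; rewrite (cint_split ax xy (pwccW (lexx a) yb MM (fun x xB => xB) H)).
  rewrite addrC addKr; apply: cint_bound => //.
  exact: (pwccW ax yb (lexx _) (fun x xB => xB) H').
move=> v /andP[av vb] uv.
have : normc (cint a v h - cint a u h) <= 2 * `|M| * `|v - u|.
  have [uv'|vu] := leP u v; first by rewrite (ger0_norm (x := v - u)) ?subr_ge0 //; exact: lip.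
  by rewrite normcB distrC (gtr0_norm (x := u - v)) ?subr_gt0 //; apply: lip => //; exact: ltW.
move/le_lt_trans; apply.
move: uv; rewrite ltr_pdivlMr; last by rewrite ltr_wpDl // mulr_ge0.
apply: le_lt_trans; rewrite mulrC ler_wpM2l //.
by rewrite lerDl.
Qed.

Lemma cint_rev h B M : pwcc h B M 0 1 ->
  cint 0 1 (fun u => - h (1 - u)) = - cint 0 1 h.
Proof.
move=> H; have [cG dG] := cint_primitive ler01 H.
pose B' := map (fun x => 1 - x) B.
have cont1 (u : R) : {for u, continuous (fun v : R => 1 - v)}.
  by apply: cvgB; [exact: cvg_cst|exact: cvg_id].
have nB u : u \notin B' -> 1 - u \notin B.
  by apply: contra => uB; apply/mapP; exists (1 - u); rewrite // opprB addrC subrK.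
rewrite (@cint_FTC (fun u => cint 0 (1 - u) h) _ B' M) //.
- rewrite subrr subr0.
  have -> : cint 0 0 h = 0 by rewrite /cint /cintegral set_itv1 !Rintegral_set1.
  by rewrite sub0r.
- move=> u u0 u1 /nB uB; have [|||c1 m1] := H (1 - u).
  + by rewrite subr_gt0.
  + by rewrite ltrBlDr ltrDl.
  + exact: uB.
  split; last by rewrite normcN.
  by apply: ccontN; apply: (ccont_comp (h := h)).
- apply: ccont_itv_within => u /andP[u0 u1] e e0; have [|d d0 Hd] := cG (1 - u) _ e e0.
    by rewrite subr_ge0 u1 lerBlDr lerDl.
  exists d => // v /andP[v0 v1] uv; apply: Hd.
    by rewrite subr_ge0 v1 lerBlDr lerDl.
  by rewrite opprB addrC addrA subrK distrC.
- move=> u u0 u1 /nB uB; have [|||d1 d2] := dG (1 - u).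
  + by rewrite subr_gt0.
  + by rewrite ltrBlDr ltrDl.
  + exact: uB.
  have d : is_derive u 1 (fun v : R => 1 - v) (-1 : R).
    rewrite -[X in is_derive _ _ _ X]sub0r.
    exact: is_deriveB.
  split; rewrite ?reN ?imN -mulrN1.
    exact: (is_derive1_comp (f := fun x => re (cint 0 x h))).
  exact: (is_derive1_comp (f := fun x => im (cint 0 x h))).
Qed.

End ComplexIntegrals.

(** * Forms exp y (A dx + B dy) along paths *)

Section Paths.
Context {R : realType}.
Local Notation C := R[i].
Local Notation PC := {poly {poly C}}.
Implicit Types (sg : R -> option (C * C)) (u : R) (A B G : PC).

Lemma hornerXY_X A (c : {poly C}) (x y : C) :
  (A * 'X + c%:P).[x, y] = A.[x, y] * x + c.[y].
Proof. by rewrite hornerMXaddC hornerD hornerM hornerC. Qed.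

Lemma hornerXY0 (x y : C) : (0 : PC).[x, y] = 0.
Proof. by rewrite !horner0. Qed.

Lemma hornerXYD A B (x y : C) : (A + B).[x, y] = A.[x, y] + B.[x, y].
Proof. by rewrite !hornerD. Qed.

Lemma hornerXYM A B (x y : C) : (A * B).[x, y] = A.[x, y] * B.[x, y].
Proof. by rewrite !hornerM. Qed.

Lemma ccont_ev (T : topologicalType) G (f g : T -> C) t :
  ccont f t -> ccont g t -> ccont (fun w => G.[f w, g w]) t.
Proof.
move=> cf cg; elim/poly_ind: G => [|G c IH].
  by under [X in ccont X]funext do rewrite hornerXY0; exact: ccont_cst.
under [X in ccont X]funext do rewrite hornerXY_X.
by apply: ccontD; [exact: ccontM|exact: ccont_poly].
Qed.

Definition pdx G : PC := G^`().
Definition pdy G : PC := map_poly (@deriv C) G.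

Lemma pdyD A (c : {poly C}) : pdy (A * 'X + c%:P) = pdy A * 'X + (c^`())%:P.
Proof.
rewrite /pdy raddfD /= map_polyC /=; congr (_ + _).
by apply/polyP => i; rewrite coef_map /= !coefMX; case: i => [|i] /=;
  rewrite ?linear0 // coef_map.
Qed.

Lemma cder_ev G (f g : R -> C) u df dg : cder f u df -> cder g u dg ->
  cder (fun w => G.[f w, g w]) u
    ((pdx G).[f u, g u] * df + (pdy G).[f u, g u] * dg).
Proof.
move=> cf cg; elim/poly_ind: G => [|G c IH].
  under [X in cder X]funext do rewrite hornerXY0.
  rewrite /pdx /pdy linear0 raddf0 !hornerXY0 !mul0r addr0.
  exact: cder_cst.
under [X in cder X]funext do rewrite hornerXY_X.
apply: (cder_eq (cderD (cderM IH cf) (cder_poly c cg))).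
rewrite pdyD /pdx derivD derivM derivX derivC addr0 mulr1.
rewrite !hornerXYD !hornerXYM !hornerX !hornerC; ring.
Qed.

Definition px sg u : C := if sg u is Some p then p.1 else 0.
Definition py sg u : C := if sg u is Some p then p.2 else 0.

Definition integrand A B sg u : C :=
  cexp (py sg u) * (A.[px sg u, py sg u] * cderive (px sg) u +
                    B.[px sg u, py sg u] * cderive (py sg) u).

(** A C^1 condition at u alone: the path is differentiable near u, with a
    derivative that is continuous at u. This is what integrals need off a finite
    set, and it makes the path finite (in U) near u. *)
Definition path_C1 sg u := exists X Y X' Y' : R -> C,
  [/\ \forall v \near u, sg v = Some (X v, Y v),
      \forall v \near u, cder X v (X' v) /\ cder Y v (Y' v),
      ccont X' u & ccont Y' u].

Lemma path_C1P sg u : path_C1 sg u -> exists X Y X' Y' : R -> C,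
  [/\ \forall v \near u, [/\ sg v = Some (X v, Y v), px sg v = X v, py sg v = Y v,
         cderive (px sg) v = X' v & cderive (py sg) v = Y' v],
      cder X u (X' u), cder Y u (Y' u), ccont X' u & ccont Y' u].
Proof.
move=> [X] [Y] [X'] [Y'] [E D cX cY]; exists X, Y, X', Y'.
have [dX dY] := nbhs_singleton D; split => //.
have E2 : \forall v \near u, \forall w \near v, sg w = Some (X w, Y w).
  by apply: near_join.
near=> v.
have Ev : sg v = Some (X v, Y v) by near: v.
have E2v : \forall w \near v, sg w = Some (X w, Y w) by near: v.
have [dXv dYv] : cder X v (X' v) /\ cder Y v (Y' v) by near: v.
split; rewrite /px /py ?Ev //.
  by apply/cder_derive/(cder_near _ dXv); apply: filterS E2v => w ->.
by apply/cder_derive/(cder_near _ dYv); apply: filterS E2v => w ->.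
Unshelve. all: by end_near. Qed.

Lemma path_C1_cder sg u : path_C1 sg u ->
  cder (px sg) u (cderive (px sg) u) /\ cder (py sg) u (cderive (py sg) u).
Proof.
move=> /path_C1P [X] [Y] [X'] [Y'] [E dX dY _ _].
have [_ _ _ -> ->] := nbhs_singleton E.
by split; [apply: cder_near dX|apply: cder_near dY]; apply: filterS E => v [].
Qed.

Lemma path_C1_ccont_der sg u : path_C1 sg u ->
  ccont (cderive (px sg)) u /\ ccont (cderive (py sg)) u.
Proof.
move=> /path_C1P [X] [Y] [X'] [Y'] [E dX dY cX cY].
by split; [apply: ccont_near cX|apply: ccont_near cY]; apply: filterS E => v [].
Qed.

Lemma path_C1_some sg u : path_C1 sg u -> \forall v \near u, sg v = Some (px sg v, py sg v).
Proof.
move=> /path_C1P [X] [Y] [X'] [Y'] [E _ _ _ _].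
by apply: filterS E => v [-> -> -> _ _].
Qed.

Lemma path_C1_ccont A B sg u : path_C1 sg u -> ccont (integrand A B sg) u.
Proof.
move=> g; have [dx dy] := path_C1_cder g; have [cx' cy'] := path_C1_ccont_der g.
have cx := cder_cont dx; have cy := cder_cont dy.
apply: ccontM; first exact: ccont_exp.
by apply: ccontD; apply: ccontM => //; apply: ccont_ev.
Qed.

(** The primitive of exp y (dg + g dy), extended by 0 at oo: the extension is
    continuous along admissible simplices, because exp y decays faster there than
    g grows. *)
Definition pval G (p : option (C * C)) : C :=
  if p is Some p then G.[p.1, p.2] * cexp p.2 else 0.

Lemma path_C1_pval G sg u : path_C1 sg u ->
  cder (fun v => pval G (sg v)) u (integrand (pdx G) (pdy G + G) sg u).
Proof.
move=> g; have [dx dy] := path_C1_cder g.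
have := cderM (cder_ev G dx dy) (cder_exp dy).
move/cder_eq => /(_ _ _) H; apply: cder_near (H _ _).
  by apply: filterS (path_C1_some g) => v ->.
by rewrite /integrand hornerXYD; ring.
Qed.

Lemma integrandD A B A' B' sg u :
  integrand (A + A') (B + B') sg u = integrand A B sg u + integrand A' B' sg u.
Proof. by rewrite /integrand !hornerXYD; ring. Qed.

Lemma path_C1_integrand0 G (c e1 e2 : PC) sg u : path_C1 sg u ->
  (\forall v \near u, G.[px sg v, py sg v] = 0) ->
  integrand (c * pdx G + G * e1) (c * pdy G + G * e2) sg u = 0.
Proof.
move=> g G0; have [dx dy] := path_C1_cder g.
have d1 := cder_ev G dx dy.
have d2 : cder (fun v => G.[px sg v, py sg v]) u 0.
  by apply: cder_near (cder_cst 0 u); apply: filterS G0 => v ->.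
have E : (pdx G).[px sg u, py sg u] * cderive (px sg) u +
         (pdy G).[px sg u, py sg u] * cderive (py sg) u = 0.
  by rewrite -(cder_derive d1) (cder_derive d2).
rewrite /integrand !hornerXYD !hornerXYM (nbhs_singleton G0) !mul0r !addr0.
by rewrite -!mulrA -mulrDr E !mulr0.
Qed.

End Paths.

(** * Simplices and the lines in them *)

Section Simplices.
Context {R : realType}.
Local Notation C := R[i].
Variable n : nat.
Local Notation V := ('rV[R]_n.+1).
Implicit Types (s : @sing R n) (v : @splx R n) (w p q : V) (a : 'I_n.+1 -> @splx R n).

(** Simplices as partial functions on the whole vector space, where one can speak
    of lines and of neighbourhoods. *)
Definition spt s w : option (C * C) := obind s (insub w).

Lemma spt_val s v : spt s (val v) = s v.
Proof. by rewrite /spt valK. Qed.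

Lemma in_splxP w : reflect ((forall i, 0 <= w 0 i) /\ \sum_i w 0 i = 1) (in_splx w).
Proof.
apply: (iffP andP) => [[/forallP ? /eqP ?]|[? ?]]; split => //; first exact/forallP.
exact/eqP.
Qed.

Lemma in_splx_convex w w' (c : R) : 0 <= c <= 1 -> in_splx w -> in_splx w' ->
  in_splx ((1 - c) *: w + c *: w').
Proof.
move=> /andP[c0 c1] /in_splxP [w0 w1] /in_splxP [w0' w1']; apply/in_splxP; split.
  by move=> i; rewrite !mxE addr_ge0 // mulr_ge0 // subr_ge0.
under eq_bigr do rewrite !mxE.
by rewrite big_split /= -!mulr_sumr w1 w1'; ring.
Qed.

Definition cell a : set V :=
  [set w | exists2 u : V, in_splx u & w = \sum_i u 0 i *: val (a i)].

Lemma cellP a v : affine_splx a v <-> cell a (val v).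
Proof.
split=> [[u ->]|[u uS E]]; first by exists (val u) => //; exact: valP.
by exists (Sub u uS); rewrite SubK.
Qed.

Lemma cell_in_splx a w : cell a w -> in_splx w.
Proof.
move=> [u /in_splxP [u0 u1] ->]; apply/in_splxP; split.
  move=> i; rewrite summxE sumr_ge0 // => j _; rewrite mxE mulr_ge0 //.
  by have /in_splxP [] := valP (a j).
under eq_bigr do rewrite summxE.
rewrite exchange_big /= -{}u1; apply: eq_bigr => j _.
under eq_bigr do rewrite mxE.
by rewrite -mulr_sumr; have /in_splxP [_ ->] := valP (a j); rewrite mulr1.
Qed.

Lemma cell_convex a w w' (c : R) : 0 <= c <= 1 -> cell a w -> cell a w' ->
  cell a ((1 - c) *: w + c *: w').
Proof.
move=> c01 [u us ->] [u' us' ->]; exists ((1 - c) *: u + c *: u').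
  exact: in_splx_convex.
rewrite !scaler_sumr -big_split /=; apply: eq_bigr => i _.
by rewrite !mxE !scalerA -scalerDl.
Qed.

Lemma sum_continuous (T : topologicalType) (W : normedModType R) (I : Type)
  (r : seq I) (f : I -> T -> W) :
  (forall i, continuous (f i)) -> continuous (fun t => \sum_(i <- r) f i t).
Proof.
move=> cf; elim: r => [|i r IH] t.
  rewrite (_ : (fun _ => _) = (fun=> 0)); first exact: cst_continuous.
  by apply/funext => ?; rewrite big_nil.
rewrite (_ : (fun _ => _) = (fun t => f i t + \sum_(j <- r) f j t)).
  exact: continuousD (cf i t) (IH t).
by apply/funext => ?; rewrite big_cons.
Qed.

Lemma splx_compact : compact [set w : V | in_splx w].
Proof.
have -> : [set w : V | in_splx w] =
  [set w : V | forall i, `[0, 1]%classic (w ord0 i)] `&` [set w | \sum_i w ord0 i = 1].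
  apply/seteqP; split => w /=.
    move=> /in_splxP [w0 w1]; split=> // i; rewrite in_itv /= w0 /=.
    by rewrite -w1 (bigD1 i) //= lerDl sumr_ge0.
  move=> [w0 w1]; apply/in_splxP; split => // i.
  by have := w0 i; rewrite in_itv /= => /andP[].
apply: compact_closedI.
  by apply: (@rV_compact R n.+1 (fun=> `[0, 1]%classic)) => i; exact: segment_compact.
apply: (preimage_closed (f := fun w : V => \sum_i w ord0 i) (D := [set 1 : R])).
  move=> w _; apply: (@sum_continuous _ R _ _ (fun i (w : V) => w ord0 i)) => i.
  exact: coord_continuous.
exact: closed_eq.
Qed.

Lemma cell_closed a : closed (cell a).
Proof.
have -> : cell a = (fun u : V => \sum_i u 0 i *: val (a i)) @` [set w : V | in_splx w].
  by apply/seteqP; split => w /= [u uS E]; exists u.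
apply: compact_closed; first exact: norm_hausdorff.
apply: continuous_compact; last exact: splx_compact.
apply: continuous_subspaceT.
apply: (@sum_continuous _ V _ _ (fun i (u : V) => u 0 i *: val (a i))) => i u.
apply: (@continuousZr_tmp _ _ _ (fun u : V => u 0 i)); exact: coord_continuous.
Qed.

(** Lines p + c u q; the factor c keeps the direction q fixed while the speed
    varies, which is what makes estimates uniform in c possible. *)
Definition line p q (c : R) (u : R) : V := p + (c * u) *: q.

Lemma line_convex p q c x y z : x < y -> y < z -> exists2 e : R, 0 <= e <= 1 &
  line p q c y = (1 - e) *: line p q c x + e *: line p q c z.
Proof.
move=> xy yz; have xz : 0 < z - x by rewrite subr_gt0 (lt_trans xy).
exists ((y - x) / (z - x)).
  apply/andP; split; first by apply: divr_ge0; rewrite ?(ltW xz) // subr_ge0 ltW.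
  by rewrite ler_pdivrMr // mul1r lerD2r ltW.
rewrite /line !scalerDr !scalerA addrACA -scalerDl subrK scale1r -scalerDl.
by congr (_ + _ *: _); field; rewrite gt_eqF.
Qed.

Lemma line_continuous p q c : continuous (line p q c).
Proof.
move=> u; have h1 : {for u, continuous (fun u : R => c * u)}.
  by apply: continuousM; [exact: cst_continuous|exact: cvg_id].
have h2 : {for u, continuous (fun=> p : V)} by exact: cst_continuous.
exact: (continuousD h2 (continuousZr_tmp (a := q) h1)).
Qed.

(** The line meets each simplex in an interval, by convexity; the exceptional
    parameters are the ends of these intervals. *)
Lemma line_cover m (aa : 'I_m -> 'I_n.+1 -> @splx R n) p q c x y :
  (forall u, x < u -> u < y -> exists j, cell (aa j) (line p q c u)) ->
  exists B : seq R, forall u, x < u -> u < y -> u \notin B ->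
    exists j, \forall u' \near u, cell (aa j) (line p q c u').
Proof.
move=> H; pose I j := [set u | [/\ x < u, u < y & cell (aa j) (line p q c u)]].
exists ([seq sup (I j) | j : 'I_m] ++ [seq inf (I j) | j : 'I_m]).
move=> u xu uy; rewrite mem_cat negb_or => /andP[/fintype.imageP uB1 /fintype.imageP uB2].
have [j Kj] := H u xu uy; exists j.
have Iu : I j u by [].
have hs : has_sup (I j) by split; [exists u|exists y => z [_ /ltW]].
have hi : has_inf (I j) by split; [exists u|exists x => z [/ltW]].
have us : u < sup (I j).
  rewrite lt_neqAle (sup_upper_bound hs Iu) andbT.
  by apply/eqP => E; apply: uB1; exists j.
have iu : inf (I j) < u.
  rewrite lt_neqAle (ge_inf hi.2 Iu) andbT.
  by apply/eqP => E; apply: uB2; exists j.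
have [z [xz zy Kz] uz] := sup_gt hs.1 us.
have [z' [xz' zy' Kz'] uz'] := inf_lt hi.1 iu.
have : u \in `]z', z[%R by rewrite in_itv /= uz' uz.
move/near_in_itvoo; apply: filterS => u'; rewrite in_itv /= => /andP[h1 h2].
have [e e01 ->] := line_convex p q c h1 h2.
exact: cell_convex.
Qed.

End Simplices.

(** * Lines in a chart *)

Section Charts.
Context {R : realType}.
Local Notation C := R[i].
Local Notation PC := {poly {poly C}}.
Variable n : nat.
Local Notation V := ('rV[R]_n.+1).
Implicit Types (s : @sing R n) (w p q : V) (aa : 'I_n.+1 -> @splx R n).
Implicit Types (X Y DX DY a b : V -> C) (A B : PC).

Lemma line_is_derive (f : V -> R) p q (c u : R) : derivable f (line p q c u) q ->
  is_derive u 1 (fun v => f (line p q c v)) (c * 'D_q f (line p q c u)).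
Proof.
move=> df; pose g (x : R) := f (p + x *: q).
have E (x : R) : (fun h : R => h^-1 *: (g (h *: (1 : R) + x) - g x)) =
    (fun h : R => h^-1 *: (f (h *: q + (p + x *: q)) - f (p + x *: q))).
  apply/funext => h; rewrite /g; congr (_ *: (f _ - _)).
  by rewrite [h *: 1]mulr1 scalerDl addrCA.
have dg : is_derive (c * u) (1 : R) g ('D_q f (p + (c * u) *: q)).
  apply: DeriveDef.
    by rewrite /derivable E.
  by rewrite /derive E.
have d2 : is_derive u (1 : R) (fun v : R => c * v) c.
  have h := @is_deriveM R R (fun=> c) id u (1 : R) 0 1 (is_derive_cst _ _ _) (is_derive_id _ _).
  by apply: is_derive_eq h _; rewrite /GRing.scale /= mulr0 mulr1 addr0.
by rewrite mulrC; exact: (is_derive1_comp (f := g)).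
Qed.

(** X is C^1 near w in the direction q, with derivative DX: what survives of
    smoothness along the lines of direction q. *)
Definition C1at q w X DX := \forall w' \near w,
  [/\ ccont X w', ccont DX w' & forall p c u, line p q c u = w' ->
     cder (fun v => X (line p q c v)) u (c%:C * DX w')].

Definition dirder a q w : C :=
  ('D_q (fun w => re (a w)) w) +i* ('D_q (fun w => im (a w)) w).

Lemma Csmooth_C1at a q w : Csmooth a -> C1at q w a (dirder a q).
Proof.
move=> /(_ 1%N) [[cr /(_ q) [dr [cdr _]]] [ci /(_ q) [di [cdi _]]]].
apply: (@filterE _ (nbhs w)) => w'; split; [by split; [exact: cr|exact: ci]| |].
  by split; [exact: cdr|exact: cdi].
move=> p c u <-; split.
  by rewrite reM /= mul0r subr0; exact: line_is_derive.
by rewrite imM /= mul0r addr0; exact: line_is_derive.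
Qed.

Lemma C1at_near q w X DX : C1at q w X DX -> \forall w' \near w, C1at q w' X DX.
Proof. exact: near_join. Qed.

Lemma C1at_ccont q w X DX : C1at q w X DX -> ccont X w /\ ccont DX w.
Proof. by move/nbhs_singleton => []. Qed.

Lemma C1atM q w X DX Y DY : C1at q w X DX -> C1at q w Y DY ->
  C1at q w (fun v => X v * Y v) (fun v => DX v * Y v + X v * DY v).
Proof.
move=> H1 H2; apply: filterS2 H1 H2 => v [x1 x2 x3] [y1 y2 y3]; split; first exact: ccontM.
  by apply: ccontD; exact: ccontM.
move=> p c u E; apply: (cder_eq (cderM (x3 p c u E) (y3 p c u E))).
by rewrite E; ring.
Qed.

Lemma C1atV q w X DX : C1at q w X DX -> X w != 0 ->
  C1at q w (fun v => (X v)^-1) (fun v => - DX v / X v ^+ 2).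
Proof.
move=> H X0; have [cX _] := C1at_ccont H; have N0 := near_ccont_neq0 cX X0.
apply: filterS2 H N0 => v [x1 x2 x3] Xv; split; first exact: ccontV.
  by apply: ccontM; [exact: ccontN|apply: ccontV; [rewrite expf_neq0|exact: ccontX]].
move=> p c u E; have := cderV _ (x3 p c u E); rewrite E => /(_ Xv) H'.
by apply: (cder_eq H'); ring.
Qed.

Definition speed A B X DX Y DY w : C :=
  cexp (Y w) * (A.[X w, Y w] * DX w + B.[X w, Y w] * DY w).

Lemma ccont_speed A B q w X DX Y DY : C1at q w X DX -> C1at q w Y DY ->
  ccont (speed A B X DX Y DY) w.
Proof.
move=> /C1at_ccont [x1 x2] /C1at_ccont [y1 y2]; apply: ccontM; first exact: ccont_exp.
by apply: ccontD; apply: ccontM => //; exact: ccont_ev.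
Qed.

Lemma near_line p q c u (P : V -> Prop) :
  (\forall w \near line p q c u, P w) -> \forall v \near u, P (line p q c v).
Proof. exact: line_continuous. Qed.

(** The speed c enters the integrand as a factor, which is why the bounds below
    depend only on the direction q. *)
Lemma chart_C1 A B s (K : set V) q X DX Y DY p c u :
  C1at q (line p q c u) X DX -> C1at q (line p q c u) Y DY ->
  (\forall w \near line p q c u, K w -> spt s w = Some (X w, Y w)) ->
  (\forall v \near u, K (line p q c v)) ->
  path_C1 (fun v => spt s (line p q c v)) u /\
  integrand A B (fun v => spt s (line p q c v)) u =
    c%:C * speed A B X DX Y DY (line p q c u).
Proof.
move=> HX HY rep KK.
have cl := @line_continuous R n p q c u.
have G : path_C1 (fun v => spt s (line p q c v)) u.
  exists (fun v => X (line p q c v)), (fun v => Y (line p q c v)),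
    (fun v => c%:C * DX (line p q c v)), (fun v => c%:C * DY (line p q c v)); split.
  - move/near_line: rep => rep.
    by apply: filterS2 KK rep => v Kv; apply.
  - have /near_line HX' := HX; have /near_line HY' := HY.
    by apply: filterS2 HX' HY' => v [_ _ h1] [_ _ h2]; split; [exact: h1|exact: h2].
  - apply: ccontM; first exact: ccont_cst.
    by apply: (ccont_comp cl); case: (C1at_ccont HX).
  - apply: ccontM; first exact: ccont_cst.
    by apply: (ccont_comp cl); case: (C1at_ccont HY).
split => //.
have E : \forall v \near u, spt s (line p q c v) = Some (X (line p q c v), Y (line p q c v)).
  by move/near_line: rep => rep; apply: filterS2 KK rep => v Kv; apply.
have [_ _ dX] := nbhs_singleton HX; have [_ _ dY] := nbhs_singleton HY.
have Eu := nbhs_singleton E.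
set sg := (fun v => spt s (line p q c v)).
have Ex : px sg u = X (line p q c u) by rewrite /px /sg Eu.
have Ey : py sg u = Y (line p q c u) by rewrite /py /sg Eu.
rewrite /integrand /speed Ex Ey.
rewrite (@cder_derive _ (px _) u (c%:C * DX (line p q c u))); last first.
  by apply: cder_near (dX p c u erefl); apply: filterS E => v; rewrite /px /sg => ->.
rewrite (@cder_derive _ (py _) u (c%:C * DY (line p q c u))); last first.
  by apply: cder_near (dY p c u erefl); apply: filterS E => v; rewrite /py /sg => ->.
by ring.
Qed.

Lemma chart_bound A B s (K : set V) q w0 X DX Y DY :
  C1at q w0 X DX -> C1at q w0 Y DY ->
  (\forall w \near w0, K w -> spt s w = Some (X w, Y w)) ->
  exists M, \forall w \near w0, forall p c u, `|c| <= 1 -> line p q c u = w ->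
  (\forall v \near u, K (line p q c v)) ->
  path_C1 (fun v => spt s (line p q c v)) u /\
  normc (integrand A B (fun v => spt s (line p q c v)) u) <= M.
Proof.
move=> HX HY rep.
exists (normc (speed A B X DX Y DY w0) + 1).
have /ccontP /(_ 1 ltr01) cS := ccont_speed A B HX HY.
have HX' := C1at_near HX; have HY' := C1at_near HY.
have /near_join rep' := rep.
apply: filterS2 (filterI HX' HY') (filterI rep' cS) => w [hX hY] [hr hc] p c u c1 E KK.
subst w; have [G ->] := chart_C1 A B hX hY hr KK; split => //.
rewrite normcM normcR.
apply: (@le_trans _ _ (1 * normc (speed A B X DX Y DY (line p q c u)))).
  by rewrite ler_wpM2r // normc_ge0.
rewrite mul1r -[X in normc X](subrK (speed A B X DX Y DY w0)) addrC.
by apply: (le_trans (le_normcD _ _)); rewrite lerD2l ltW.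
Qed.

End Charts.

(** * Behaviour near oo *)

Section NearInfinity.
Context {R : realType}.
Local Notation C := R[i].
Local Notation PC := {poly {poly C}}.

Lemma cubicE (K : comNzRingType) (l x : K) : (cubic l).[x] = x * (x - 1) * (x - l).
Proof. by rewrite /cubic !hornerE. Qed.

Lemma poly_growth (c : {poly C}) : exists K D, 0 <= D /\
  forall w, w != 0 -> normc w <= 1 -> normc c.[w^-1] * normc w ^+ K <= D.
Proof.
elim/poly_ind: c => [|c d [K [D [D0 H]]]].
  by exists 0%N, 0; split => // w _ _; rewrite horner0 normc0 mul0r.
exists K.+1, (D + normc d); split; first by rewrite addr_ge0 // normc_ge0.
move=> w w0 w1; have nw : 0 < normc w by rewrite normc_gt0.
rewrite hornerMXaddC.
apply: (@le_trans _ _ ((normc c.[w^-1] * (normc w)^-1 + normc d) * normc w ^+ K.+1)).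
  by rewrite ler_wpM2r ?exprn_ge0 ?normc_ge0 // -normcV -normcM le_normcD.
rewrite mulrDl; apply: lerD.
  by rewrite exprS mulrA mulfVK ?gt_eqF //; exact: H.
by rewrite ler_piMr ?normc_ge0 // exprn_ile1 // normc_ge0.
Qed.

Lemma polyXY_growth (G : PC) : exists K D, 0 <= D /\
  forall t w, normc t <= 1 -> w != 0 -> normc w <= 1 ->
  normc G.[t / w, w^-1] * normc w ^+ K <= D.
Proof.
elim/poly_ind: G => [|G c [K [D [D0 H]]]].
  by exists 0%N, 0; split => // t w _ _ _; rewrite hornerXY0 normc0 mul0r.
have [K' [D' [D0' H']]] := poly_growth c.
exists (K' + K.+1)%N, (D + D'); split; first by rewrite addr_ge0.
move=> t w t1 w0 w1; have nw : 0 < normc w by rewrite normc_gt0.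
have X1 k : normc w ^+ k <= 1 by rewrite exprn_ile1 // normc_ge0.
rewrite hornerXY_X.
apply: (@le_trans _ _ ((normc G.[t / w, w^-1] * (normc w)^-1 + normc c.[w^-1])
    * normc w ^+ (K' + K.+1))).
  rewrite ler_wpM2r ?exprn_ge0 ?normc_ge0 //.
  apply: (le_trans (le_normcD _ _)); rewrite lerD2r normcM ler_wpM2l ?normc_ge0 //.
  by rewrite normcM normcV ler_piMl // invr_ge0 ltW.
rewrite mulrDl; apply: lerD.
  have -> : normc G.[t / w, w^-1] / normc w * normc w ^+ (K' + K.+1) =
      normc w ^+ K' * (normc G.[t / w, w^-1] * normc w ^+ K).
    by rewrite exprD exprS; field; rewrite gt_eqF.
  rewrite -[X in _ <= X]mul1r; apply: ler_pM; rewrite ?mulr_ge0 ?exprn_ge0 ?normc_ge0 //.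
  exact: H.
rewrite exprD mulrA -[X in _ <= X]mulr1; apply: ler_pM => //;
  by rewrite ?mulr_ge0 ?exprn_ge0 ?normc_ge0 //; exact: H'.
Qed.

(** At oo the function 1 / y vanishes to third order in the local parameter x / y,
    so that decay in terms of x / y turns into decay in terms of 1 / y. *)
Lemma curve_oo_growth (l x y : C) : curve l (x, y) -> y != 0 ->
  normc (x / y) <= 1 -> normc y^-1 <= 1 ->
  normc (x / y) ^+ 3 <= (1 + normc (1 + l) + normc l) * normc y^-1.
Proof.
rewrite /curve /= cubicE => E y0; set t := x / y; set w := y^-1 => t1 w1.
have -> : normc t ^+ 3 = normc (w + (1 + l) * t ^+ 2 * w - l * t * w ^+ 2).
  rewrite -normcX; congr normc; rewrite /t /w.
  have -> : (x / y) ^+ 3 = x ^+ 3 / y ^+ 3 by rewrite expr_div_n.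
  have -> : x ^+ 3 = y ^+ 2 + (1 + l) * x ^+ 2 - l * x by rewrite E; ring.
  by field.
apply: (le_trans (le_normcB _ _)).
rewrite [X in _ <= X]mulrDl [X in _ <= X + _]mulrDl mul1r.
apply: lerD.
  apply: (le_trans (le_normcD _ _)); rewrite lerD2l (normcM (_ * _)) (normcM (1 + l)) normcX.
  rewrite ler_wpM2r ?normc_ge0 // ler_piMr ?normc_ge0 // exprn_ile1 ?normc_ge0 //.
rewrite (normcM (_ * _)) (normcM l) normcX expr2 mulrA ler_wpM2r ?normc_ge0 //.
rewrite -mulrA ler_piMr ?normc_ge0 //.
by rewrite mulr_ile1 ?normc_ge0.
Qed.

(** In the chart (x / y, 1 / y) a polynomial in x and y has a pole of finite order
    in 1 / y; this is the decay that absorbs it. *)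
Lemma decay_bound (l : C) n (s : @sing R n) (K : nat) : rapid_decay s ->
  (forall v p, s v = Some p -> curve l p) ->
  forall e : R, 0 < e -> exists2 d : R, 0 < d & forall v p, s v = Some p -> p.2 != 0 ->
    normc (p.1 / p.2) < d -> normc p.2^-1 < d ->
    normc (cexp p.2) <= e * normc p.2^-1 ^+ K.
Proof.
move=> rd cu e e0; have [M HM] := rd (3 * K + 1)%N.
pose c0 := 1 + normc (1 + l) + normc l.
have c00 : 1 <= c0 by rewrite /c0 -addrA lerDl addr_ge0 // normc_ge0.
have c0p : 0 < c0 by exact: lt_le_trans c00.
have cK : 0 < c0 ^+ K by rewrite exprn_gt0.
exists (Num.min 1 (Num.min (`|M| + 1)^-1 (e / c0 ^+ K))).
  by rewrite !lt_min ltr01 invr_gt0 ltr_wpDl //= divr_gt0.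
move=> v [x y] Es /= y0; rewrite !lt_min => /and3P[t1 tM te] /and3P[w1 wM we].
have yM : M <= normc y.
  have : normc y^-1 < (`|M| + 1)^-1 by [].
  rewrite normcV ltf_pV2 ?posrE ?normc_gt0 ?ltr_wpDl // => H.
  by apply: ltW; apply: le_lt_trans H; apply: (le_trans (ler_norm _)); rewrite lerDl.
have := HM v _ Es; rewrite /= !normE lecR => /(_ yM).
rewrite -rmorphXn lecR => /le_trans; apply.
have C3 := curve_oo_growth (cu _ _ Es) y0 (ltW t1) (ltW w1).
rewrite exprD expr1 exprM.
have H3 : (normc (x / y) ^+ 3) ^+ K <= (c0 * normc y^-1) ^+ K.
  by rewrite lerXn2r // nnegrE ?exprn_ge0 ?mulr_ge0 ?normc_ge0 // ltW.
apply: (@le_trans _ _ ((c0 * normc y^-1) ^+ K * (e / c0 ^+ K))).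
  apply: ler_pM; rewrite ?exprn_ge0 ?normc_ge0 //.
  exact: ltW.
have -> // : (c0 * normc y^-1) ^+ K * (e / c0 ^+ K) = e * normc y^-1 ^+ K.
by rewrite exprMn; field; rewrite gt_eqF.
Qed.

End NearInfinity.

Section LocalBounds.
Context {R : realType}.
Local Notation C := R[i].
Local Notation PC := {poly {poly C}}.
Variables (n : nat) (l : C) (s : @sing R n).
Hypothesis adm : admissible l s.
Local Notation V := ('rV[R]_n.+1).
Implicit Types (w p q : V) (aa : 'I_n.+1 -> @splx R n) (A B : PC).

Lemma nearI (T : topologicalType) (t : T) (P Q : T -> Prop) :
  (\forall w \near t, P w) -> (\forall w \near t, Q w) -> \forall w \near t, P w /\ Q w.
Proof. exact: filterI. Qed.

(** Uniform in the base point p and the speed c: in the square of the Stokes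
    argument the horizontal lines have one direction and varying speeds. *)
Definition piece_bound A B aa q (w0 : V) (M : R) :=
  \forall w \near w0, forall p c u, `|c| <= 1 -> line p q c u = w ->
  (\forall x \near u, cell aa (line p q c x)) -> spt s w <> None ->
  path_C1 (fun x => spt s (line p q c x)) u /\
  normc (integrand A B (fun x => spt s (line p q c x)) u) <= M.

Lemma chart_some (w : V) (t z : C) : chart_oo (spt s w) t z -> z != 0 ->
  spt s w = Some (t / z, z^-1).
Proof.
case: (spt s w) => [[x y]|] /=; last by case=> _ ->; rewrite eqxx.
by case=> y0 -> -> _; rewrite invrK mulfVK.
Qed.

Lemma chart_affine_bound A B aa q w0 (a b : V -> C) :
  Csmooth a -> Csmooth b ->
  (\forall w \near w0, cell aa w -> chart_oo (spt s w) (a w) (b w)) ->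
  b (w0) != 0 -> exists M, piece_bound A B aa q w0 M.
Proof.
move=> sa sb rep b0.
have Ca := Csmooth_C1at q (w0) sa; have Cb := Csmooth_C1at q (w0) sb.
have CV := C1atV Cb b0; have CX := C1atM Ca CV.
have nb := near_ccont_neq0 (C1at_ccont Cb).1 b0.
have rep' : \forall w \near w0, cell aa w ->
    spt s w = Some (a w * (b w)^-1, (b w)^-1).
  by apply: filterS2 nb rep => w bw0 H /H /chart_some -> .
have [M HM] := chart_bound A B CX CV rep'.
exists M; apply: filterS HM => w H p c u c1 E KK _.
exact: H.
Qed.

(** In the chart at oo the form exp y (A dx + B dy) is exp y times a form with a
    pole of order at most KA + KB + 2 in w = 1 / y, and exp y is small compared
    with that power of w. *)
Lemma chart_oo_bound A B aa q w0 (a b : V -> C) :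
  Csmooth a -> Csmooth b ->
  (\forall w \near w0, cell aa w -> chart_oo (spt s w) (a w) (b w)) ->
  a (w0) = 0 -> b (w0) = 0 -> forall e, 0 < e -> piece_bound A B aa q w0 e.
Proof.
move=> sa sb rep a0 b0 e e0.
have Ca := Csmooth_C1at q (w0) sa; have Cb := Csmooth_C1at q (w0) sb.
have [KA [DA [DA0 HA]]] := polyXY_growth A.
have [KB [DB [DB0 HB]]] := polyXY_growth B.
pose da := dirder a q; pose db := dirder b q.
pose M0 := normc (da (w0)) + normc (db (w0)) + 1.
have M01 : 1 <= M0 by rewrite /M0 lerDr addr_ge0 // normc_ge0.
have M00 : 0 < M0 by exact: lt_le_trans M01.
pose e' := e / (2 * DA * M0 + DB * M0 + 1).
have den0 : 0 < 2 * DA * M0 + DB * M0 + 1.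
  by rewrite ltr_wpDl // addr_ge0 // !mulr_ge0 // ltW.
have e'0 : 0 < e' by rewrite divr_gt0.
have [_ _ _ _ rd] := adm; have [cu _ _ _ _] := adm.
have [d d0 Hd] := decay_bound (KA + KB + 2) rd cu e'0.
have [ca cda] := C1at_ccont Ca; have [cb cdb] := C1at_ccont Cb.
have d10 : 0 < Num.min d 1 by rewrite lt_min d0 ltr01.
move/ccontP/(_ _ d10): (ca) => Na; move/ccontP/(_ _ d10): (cb) => Nb.
move/ccontP/(_ _ ltr01): (cda) => Nda; move/ccontP/(_ _ ltr01): (cdb) => Ndb.
have rep' : \forall w \near w0, \forall w' \near w,
  cell aa w' -> chart_oo (spt s w') (a w') (b w') by exact: near_join.
have F1 := nearI (nearI Na Nb) (nearI Nda Ndb).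
have F2 := nearI (C1at_near Ca) (nearI (C1at_near Cb) rep').
rewrite /piece_bound; apply: filterS2 F1 F2 => w [[aw bw] [daw dbw]] [Caw [Cbw rw]].
move=> p c u c1 E KK sw; subst w; set w := line p q c u in aw bw daw dbw Caw Cbw rw sw *.
have Kw : cell aa w by exact: (nbhs_singleton KK).
have chw := nbhs_singleton rw Kw.
have bw0 : b w != 0.
  case E : (spt s w) sw chw => [[x y]|] //= _.
  by move=> [y0 _ ->]; rewrite invr_eq0.
have sw' := chart_some chw bw0.
have CVw := C1atV Cbw bw0; have CXw := C1atM Caw CVw.
have nb := near_ccont_neq0 (C1at_ccont Cbw).1 bw0.
have repw : \forall w' \near w, cell aa w' ->
    spt s w' = Some (a w' * (b w')^-1, (b w')^-1).
  by apply: filterS2 nb rw => w' bw0' H /H /chart_some ->.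
have [G ->] := chart_C1 A B CXw CVw repw KK; split => //.
rewrite normcM normcR.
move: aw bw; rewrite a0 b0 !subr0 !lt_min => /andP[awd aw1] /andP[bwd bw1].
have nbw : 0 < normc (b w) by rewrite normc_gt0.
have [v' Ev'] : exists v' : splx n, s v' = Some (a w * (b w)^-1, (b w)^-1).
  move: sw'; rewrite /spt; case: insubP => //= v' _ _ E'; by exists v'.
have := Hd v' _ Ev'; rewrite /= invrK mulfVK // invr_eq0 => /(_ bw0 awd bwd) Hexp.
have nda : normc (da w) <= M0.
  rewrite -[da w](subrK (da w0)) addrC; apply: (le_trans (le_normcD _ _)).
  by rewrite /M0 -addrA lerD2l (le_trans (ltW daw)) // lerDr normc_ge0.
have ndb : normc (db w) <= M0.
  rewrite -[db w](subrK (db w0)) addrC; apply: (le_trans (le_normcD _ _)).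
  by rewrite /M0 -[X in _ <= X]addrA ler_wpDl ?normc_ge0 // lerD2l ltW.
have nA := HA (a w) (b w) (ltW aw1) bw0 (ltW bw1).
have nB := HB (a w) (b w) (ltW aw1) bw0 (ltW bw1).
rewrite /speed; apply: (@le_trans _ _ (1 * (e' * (2 * DA * M0 + DB * M0)))); last first.
  rewrite mul1r /e' mulrAC ler_pdivrMr // ler_wpM2l ?ltW //.
  by rewrite ltrDl.
apply: ler_pM => //; first exact: normc_ge0.
rewrite normcM; set T := _ + _.
have -> : normc (cexp (b w)^-1) * normc T =
  normc (cexp (b w)^-1) / normc (b w) ^+ (KA + KB + 2) *
    (normc (b w) ^+ (KA + KB + 2) * normc T).
  by rewrite mulrA mulfVK // expf_neq0 // gt_eqF.
apply: ler_pM; rewrite ?divr_ge0 ?mulr_ge0 ?exprn_ge0 ?normc_ge0 //.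
  by rewrite ler_pdivrMr ?exprn_gt0.
have nT : normc T <= (normc A.[a w / b w, (b w)^-1] * (2 * M0) +
    normc B.[a w / b w, (b w)^-1] * M0) / normc (b w) ^+ 2.
  have nd : normc (- db w / b w ^+ 2) <= M0 / normc (b w) ^+ 2.
    by rewrite normcM normcN normcV normcX ler_wpM2r // invr_ge0 exprn_ge0 ?normc_ge0.
  rewrite mulrDl; apply: (le_trans (le_normcD _ _)); apply: lerD; last first.
    by rewrite normcM -mulrA ler_wpM2l ?normc_ge0.
  rewrite normcM -mulrA ler_wpM2l ?normc_ge0 // mulr_natl mulr2n mulrDl.
  apply: (le_trans (le_normcD _ _)); apply: lerD.
    rewrite normcM normcV; apply: ler_pM => //; rewrite ?invr_ge0 ?normc_ge0 //.
    by rewrite lef_pV2 ?posrE ?exprn_gt0 // expr2 ler_piMl // ltW.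
  rewrite normcM -[X in _ <= X]mul1r; apply: ler_pM => //; rewrite ?normc_ge0 //.
  exact: ltW.
apply: (@le_trans _ _ (normc (b w) ^+ (KA + KB + 2) *
   ((normc A.[a w / b w, (b w)^-1] * (2 * M0) +
    normc B.[a w / b w, (b w)^-1] * M0) / normc (b w) ^+ 2))).
  by rewrite ler_wpM2l // exprn_ge0 // normc_ge0.
have -> : normc (b w) ^+ (KA + KB + 2) *
   ((normc A.[a w / b w, (b w)^-1] * (2 * M0) +
    normc B.[a w / b w, (b w)^-1] * M0) / normc (b w) ^+ 2) =
  (normc A.[a w / b w, (b w)^-1] * normc (b w) ^+ KA) * (2 * M0) * normc (b w) ^+ KB +
  (normc B.[a w / b w, (b w)^-1] * normc (b w) ^+ KB) * M0 * normc (b w) ^+ KA.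
  by rewrite !exprD; field; rewrite gt_eqF.
have X1 k : normc (b w) ^+ k <= 1 by rewrite exprn_ile1 ?normc_ge0 // ltW.
have X0 k : 0 <= normc (b w) ^+ k by rewrite exprn_ge0 // normc_ge0.
have M20 : 0 <= 2 * M0 by rewrite mulr_ge0 // ltW.
apply: lerD.
  apply: (@le_trans _ _ (DA * (2 * M0) * 1)); last by rewrite mulr1 mulrCA mulrA.
  have P1 : 0 <= normc A.[a w / b w, (b w)^-1] * normc (b w) ^+ KA.
    by rewrite mulr_ge0 ?normc_ge0.
  by apply: ler_pM; [exact: mulr_ge0|exact: X0|rewrite ler_wpM2r|exact: X1].
apply: (@le_trans _ _ (DB * M0 * 1)); last by rewrite mulr1.
have P2 : 0 <= normc B.[a w / b w, (b w)^-1] * normc (b w) ^+ KB.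
  by rewrite mulr_ge0 ?normc_ge0.
by apply: ler_pM; [exact: (mulr_ge0 P2 (ltW M00))|exact: X0|rewrite ler_wpM2r // ltW|exact: X1].
Qed.

End LocalBounds.

(** * Lines in an admissible simplex *)

Section AdmissiblePaths.
Context {R : realType}.
Local Notation C := R[i].
Local Notation PC := {poly {poly C}}.
Variables (n : nat) (l : C) (s : @sing R n).
Hypothesis adm : admissible l s.
Local Notation V := ('rV[R]_n.+1).
Implicit Types (w p q : V) (aa : 'I_n.+1 -> @splx R n) (A B G : PC) (v : @splx R n).

Lemma near_notin aa (w0 : V) (P : V -> Prop) : ~ cell aa w0 ->
  \forall w \near w0, cell aa w -> P w.
Proof.
move=> nK; have : nbhs w0 (~` cell aa).
  by apply: open_nbhs_nbhs; split => //; apply: closed_openC; exact: cell_closed.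
by apply: filterS => w nKw /nKw.
Qed.

Lemma smooth_on_chart aa v : smooth_on (affine_splx aa) s -> cell aa (val v) ->
  exists a b : V -> C, [/\ Csmooth a, Csmooth b &
   (\forall w \near (val v : V), cell aa w -> spt s w = Some (a w, b w)) \/
   (\forall w \near (val v : V), cell aa w -> chart_oo (spt s w) (a w) (b w))].
Proof.
move=> sm Kv; have [a [b [sa sb rep]]] := sm v ((cellP aa v).2 Kv).
exists a, b; split => //.
case: rep => rep; [left|right]; apply: (@filterS _ (nbhs (val v : V))) rep => w rep Kw;
  have wS := cell_in_splx Kw; have := rep (Sub w wS) (SubK _ _);
  by rewrite -(spt_val s) SubK; apply; apply/cellP; rewrite SubK.
Qed.

Lemma piece_boundW A B aa q (w0 : V) (M M' : R) : M <= M' ->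
  piece_bound s A B aa q w0 M -> piece_bound s A B aa q w0 M'.
Proof.
move=> MM; apply: filterS => w H p c u c1 E KK sw.
by have [g b] := H p c u c1 E KK sw; split => //; exact: le_trans MM.
Qed.

Lemma piece_local A B aa q v : smooth_on (affine_splx aa) s ->
  (s v <> None -> exists M, piece_bound s A B aa q (val v) M) /\
  (s v = None -> forall e, 0 < e -> piece_bound s A B aa q (val v) e).
Proof.
move=> sm; have [Kv|nK] := pselect (cell aa (val v)); last first.
  have H M : piece_bound s A B aa q (val v) M.
    have := near_notin (fun w => False) nK.
    apply: (@filterS _ (nbhs (val v : V))) => w H p c u c1 E KK; exfalso; apply: H.
    by rewrite -E; exact: (nbhs_singleton KK).
  by split => [_|_ e _]; [exists 0|]; exact: H.
have [a [b [sa sb [rep|rep]]]] := smooth_on_chart sm Kv.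
  have sv := nbhs_singleton rep Kv; rewrite spt_val in sv.
  split; last by rewrite sv.
  move=> _; have [M HM] := chart_bound A B (Csmooth_C1at q _ sa) (Csmooth_C1at q _ sb) rep.
  exists M; apply: (@filterS _ (nbhs (val v : V))) HM => w H p c u c1 E KK _.
  exact: H.
have chv := nbhs_singleton rep Kv; rewrite spt_val in chv.
split => sv.
  apply: (chart_affine_bound A B q sa sb rep).
  by case: (s v) chv sv => [[x y]|] // [y0 _ -> _]; rewrite invr_eq0.
move=> e e0; move: chv; rewrite sv => -[a0 b0].
exact: (chart_oo_bound adm A B q sa sb rep).
Qed.

Lemma piece_cont aa v G : smooth_on (affine_splx aa) s -> forall e, 0 < e ->
  \forall w \near (val v : V), cell aa w ->
    normc (pval G (spt s w) - pval G (s v)) < e /\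
    (forall p0 : C * C, s v = Some p0 -> exists p : C * C, [/\ spt s w = Some p,
       normc (p.1 - p0.1) < e & normc (p.2 - p0.2) < e]).
Proof.
move=> sm e e0; have [Kv|nK] := pselect (cell aa (val v)); last exact: near_notin.
have some_case (X Y : V -> C) : ccont X (val v) -> ccont Y (val v) ->
    (\forall w \near (val v : V), cell aa w -> spt s w = Some (X w, Y w)) ->
    \forall w \near (val v : V), cell aa w ->
    normc (pval G (spt s w) - pval G (s v)) < e /\
    (forall p0 : C * C, s v = Some p0 -> exists p : C * C, [/\ spt s w = Some p,
       normc (p.1 - p0.1) < e & normc (p.2 - p0.2) < e]).
  move=> cX cY rep; have sv := nbhs_singleton rep Kv; rewrite spt_val in sv.
  have cP : ccont (fun w => G.[X w, Y w] * cexp (Y w)) (val v).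
    by apply: ccontM; [exact: ccont_ev|exact: ccont_exp].
  move/ccontP/(_ e e0): cX => NX; move/ccontP/(_ e e0): cY => NY.
  move/ccontP/(_ e e0): cP => NP.
  apply: filterS2 (nearI NX NY) (nearI NP rep) => w [h1 h2] [h3 h4] Kw.
  rewrite h4 // sv /=; split=> // p0 [<-] /=.
  by exists (X w, Y w).
have [a [b [sa sb [rep|rep]]]] := smooth_on_chart sm Kv.
  by have [ca _] := C1at_ccont (Csmooth_C1at 0 (val v) sa);
     have [cb _] := C1at_ccont (Csmooth_C1at 0 (val v) sb); exact: (some_case a b).
have [ca _] := C1at_ccont (Csmooth_C1at 0 (val v) sa).
have [cb _] := C1at_ccont (Csmooth_C1at 0 (val v) sb).
have chv := nbhs_singleton rep Kv; rewrite spt_val in chv.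
case E : (s v) chv => [p0|] chv.
  have b0 : b (val v) != 0 by case: chv => ? _ ->; rewrite invr_eq0.
  rewrite -E; apply: (some_case (fun w => a w * (b w)^-1) (fun w => (b w)^-1)).
  - by apply: ccontM => //; exact: ccontV.
  - exact: ccontV.
  - by apply: filterS2 (near_ccont_neq0 cb b0) rep => w bw0 H /H /chart_some ->.
have [a0 b0] := chv.
have [K [D [D0 HD]]] := polyXY_growth G.
have [cu _ _ _ rd] := adm.
have De : 0 < e / (D + 1) by rewrite divr_gt0 // ltr_wpDl.
have [d d0 Hd] := decay_bound K rd cu De.
have d10 : 0 < Num.min d 1 by rewrite lt_min d0 ltr01.
move/ccontP/(_ _ d10): (ca) => Na; move/ccontP/(_ _ d10): (cb) => Nb.
apply: filterS2 (nearI Na Nb) rep => w [].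
rewrite a0 b0 !subr0 !lt_min => /andP[awd aw1] /andP[bwd bw1] ch Kw; split=> //.
case E' : (spt s w) (ch Kw) => [p|] chw; last by rewrite normc0.
have bw0 : b w != 0 by case: chw => ? _ ->; rewrite invr_eq0.
have sw : spt s w = Some (a w / b w, (b w)^-1) by apply: chart_some => //; rewrite E'.
rewrite -E' sw /pval normcM.
have [v' Ev'] : exists v' : splx n, s v' = Some (a w * (b w)^-1, (b w)^-1).
  by move: sw; rewrite /spt; case: insubP => //= v' _ _ E2; exists v'.
have := Hd v' _ Ev'; rewrite /= invrK mulfVK // invr_eq0 => /(_ bw0 awd bwd) Hexp.
have nG := HD (a w) (b w) (ltW aw1) bw0 (ltW bw1).
apply: (@le_lt_trans _ _ (normc G.[a w / b w, (b w)^-1] * (e / (D + 1) * normc (b w) ^+ K))).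
  by rewrite ler_wpM2l ?normc_ge0.
rewrite mulrCA; apply: (@le_lt_trans _ _ (e / (D + 1) * D)).
  by rewrite ler_wpM2l // ltW.
by rewrite mulrAC ltr_pdivrMr ?ltr_wpDl // ltr_pM2l // ltrDl.
Qed.

Lemma adm_cover : exists m (aa : 'I_m -> 'I_n.+1 -> @splx R n),
  (forall w, in_splx w -> exists j, cell (aa j) w) /\
  (forall j, smooth_on (affine_splx (aa j)) s).
Proof.
have [_ [m [aa [cov sm]]] _ _ _] := adm; exists m, aa; split => // w wS.
by have [j /cellP] := cov (Sub w wS); rewrite SubK; exists j.
Qed.

Lemma adm_cont v G e : 0 < e -> \forall w \near (val v : V), in_splx w ->
    normc (pval G (spt s w) - pval G (s v)) < e /\
    (forall p0 : C * C, s v = Some p0 -> exists p : C * C, [/\ spt s w = Some p,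
       normc (p.1 - p0.1) < e & normc (p.2 - p0.2) < e]).
Proof.
move=> e0; have [m [aa [cov sm]]] := adm_cover.
have : \forall w \near (val v : V), forall j, cell (aa j) w ->
    normc (pval G (spt s w) - pval G (s v)) < e /\
    (forall p0 : C * C, s v = Some p0 -> exists p : C * C, [/\ spt s w = Some p,
       normc (p.1 - p0.1) < e & normc (p.2 - p0.2) < e]).
  apply: (@filter_forall _ _ _ (nbhs (val v : V))) => j.
  exact: (piece_cont v G (sm j) e0).
apply: (@filterS _ (nbhs (val v : V))) => w H /cov [j Kj].
exact: (H j).
Qed.

Lemma adm_bound_some m (aa : 'I_m -> 'I_n.+1 -> @splx R n) A B q v :
  (forall j, smooth_on (affine_splx (aa j)) s) -> s v <> None ->
  exists M, \forall w \near (val v : V), forall j p c u, `|c| <= 1 -> line p q c u = w ->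
  (\forall x \near u, cell (aa j) (line p q c x)) -> spt s w <> None ->
  path_C1 (fun x => spt s (line p q c x)) u /\
  normc (integrand A B (fun x => spt s (line p q c x)) u) <= M.
Proof.
move=> sm sv.
have [f Hf] := choice (fun j => (piece_local A B q v (sm j)).1 sv).
exists (\sum_j `|f j|); apply: (@filter_forall _ _ _ (nbhs (val v : V))) => j.
apply: piece_boundW (Hf j); apply: (le_trans (ler_norm _)).
by rewrite (bigD1 j) //= lerDl sumr_ge0.
Qed.

Lemma adm_bound_oo m (aa : 'I_m -> 'I_n.+1 -> @splx R n) A B q v :
  (forall j, smooth_on (affine_splx (aa j)) s) -> s v = None -> forall e, 0 < e ->
  \forall w \near (val v : V), forall j p c u, `|c| <= 1 -> line p q c u = w ->
  (\forall x \near u, cell (aa j) (line p q c x)) -> spt s w <> None ->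
  path_C1 (fun x => spt s (line p q c x)) u /\
  normc (integrand A B (fun x => spt s (line p q c x)) u) <= e.
Proof.
move=> sm sv e e0; apply: (@filter_forall _ _ _ (nbhs (val v : V))) => j.
exact: (piece_local A B q v (sm j)).2.
Qed.

(** Near each point of the line the integrand is bounded, in either chart, away
    from the ends of the pieces of the cover; Cousin's lemma makes the bound
    global. *)
Lemma adm_path A B p q c x y : `|c| <= 1 -> x < y ->
  (forall u, x <= u -> u <= y -> in_splx (line p q c u)) ->
  (forall u, x < u -> u < y -> spt s (line p q c u) <> None) ->
  exists (bad : seq R) M, forall u, x < u -> u < y -> u \notin bad ->
    path_C1 (fun u => spt s (line p q c u)) u /\
    normc (integrand A B (fun u => spt s (line p q c u)) u) <= M.
Proof.
move=> c1 xy inS noo; have [m [aa [cov sm]]] := adm_cover.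
have [|bad Hbad] := @line_cover R n m aa p q c x y.
  by move=> u xu uy; apply: cov; apply: inS; exact: ltW.
exists bad.
pose P a b := exists M, forall u, a <= u -> u <= b -> x < u -> u < y -> u \notin bad ->
    path_C1 (fun u => spt s (line p q c u)) u /\
    normc (integrand A B (fun u => spt s (line p q c u)) u) <= M.
have loc u0 : x <= u0 -> u0 <= y -> exists2 d, 0 < d & exists M,
    forall u, u0 - d < u -> u < u0 + d -> x < u -> u < y -> u \notin bad ->
    path_C1 (fun u => spt s (line p q c u)) u /\
    normc (integrand A B (fun u => spt s (line p q c u)) u) <= M.
  move=> xu uy; pose v : splx n := Sub (line p q c u0) (inS _ xu uy).
  have : exists M, \forall w \near (val v : V), forall j p c u, `|c| <= 1 -> line p q c u = w ->
      (\forall x \near u, cell (aa j) (line p q c x)) -> spt s w <> None ->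
      path_C1 (fun x => spt s (line p q c x)) u /\
      normc (integrand A B (fun x => spt s (line p q c x)) u) <= M.
    case E : (s v) => [p0|]; first by apply: adm_bound_some => //; rewrite E.
    by exists 1; apply: adm_bound_oo.
  rewrite SubK => -[M /near_line /nbhs_ballP [d /= d0 Hd]].
  exists d => //; exists M => u h1 h2 xu' uy' ub.
  have [j Kj] := Hbad u xu' uy' ub.
  apply: (Hd u _ j) => //; last exact: noo.
  by rewrite /ball /= ltr_norml; apply/andP; split; lra.
suff [M HM] : P x y.
  by exists M => u xu uy; apply: HM => //; exact: ltW.
apply: cousin_lr => //.
- move=> a b d _ _ _ _ [M HM] [M' HM']; exists (Num.max M M') => u au ud xu uy ub.
  have [ub'|bu] := leP u b.
    by have [g h] := HM u au ub' xu uy ub; split => //; rewrite le_max h.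
  by have [g h] := HM' u (ltW bu) ud xu uy ub; split => //; rewrite le_max h orbT.
- move=> u0 xu uy; have [d d0 [M HM]] := loc u0 xu (ltW uy).
  exists d => // e ue ed ey; exists M => u h1 h2; apply: HM; lra.
- move=> u0 xu uy; have [d d0 [M HM]] := loc u0 (ltW xu) uy.
  exists d => // e ue ed ey; exists M => u h1 h2; apply: HM; lra.
Qed.

Lemma adm_pwcc A B p q c x y : `|c| <= 1 -> x < y ->
  (forall u, x <= u -> u <= y -> in_splx (line p q c u)) ->
  (forall u, x < u -> u < y -> spt s (line p q c u) <> None) ->
  exists (bad : seq R) M, pwcc (integrand A B (fun u => spt s (line p q c u))) bad M x y /\
    forall u, x < u -> u < y -> u \notin bad -> path_C1 (fun u => spt s (line p q c u)) u.
Proof.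
move=> c1 xy inS noo; have [bad [M H]] := adm_path A B c1 xy inS noo.
exists bad, M; split => u xu uy ub; have [g b] := H u xu uy ub => //.
by split => //; exact: path_C1_ccont.
Qed.

Lemma adm_pval_ccont_itv G p q c x y :
  (forall u, x <= u -> u <= y -> in_splx (line p q c u)) ->
  ccont_itv (fun u => pval G (spt s (line p q c u))) x y.
Proof.
move=> inS u /andP[xu uy] e e0.
have := adm_cont (Sub (line p q c u) (inS u xu uy) : splx n) G e0.
rewrite -[s _]spt_val SubK => /near_line /nbhs_ballP [d /= d0 Hd].
exists d => // v /andP[xv vy] uv; apply: (Hd v _ (inS v xv vy)).1.
by rewrite /ball /= distrC.
Qed.

End AdmissiblePaths.

(** * Uniform limits of polynomials *)

Section Approximation.
Context {R : realType}.
Local Notation C := R[i].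
Local Notation PC := {poly {poly C}}.
Variables (N : set (C * C)) (z : C * C -> C).
Implicit Types (f g : C * C -> C).

(** If z is a coordinate on a piece N of the curve, such functions f have forms
    f dz whose integrals vanish on small closed paths, because H dz has a primitive
    for a polynomial H. The boundedness makes the class stable under products. *)
Definition appr f := (exists M, forall p, N p -> normc (f p) <= M) /\
  forall e, 0 < e -> exists H : {poly C}, forall p, N p -> normc (f p - H.[z p]) <= e.

Lemma appr_cst (c : C) : appr (fun=> c).
Proof.
split; first by exists (normc c).
by move=> e /ltW e0; exists c%:P => p _; rewrite hornerC subrr normc0.
Qed.

Lemma appr_poly (H : {poly C}) M : (forall p, N p -> normc H.[z p] <= M) ->
  appr (fun p => H.[z p]).
Proof.
move=> HM; split; first by exists M.
by move=> e /ltW e0; exists H => p _; rewrite subrr normc0.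
Qed.

Lemma apprD f g : appr f -> appr g -> appr (fun p => f p + g p).
Proof.
move=> [[M1 b1] a1] [[M2 b2] a2]; split.
  by exists (M1 + M2) => p Np; apply: (le_trans (le_normcD _ _)); apply: lerD; auto.
move=> e e0; have e2 : 0 < e / 2 by rewrite divr_gt0.
have [H1 h1] := a1 _ e2; have [H2 h2] := a2 _ e2.
exists (H1 + H2) => p Np; rewrite hornerD opprD addrACA.
by apply: (le_trans (le_normcD _ _)); rewrite (splitr e) lerD; auto.
Qed.

Lemma apprM f g : appr f -> appr g -> appr (fun p => f p * g p).
Proof.
move=> [[M1 b1] a1] [[M2 b2] a2]; split.
  by exists (M1 * M2) => p Np; rewrite normcM ler_pM ?normc_ge0 //; auto.
move=> e e0; pose M := `|M1| + `|M2| + 1.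
have M0 : 0 < M by rewrite ltr_wpDl // addr_ge0.
have d0 : 0 < Num.min 1 (e / (2 * M)) by rewrite lt_min ltr01 divr_gt0 // mulr_gt0.
have [H1 h1] := a1 _ d0; have [H2 h2] := a2 _ d0.
exists (H1 * H2) => p Np; rewrite hornerM.
have -> : f p * g p - H1.[z p] * H2.[z p] =
   f p * (g p - H2.[z p]) + (f p - H1.[z p]) * H2.[z p] by ring.
have := h1 p Np; rewrite le_min => /andP[_ h1e].
have := h2 p Np; rewrite le_min => /andP[h21 h2e].
have nf : normc (f p) <= M.
  apply: (le_trans (b1 p Np)); apply: (le_trans (ler_norm _)).
  by rewrite /M -addrA lerDl addr_ge0.
have nH : normc H2.[z p] <= M.
  have -> : H2.[z p] = g p - (g p - H2.[z p]) by ring.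
  apply: (le_trans (le_normcB _ _)); apply: lerD => //.
  by apply: (le_trans (b2 p Np)); apply: (le_trans (ler_norm _)); rewrite lerDr.
apply: (le_trans (le_normcD _ _)); rewrite !normcM.
have -> : e = M * (e / (2 * M)) + (e / (2 * M)) * M by field; rewrite gt_eqF.
by apply: lerD; apply: ler_pM; rewrite ?normc_ge0.
Qed.

Lemma appr_lim f (F : nat -> C * C -> C) (b : R) : (forall n, appr (F n)) ->
  (forall n p, N p -> normc (f p - F n p) <= b * 2^-1 ^+ n) -> appr f.
Proof.
move=> aF lF; split.
  have [[M HM] _] := aF 0%N; exists (M + b) => p Np.
  rewrite -[f p](subrK (F 0%N p)) addrC; apply: (le_trans (le_normcD _ _)).
  by apply: lerD; [exact: HM|have := lF 0%N p Np; rewrite expr0 mulr1].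
move=> e e0; have e2 : 0 < e / 2 by rewrite divr_gt0.
have [n Hn] : exists n, b * 2^-1 ^+ n <= e / 2.
  have [n] := @near_infty_natSinv_expn_lt R (PosNum (divr_gt0 e2 (ltr_wpDl (normr_ge0 b) ltr01))).
  move=> _ /(_ n (leqnn _)) /= H; exists n.
  have b0 : 0 < `|b| + 1 by rewrite ltr_wpDl.
  move: H; rewrite ltr_pdivlMr // => /ltW; apply: le_trans.
  rewrite mulrC exprVn mul1r ler_wpM2l ?invr_ge0 ?exprn_ge0 //.
  by apply: (le_trans (ler_norm _)); rewrite lerDl.
have [_ /(_ _ e2) [H hH]] := aF n.
exists H => p Np; have -> : f p - H.[z p] = (f p - F n p) + (F n p - H.[z p]) by ring.
apply: (le_trans (le_normcD _ _)); rewrite (splitr e); apply: lerD; last exact: hH.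
exact: le_trans (lF n p Np) Hn.
Qed.

Lemma appr_sum (F : nat -> C * C -> C) n : (forall i, appr (F i)) ->
  appr (fun p => \sum_(i < n) F i p).
Proof.
move=> aF; elim: n => [|n IH].
  rewrite (_ : (fun _ => _) = fun=> 0); first exact: appr_cst.
  by apply/funext => p; rewrite big_ord0.
rewrite (_ : (fun _ => _) = fun p => \sum_(i < n) F i p + F n p); first exact: apprD.
by apply/funext => p; rewrite big_ord_recr.
Qed.

Lemma apprX f n : appr f -> appr (fun p => f p ^+ n).
Proof.
move=> af; elim: n => [|n IH]; first exact: appr_cst.
rewrite (_ : (fun _ => _) = fun p => f p * f p ^+ n); first exact: apprM.
by apply/funext => p; rewrite exprS.
Qed.

Lemma appr_polyfun f (H : {poly C}) : appr f -> appr (fun p => H.[f p]).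
Proof.
move=> af; elim/poly_ind: H => [|H c IH].
  rewrite (_ : (fun _ => _) = fun=> 0); first exact: appr_cst.
  by apply/funext => p; rewrite horner0.
rewrite (_ : (fun _ => _) = fun p => H.[f p] * f p + c).
  by apply: apprD; [exact: apprM|exact: appr_cst].
by apply/funext => p; rewrite hornerMXaddC.
Qed.

Lemma appr_ev f g (G : PC) : appr f -> appr g -> appr (fun p => G.[f p, g p]).
Proof.
move=> af ag; elim/poly_ind: G => [|G c IH].
  rewrite (_ : (fun _ => _) = fun=> 0); first exact: appr_cst.
  by apply/funext => p; rewrite hornerXY0.
rewrite (_ : (fun _ => _) = fun p => G.[f p, g p] * f p + c.[g p]).
  by apply: apprD; [exact: apprM|exact: appr_polyfun].
by apply/funext => p; rewrite hornerXY_X.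
Qed.

(** Geometric series in 1 - f / c. *)
Lemma apprV f (c : C) : c != 0 -> appr f ->
  (forall p, N p -> normc (1 - f p / c) <= 2^-1) -> appr (fun p => (f p)^-1).
Proof.
move=> c0 af fc; pose g p := 1 - f p / c.
have ag : appr g.
  rewrite (_ : g = fun p => 1 + (- c^-1) * f p).
    by apply: apprD; [exact: appr_cst|apply: apprM => //; exact: appr_cst].
  by apply/funext => p; rewrite /g mulNr mulrC.
apply: (@appr_lim _ (fun n p => c^-1 * \sum_(i < n) g p ^+ i) (2 / normc c)).
  move=> n; apply: apprM; first exact: appr_cst.
  by apply: (@appr_sum (fun i p => g p ^+ i)) => i; exact: apprX.
move=> n p Np; have gp := fc p Np.
have nfc : 2^-1 <= normc (f p / c).
  have : 1 <= normc (f p / c) + normc (1 - f p / c).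
    by rewrite -normc1 -{1}[1](subrK (f p / c)) addrC le_normcD.
  have h2 : (2^-1 : R) + 2^-1 = 1 by field.
  by move: gp; lra.
have f0 : f p != 0.
  apply: contraTneq nfc => ->; rewrite mul0r normc0 -ltNge.
  by rewrite invr_gt0.
have -> : (f p)^-1 - c^-1 * \sum_(i < n) g p ^+ i = g p ^+ n / f p.
  have : (1 - g p) * \sum_(i < n) g p ^+ i = 1 - g p ^+ n by rewrite -[RHS]opprB subrX1; ring.
  have -> : 1 - g p = f p / c by rewrite /g; ring.
  move: (\sum_(i < n) _) => S h.
  have -> : g p ^+ n = 1 - f p / c * S by rewrite h; ring.
  by field; rewrite f0 c0.
rewrite normcM normcX normcV mulrC; apply: ler_pM.
- by rewrite invr_ge0 normc_ge0.
- by rewrite exprn_ge0 // normc_ge0.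
- rewrite normcM normcV in nfc; have nc : 0 < normc c by rewrite normc_gt0.
  have nf : 0 < normc (f p) by rewrite normc_gt0.
  rewrite ler_pdivlMr // mulrC ler_pdivrMr //.
  by move: nfc; rewrite ler_pdivlMr //; lra.
- by rewrite lerXn2r ?nnegrE ?normc_ge0 ?invr_ge0.
Qed.

(** Each integration of the remainder gains a factor 2 |w|, at most 1/2, the 2 coming
    from the separate estimates of the real and the imaginary part. *)
Lemma cexp_taylor n (w : C) : normc w <= 4^-1 ->
  normc (cexp w - \sum_(i < n) (i`!%:R)^-1 * w ^+ i) <= expR 1 * 2^-1 ^+ n.
Proof.
elim: n w => [|n IH] w w4.
  rewrite big_ord0 subr0 expr0 mulr1 normc_cexp ler_expR.
  apply: (le_trans (ler_norm _)); apply: (le_trans (le_norm_re _)).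
  by apply: (le_trans w4); rewrite invf_le1 // ler1n.
pose E m (x : C) := \sum_(i < m) (i`!%:R)^-1 * x ^+ i.
pose r m (t : R) := cexp (t%:C * w) - E m (t%:C * w).
have dE m (t : R) : cder (fun t => E m.+1 (t%:C * w)) t (w * E m (t%:C * w)).
  elim: m => [|m IHm].
    rewrite /E big_ord0 mulr0.
    rewrite (_ : (fun _ => _) = fun=> 1); first exact: cder_cst.
    by apply/funext => x; rewrite big_ord_recl big_ord0 expr0 fact0 invr1 mulr1 addr0.
  rewrite (_ : (fun _ => _) = fun t => E m.+1 (t%:C * w) +
      (m.+1`!%:R)^-1 * (t%:C * w) ^+ m.+1); last first.
    by apply/funext => x; rewrite /E big_ord_recr.
  have dw := cderM (cder_id t) (cder_cst w t).
  apply: (cder_eq (cderD IHm (cderM (cder_cst (m.+1`!%:R)^-1 t) (cderX m.+1 dw)))).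
  have -> : E m.+1 (t%:C * w) = E m (t%:C * w) + (m`!%:R)^-1 * (t%:C * w) ^+ m.
    by rewrite /E big_ord_recr.
  rewrite [in RHS]mulrDr; congr (_ + _).
  rewrite mul0r add0r mulr0 addr0 mul1r.
  have -> : ((m.+1)`!%:R : C) = m.+1%:R * m`!%:R by rewrite -natrM.
  have n1 : (m.+1%:R : C) != 0 by rewrite pnatr_eq0.
  have n2 : (m`!%:R : C) != 0 by rewrite pnatr_eq0 -lt0n fact_gt0.
  move: n1 n2; move: (m.+1%:R : C) (m`!%:R : C) => a b a0 b0.
  by field; rewrite a0 b0.
have dr (t : R) : cder (r n.+1) t (w * r n t).
  have dw := cderM (cder_id t) (cder_cst w t).
  apply: (cder_eq (cderD (cder_exp dw) (cderN (dE n t)))).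
  by rewrite mulr0 addr0 mul1r /r; ring.
have bnd (t : R) : 0 < t -> t < 1 -> normc (w * r n t) <= 4^-1 * (expR 1 * 2^-1 ^+ n).
  move=> t0 t1; rewrite normcM; apply: ler_pM => //; rewrite ?normc_ge0 //.
  apply: IH; rewrite normcM normcR (ger0_norm (ltW t0)).
  by apply: le_trans w4; rewrite ler_piMl ?normc_ge0 // (ltW t1).
have r0 : r n.+1 0 = 0.
  rewrite /r mul0r cexp0 /E big_ord_recl fact0 invr1 expr0 mulr1 big1 ?addr0 ?subrr //.
  by move=> i _; rewrite expr0n /= mulr0.
have cr t : ccont (r n.+1) t := cder_cont (dr t).
have E1 : cexp w - \sum_(i < n.+1) (i`!%:R)^-1 * w ^+ i = r n.+1 1 - r n.+1 0.
  by rewrite r0 subr0 /r /E mul1r.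
rewrite E1; apply: (le_trans (normc_le_reim _)).
rewrite (reD (r n.+1 1)) (imD (r n.+1 1)) (reN (r n.+1 0)) (imN (r n.+1 0)).
have -> : expR 1 * 2^-1 ^+ n.+1 = 4^-1 * (expR 1 * 2^-1 ^+ n) * (1 - 0) +
   4^-1 * (expR 1 * 2^-1 ^+ n) * (1 - 0) :> R by rewrite exprS; field.
apply: lerD.
  apply: (@mvt_off_finite R (fun t => re (r n.+1 t)) (fun t => re (w * r n t)) [::] _ 0 1 ler01).
  - by apply: continuous_subspaceT => t; exact: (cr t).1.
  - by move=> u _ _ _; exact: (dr u).1.
  - by move=> u u0 u1 _; apply: (le_trans (le_norm_re _)); exact: bnd.
apply: (@mvt_off_finite R (fun t => im (r n.+1 t)) (fun t => im (w * r n t)) [::] _ 0 1 ler01).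
- by apply: continuous_subspaceT => t; exact: (cr t).2.
- by move=> u _ _ _; exact: (dr u).2.
- by move=> u u0 u1 _; apply: (le_trans (le_norm_im _)); exact: bnd.
Qed.

Lemma appr_exp f (c : C) : appr f -> (forall p, N p -> normc (f p - c) <= 4^-1) ->
  appr (fun p => cexp (f p)).
Proof.
move=> af fc; pose g p := f p - c.
have ag : appr g by apply: apprD => //; exact: appr_cst.
rewrite (_ : (fun _ => _) = fun p => cexp c * cexp (g p)); last first.
  by apply/funext => p; rewrite -cexpD /g addrC subrK.
apply: apprM; first exact: appr_cst.
apply: (@appr_lim _ (fun n p => \sum_(i < n) (i`!%:R)^-1 * g p ^+ i) (expR 1)).
  move=> n; apply: (@appr_sum (fun i p => (i`!%:R)^-1 * g p ^+ i)) => i.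
  by apply: apprM; [exact: appr_cst|exact: apprX].
by move=> n p Np; apply: cexp_taylor; exact: fc.
Qed.

(** Newton iteration with a frozen slope c: the solutions t of q t = r z are
    uniform limits of polynomials in z. *)
Lemma appr_newton f (q r : {poly C}) (c t0 : C) (d Mz : R) : c != 0 ->
  (forall p, N p -> normc (z p) <= Mz) ->
  (forall p, N p -> q.[f p] = r.[z p]) ->
  (forall p, N p -> normc (f p - t0) <= d) ->
  (forall a b, normc (a - t0) <= 3 * d -> normc (b - t0) <= 3 * d ->
     normc (q.[a] - q.[b] - c * (a - b)) <= 2^-1 * normc c * normc (a - b)) ->
  appr f.
Proof.
move=> c0 bz qr fd qc.
pose T := fix T n : {poly C} := if n is n'.+1 then T n' - c^-1 *: (q \Po T n' - r) else t0%:P.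
have TS n : T n.+1 = T n - c^-1 *: (q \Po T n - r) by [].
have nc : 0 < normc c by rewrite normc_gt0.
have az : appr z.
  rewrite (_ : z = fun p => ('X : {poly C}).[z p]).
    by apply: (@appr_poly _ Mz) => p /bz; rewrite hornerX.
  by apply/funext => p; rewrite hornerX.
apply: (@appr_lim _ (fun n p => (T n).[z p]) d).
  by move=> n; exact: appr_polyfun.
move=> n p Np; have d0 : 0 <= d by apply: le_trans (fd p Np); exact: normc_ge0.
elim: n => [|n IH]; first by rewrite expr0 mulr1 hornerC; exact: fd.
have Td : normc (f p - (T n).[z p]) <= d.
  by apply: (le_trans IH); rewrite ler_piMr // exprn_ile1 ?invr_ge0 // invf_le1 // ler1n.
rewrite TS hornerD hornerN hornerZ hornerD hornerN horner_comp -qr //.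
have -> : f p - ((T n).[z p] - c^-1 * (q.[(T n).[z p]] - q.[f p])) =
   - (c^-1 * (q.[f p] - q.[(T n).[z p]] - c * (f p - (T n).[z p]))) by field.
rewrite normcN normcM normcV mulrC ler_pdivrMr //.
have := qc (f p) (T n).[z p].
move=> /(_ _ _) /le_trans; apply.
- by apply: (le_trans (fd p Np)); rewrite ler_peMl // ler1n.
- have -> : (T n).[z p] - t0 = (f p - t0) - (f p - (T n).[z p]) by ring.
  apply: (le_trans (le_normcB _ _)).
  have -> : 3 * d = d + d + d by ring.
  by rewrite -[X in X <= _]addr0; apply: lerD => //; apply: lerD => //; exact: fd.
- have -> : d * 2^-1 ^+ n.+1 * normc c = 2^-1 * normc c * (d * 2^-1 ^+ n).
    by rewrite exprS; ring.
  by rewrite ler_wpM2l // mulr_ge0 ?invr_ge0 // ltW.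
Qed.

End Approximation.

(** * Local exactness on the curve *)

Section CurveLocal.
Context {R : realType}.
Local Notation C := R[i].
Local Notation PC := {poly {poly C}}.
Variable l : C.
Implicit Types (A B : PC) (sg : R -> option (C * C)).

Lemma normc_nat k : normc (k%:R : C) = k%:R.
Proof. by rewrite -(rmorph_nat (real_complex R)) normcR normr_nat. Qed.

Definition coordp (b : bool) sg : R -> C := if b then px sg else py sg.

Definition on_curve sg (u : R) := \forall v \near u, exists2 p, sg v = Some p & curve l p.

Lemma path_C1_curve_der sg u : path_C1 sg u -> on_curve sg u ->
  (cubic l)^`().[px sg u] * cderive (px sg) u = 2 * py sg u * cderive (py sg) u.
Proof.
move=> g oc; have [dx dy] := path_C1_cder g.
have d1 := cder_poly (cubic l) dx; have d2 := cderX 2 dy.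
rewrite -(cder_derive d1); apply: cder_derive.
apply: (@cder_eq _ _ _ (2%:R * py sg u ^+ 2.-1 * cderive (py sg) u)) => //.
apply: cder_near d2.
by apply: filterS oc => v [[x y] E Ec]; rewrite /px /py E.
Qed.

Lemma cubic_deriv x : (cubic l)^`().[x] = x ^+ 2 + x * x + x ^+ 2 - (1 + l) * (x + x) + l.
Proof. by rewrite /cubic -polyC1 !derivM !derivXsubC derivX !hornerE; ring. Qed.

Lemma cubic_diff a b : (cubic l).[a] - (cubic l).[b] =
  (a - b) * (a ^+ 2 + a * b + b ^+ 2 - (1 + l) * (a + b) + l).
Proof. by rewrite !cubicE; ring. Qed.

Hypotheses (l0 : l != 0) (l1 : l != 1).

Lemma cubic_smooth x : (cubic l).[x] = 0 -> (cubic l)^`().[x] != 0.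
Proof.
rewrite cubicE cubic_deriv => /eqP; rewrite !mulf_eq0 -orbA.
move=> /or3P[/eqP ->|/eqP|/eqP].
- by rewrite expr0n /= !mul0r !addr0 mulr0 subr0 add0r.
- move/subr0_eq ->; apply: contra l1 => /eqP E; apply/eqP/esym/eqP.
  by rewrite -subr_eq0 -E; apply/eqP; ring.
- move/subr0_eq ->; have -> : l ^+ 2 + l * l + l ^+ 2 - (1 + l) * (l + l) + l = l * (l - 1) by ring.
  by rewrite mulf_neq0 // subr_eq0.
Qed.

Definition box (p0 : C * C) (e : R) : set (C * C) :=
  [set p | [/\ curve l p, normc (p.1 - p0.1) <= e & normc (p.2 - p0.2) <= e]].

Lemma normc_near (x y : C) (e : R) : normc (x - y) <= e -> normc x <= normc y + e.
Proof.
by move=> h; rewrite -{1}[x](subrK y) addrC (le_trans (le_normcD _ _)) // lerD2l.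
Qed.

(** At a point with y != 0 the coordinate is x, and y is the solution of
    y^2 = f(x) near y0, found by Newton iteration. *)
Lemma appr_box_fst (p0 : C * C) A B : curve l p0 -> p0.2 != 0 ->
  exists e, [/\ 0 < e, forall p, box p0 e p -> p.2 != 0 & appr (box p0 e) fst
    (fun p => cexp p.2 * (A.[p.1, p.2] + B.[p.1, p.2] * ((cubic l)^`().[p.1] * (2 * p.2)^-1)))].
Proof.
case: p0 => x0 y0 cp /= y00; pose e := Num.min 4^-1 (normc y0 / 6).
have ny : 0 < normc y0 by rewrite normc_gt0.
have e0 : 0 < e by rewrite lt_min invr_gt0 ltr0n divr_gt0.
have e4 : e <= 4^-1 by rewrite ge_min lexx.
have e6 : e <= normc y0 / 6 by rewrite ge_min lexx orbT.
have half : e <= 2^-1 * normc y0.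
  apply: (le_trans e6); rewrite mulrC ler_wpM2r ?normc_ge0 //.
  by rewrite lef_pV2 ?posrE // ler_nat.
exists e; split => //.
  move=> p [_ _ /= h]; apply: contraTneq h => ->; rewrite sub0r normcN -ltNge.
  by apply: (le_lt_trans half); rewrite gtr_pMl // invf_lt1 // ltr1n.
have bz p : box (x0, y0) e p -> normc p.1 <= normc x0 + e.
  by move=> [_ h _]; exact: normc_near.
have ax : appr (box (x0, y0) e) fst (fun p => p.1).
  rewrite (_ : (fun p => p.1) = fun p : C * C => ('X : {poly C}).[p.1]).
    by apply: (@appr_poly _ _ fst _ (normc x0 + e)) => p /bz; rewrite hornerX.
  by apply/funext => p; rewrite hornerX.
have n2 : normc (2 : C) = 2 by exact: normc_nat.
have ay : appr (box (x0, y0) e) fst (fun p => p.2).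
  apply: (@appr_newton _ _ fst (fun p => p.2) 'X^2 (cubic l) (2 * y0) y0 e _ _ bz).
  - by rewrite mulf_neq0 // pnatr_eq0.
  - by move=> [x y] [cp' _ _]; rewrite hornerXn.
  - by move=> p [].
  move=> a b ha hb; rewrite !hornerXn.
  have -> : a ^+ 2 - b ^+ 2 - 2 * y0 * (a - b) = ((a - y0) + (b - y0)) * (a - b) by ring.
  rewrite normcM ler_wpM2r ?normc_ge0 // normcM n2 mulKf ?pnatr_eq0 //.
  apply: (le_trans (le_normcD _ _)); apply: (le_trans (lerD ha hb)).
  have -> : 3 * e + 3 * e = e * 6 by ring.
  by rewrite -ler_pdivlMr.
apply: apprM; first by apply: (appr_exp (c := y0)) => // p [_ _ h]; exact: le_trans e4.
apply: apprD; first exact: appr_ev.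
apply: apprM; first exact: appr_ev.
apply: apprM; first exact: appr_polyfun.
apply: (apprV (c := 2 * y0)); first by rewrite mulf_neq0 // pnatr_eq0.
  by apply: apprM => //; exact: appr_cst.
move=> p [_ _ h]; have -> : 1 - 2 * p.2 / (2 * y0) = - (p.2 - y0) / y0.
  by field; rewrite y00.
rewrite normcM normcN normcV ler_pdivrMr //; exact: le_trans half.
Qed.

(** At a point with y = 0 the coordinate is y, since f' does not vanish there, and x
    is the solution of f(x) = y^2 near x0. *)
Lemma appr_box_snd (p0 : C * C) A B : curve l p0 -> p0.2 = 0 ->
  exists e, [/\ 0 < e, forall p, box p0 e p -> (cubic l)^`().[p.1] != 0 & appr (box p0 e) snd
    (fun p => cexp p.2 * (A.[p.1, p.2] * (2 * p.2 * ((cubic l)^`().[p.1])^-1) + B.[p.1, p.2]))].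
Proof.
case: p0 => x0 y0 cp /= y00; subst y0.
have fx0 : (cubic l).[x0] = 0 by move: cp; rewrite /curve /= expr0n.
set c := (cubic l)^`().[x0]; have c0 : c != 0 by exact: cubic_smooth.
have nc : 0 < normc c by rewrite normc_gt0.
pose K := 2 + 3 * normc x0 + normc (1 + l).
have K0 : 0 < K by rewrite /K -addrA ltr_wpDr // addr_ge0 ?mulr_ge0 ?normc_ge0.
pose e := Num.min 4^-1 (normc c / (12 * K)).
have e0 : 0 < e by rewrite lt_min invr_gt0 ltr0n divr_gt0 // mulr_gt0.
have e4 : e <= 4^-1 by rewrite ge_min lexx.
have eK : e <= normc c / (12 * K) by rewrite ge_min lexx orbT.
have n3 : normc (3 : C) = 3 by exact: normc_nat.
have Dbound a b : normc (a - x0) <= 3 * e -> normc (b - x0) <= 3 * e ->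
    normc (a ^+ 2 + a * b + b ^+ 2 - (1 + l) * (a + b) + l - c) <= 2^-1 * normc c.
  move=> ha hb; set al := a - x0; set be := b - x0.
  have -> : a ^+ 2 + a * b + b ^+ 2 - (1 + l) * (a + b) + l - c =
    (al * al + be * (al + be)) + (3 * x0 - (1 + l)) * (al + be).
    by rewrite /c cubic_deriv /al /be; ring.
  have nal : normc al <= 1.
    by apply: (le_trans ha); apply: (@le_trans _ _ (3 * 4^-1)); [rewrite ler_wpM2l|lra].
  have nab : normc (al + be) <= 6 * e.
    apply: (le_trans (le_normcD _ _)); apply: (le_trans (lerD ha hb)).
    by rewrite -mulrDl -natrD.
  have nbe : normc be <= 1.
    by apply: (le_trans hb); apply: (@le_trans _ _ (3 * 4^-1)); [rewrite ler_wpM2l|lra].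
  apply: (@le_trans _ _ (K * (6 * e))); last first.
    apply: (@le_trans _ _ (K * (6 * (normc c / (12 * K))))).
      by rewrite ler_wpM2l ?(ltW K0) // ler_wpM2l.
    have -> // : forall k : R, 0 < k -> k * (6 * (normc c / (12 * k))) = 2^-1 * normc c.
    by move=> k k0; field; rewrite gt_eqF.
  have e60 : 0 <= 6 * e by rewrite mulr_ge0 // ltW.
  have -> : K * (6 * e) = (6 * e + 6 * e) + (3 * normc x0 + normc (1 + l)) * (6 * e).
    by rewrite /K; ring.
  apply: (le_trans (le_normcD _ _)); apply: lerD.
    apply: (le_trans (le_normcD _ _)); rewrite !normcM; apply: lerD.
      apply: (@le_trans _ _ (normc al)); first by rewrite ler_piMl ?normc_ge0.
      by apply: (le_trans ha); rewrite ler_wpM2r ?(ltW e0) // ler_nat.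
    by apply: le_trans nab; rewrite ler_piMl ?normc_ge0.
  rewrite normcM; apply: ler_pM; rewrite ?normc_ge0 //.
  by apply: (le_trans (le_normcB _ _)); rewrite normcM n3.
have near_c p : box (x0, 0) e p -> normc ((cubic l)^`().[p.1] - c) <= 2^-1 * normc c.
  move=> [_ h _]; have h3 : normc (p.1 - x0) <= 3 * e.
    by apply: (le_trans h); rewrite ler_peMl ?ler1n // ltW.
  by rewrite cubic_deriv; have := Dbound _ _ h3 h3; rewrite -expr2.
exists e; split => //.
  move=> p /near_c; apply: contraTneq => ->; rewrite sub0r normcN -ltNge.
  by rewrite gtr_pMl // invf_lt1 // ltr1n.
have bz p : box (x0, 0) e p -> normc p.2 <= e.
  by move=> [_ _ /=]; rewrite subr0.
have ay : appr (box (x0, 0) e) snd (fun p => p.2).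
  rewrite (_ : (fun p => p.2) = fun p : C * C => ('X : {poly C}).[p.2]).
    by apply: (@appr_poly _ _ snd _ e) => p /bz; rewrite hornerX.
  by apply/funext => p; rewrite hornerX.
have ax : appr (box (x0, 0) e) snd (fun p => p.1).
  apply: (@appr_newton _ _ snd (fun p => p.1) (cubic l) 'X^2 c x0 e _ c0 bz).
  - by move=> [x y] [cp' _ _]; rewrite hornerXn.
  - by move=> p [].
  move=> a b ha hb; rewrite cubic_diff.
  set D := _ + l; have -> : (a - b) * D - c * (a - b) = (D - c) * (a - b) by ring.
  by rewrite normcM ler_wpM2r ?normc_ge0 //; exact: Dbound.
apply: apprM.
  apply: (appr_exp (c := 0)) => // p [_ _ /= h]; exact: le_trans e4.
apply: apprD; last exact: appr_ev.
apply: apprM; first exact: appr_ev.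
apply: apprM; first by apply: apprM => //; exact: appr_cst.
apply: (apprV (c := c)) => //; first exact: appr_polyfun.
move=> p bp; have -> : 1 - (cubic l)^`().[p.1] / c = - ((cubic l)^`().[p.1] - c) / c by field.
by rewrite normcM normcN normcV ler_pdivrMr //; exact: near_c.
Qed.

Definition form_approx A B (p0 : C * C) (e : R) (b : bool) (H : {poly C}) (eta : R) :=
  forall sg u, path_C1 sg u -> on_curve sg u ->
    normc (px sg u - p0.1) <= e -> normc (py sg u - p0.2) <= e ->
    normc (integrand A B sg u - H.[coordp b sg u] * cderive (coordp b sg) u)
      <= eta * normc (cderive (coordp b sg) u).

(** The local exactness behind Stokes. A form exp y (A dx + B dy) is h(z) dz with
    z = x or z = y, and h is a uniform limit of polynomials H; the error is
    measured against |dz| so that it integrates to eta times the length. *)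
Lemma curve_local_exact (p0 : C * C) A B : curve l p0 ->
  exists (b : bool) (e : R), 0 < e /\ forall eta, 0 < eta -> exists H : {poly C},
  form_approx A B p0 e b H eta.
Proof.
move=> cp.
have onb sg u e : on_curve sg u -> normc (px sg u - p0.1) <= e ->
    normc (py sg u - p0.2) <= e -> box p0 e (px sg u, py sg u).
  move=> oc h1 h2; split => //.
  by have [[x y] E Ec] := nbhs_singleton oc; rewrite /px /py E.
have [y0|y0] := eqVneq p0.2 0.
  have [e [e0 nz [_ ap]]] := appr_box_snd A B cp y0.
  exists false, e; split => // eta /ap [H HH]; exists H => sg u g oc h1 h2.
  have bx := onb _ _ _ oc h1 h2; have /= Hb := HH _ bx; have /= f0 := nz _ bx.
  have E := path_C1_curve_der g oc.
  rewrite /= in Hb; rewrite /coordp /integrand.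
  have -> : cderive (px sg) u = 2 * py sg u / (cubic l)^`().[px sg u] * cderive (py sg) u.
    by apply: (mulfI f0); rewrite E; field.
  rewrite (_ : _ - _ = (cexp (py sg u) * (A.[px sg u, py sg u] *
     (2 * py sg u * ((cubic l)^`().[px sg u])^-1) + B.[px sg u, py sg u]) - H.[py sg u]) *
     cderive (py sg) u); last by ring.
  by rewrite normcM ler_wpM2r ?normc_ge0.
have [e [e0 nz [_ ap]]] := appr_box_fst A B cp y0.
exists true, e; split => // eta /ap [H HH]; exists H => sg u g oc h1 h2.
have bx := onb _ _ _ oc h1 h2; have /= Hb := HH _ bx; have /= f0 := nz _ bx.
have E := path_C1_curve_der g oc.
rewrite /= in Hb; rewrite /coordp /integrand.
have f2 : 2 * py sg u != 0 by rewrite mulf_neq0 // pnatr_eq0.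
have -> : cderive (py sg) u = (cubic l)^`().[px sg u] * (2 * py sg u)^-1 * cderive (px sg) u.
  by apply: (mulfI f2); rewrite -E; field.
rewrite (_ : _ - _ = (cexp (py sg u) * (A.[px sg u, py sg u] + B.[px sg u, py sg u] *
   ((cubic l)^`().[px sg u] * (2 * py sg u)^-1)) - H.[px sg u]) *
   cderive (px sg) u); last by ring.
by rewrite normcM ler_wpM2r ?normc_ge0.
Qed.

End CurveLocal.

(** * Stokes on squares away from oo *)

Section Stokes.
Context {R : realType}.
Local Notation C := R[i].
Local Notation PC := {poly {poly C}}.
Variables (n : nat) (l : C) (s : @sing R n).
Hypotheses (l0 : l != 0) (l1 : l != 1) (adm : admissible l s).
Local Notation V := ('rV[R]_n.+1).
Variables (A B : PC).
Implicit Types (p q w : V).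

Definition sline p q c (u : R) : option (C * C) := spt s (line p q c u).

Definition line_int p q c x y : C := cint x y (integrand A B (sline p q c)).

Lemma spt_curve w (p : C * C) : spt s w = Some p -> curve l p.
Proof.
have [cu _ _ _ _] := adm; rewrite /spt; case: insubP => //= v _ _; exact: cu.
Qed.

Lemma path_C1_on_curve p q c u : path_C1 (sline p q c) u -> on_curve l (sline p q c) u.
Proof.
move=> /path_C1_some; apply: filterS => v E.
by exists (px (sline p q c) v, py (sline p q c) v) => //; exact: spt_curve E.
Qed.

Lemma horner_evXY1 (x y : C) : (1 : PC).[x, y] = 1.
Proof. by rewrite -[1 : PC]polyC1 hornerC -polyC1 hornerC. Qed.

Lemma poly_antideriv (H : {poly C}) : exists G : {poly C}, deriv G = H.
Proof.
exists (\poly_(i < (size H).+1) (H`_i.-1 / i%:R)); apply/polyP => i.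
rewrite coef_deriv coef_poly ltnS /=; case: ltnP => [_|h].
  by rewrite -[LHS]mulr_natr mulfVK // pnatr_eq0.
by rewrite mul0rn nth_default.
Qed.

Lemma sline_ccont_itv p q c x y b :
  (forall u, x <= u -> u <= y -> in_splx (line p q c u)) ->
  (forall u, x <= u -> u <= y -> sline p q c u <> None) ->
  ccont_itv (coordp b (sline p q c)) x y.
Proof.
move=> inS noo u /andP[xu uy] e e0.
have := adm_cont adm (Sub (line p q c u) (inS u xu uy) : splx n) 0 e0.
rewrite -[s _]spt_val SubK => /near_line /nbhs_ballP [d /= d0 Hd].
exists d => // v /andP[xv vy] uv.
have [|_ ] := Hd v _ (inS v xv vy); first by rewrite /ball /= distrC.
case E : (spt s (line p q c u)) (noo u xu uy) => [p0|]; last by rewrite /sline E.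
move=> _ /(_ p0 erefl) [p1 [E1 h1 h2]].
by case: b; rewrite /coordp /px /py /sline E E1.
Qed.

Lemma line_int_xx p q c x : line_int p q c x x = 0.
Proof. by rewrite /line_int /cint /cintegral set_itv1 !Rintegral_set1. Qed.

(** A side of a small square contributes the difference of a primitive G at its
    ends up to eta L; the four differences cancel in rect_local. To bound |dz| along
    the side, dz is written as exp (- y) times one of the integrands. *)
Lemma side_approx p q c x y (b : bool) (e : R) (p0 : C * C) : `|c| <= 1 -> x <= y -> 0 < e ->
  (forall u, x <= u -> u <= y -> in_splx (line p q c u)) ->
  (forall u, x <= u -> u <= y -> exists r : C * C, [/\ sline p q c u = Some r,
      normc (r.1 - p0.1) < e & normc (r.2 - p0.2) < e]) ->
  exists2 L, 0 <= L & forall eta (H G : {poly C}), 0 < eta -> deriv G = H ->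
    form_approx l A B p0 e b H eta ->
    normc (line_int p q c x y -
      (G.[coordp b (sline p q c) y] - G.[coordp b (sline p q c) x])) <= eta * L.
Proof.
move=> c1 xy e0 inS noo; move: xy; rewrite le_eqVlt => /orP[/eqP <-|xy].
  by exists 0 => // eta H G _ _ _; rewrite line_int_xx !subrr normc0 mulr0.
have noo' u : x <= u -> u <= y -> sline p q c u <> None.
  by move=> xu uy; have [p1 [-> _ _]] := noo u xu uy.
have noo2 u : x < u -> u < y -> sline p q c u <> None.
  by move=> xu uy; apply: noo'; exact: ltW.
have [bad1 [M1 H1]] := adm_path adm A B c1 xy inS noo2.
have [D1 D1E] : exists D : PC, forall v w : C, D.[v, w] = if b then 1 else 0.
  by exists (if b then 1 else 0); case: (b) => v w; [exact: horner_evXY1|exact: hornerXY0].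
have [D2 D2E] : exists D : PC, forall v w : C, D.[v, w] = if b then 0 else 1.
  by exists (if b then 0 else 1); case: (b) => v w; [exact: hornerXY0|exact: horner_evXY1].
have [bad2 [M2 H2]] := adm_path adm D1 D2 c1 xy inS noo2.
pose Mz := expR (normc p0.2 + e) * `|M2|.
have Mz0 : 0 <= Mz by rewrite mulr_ge0 // expR_ge0.
set sg := sline p q c.
have zb u : x < u -> u < y -> u \notin bad1 ++ bad2 ->
    [/\ path_C1 sg u, normc (integrand A B sg u) <= M1,
     normc (cderive (coordp b sg) u) <= Mz &
     normc (px sg u - p0.1) <= e /\ normc (py sg u - p0.2) <= e].
  move=> xu uy; rewrite mem_cat negb_or => /andP[ub1 ub2].
  have [g i1] := H1 u xu uy ub1; have [_ i2] := H2 u xu uy ub2.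
  have [p1 [E h1 h2]] := noo u (ltW xu) (ltW uy).
  split => //; last by rewrite /px /py /sg E; split; exact: ltW.
  have -> : cderive (coordp b sg) u = cexp (- py sg u) * integrand D1 D2 sg u.
    rewrite /integrand mulrA -cexpD addNr cexp0 mul1r D1E D2E /coordp.
    by case: (b); rewrite mul1r mul0r ?addr0 ?add0r.
  rewrite normcM; apply: ler_pM; rewrite ?normc_ge0 //; last first.
    by apply: (le_trans i2); exact: ler_norm.
  rewrite normc_cexp ler_expR; apply: (le_trans (ler_norm _)).
  apply: (le_trans (le_norm_re _)); rewrite normcN.
  apply: normc_near; rewrite /py /sg E; exact: ltW.
exists (2 * Mz * (y - x)).
  by rewrite !mulr_ge0 // subr_ge0 ltW.
move=> eta H G eta0 GH HH.
have P1 : pwcc (integrand A B sg) (bad1 ++ bad2) M1 x y.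
  by move=> u xu uy ub; have [g i _ _] := zb u xu uy ub; split; [exact: path_C1_ccont|exact: i].
have D u : x < u -> u < y -> u \notin bad1 ++ bad2 ->
    normc (integrand A B sg u - H.[coordp b sg u] * cderive (coordp b sg) u) <= eta * Mz.
  move=> xu uy ub; have [g _ i [h1 h2]] := zb u xu uy ub.
  apply: (le_trans (HH sg u g (path_C1_on_curve g) h1 h2)).
  by rewrite ler_wpM2l // ltW.
have cz u : path_C1 sg u -> cder (coordp b sg) u (cderive (coordp b sg) u) /\
    ccont (cderive (coordp b sg)) u.
  move=> g; have [dx dy] := path_C1_cder g; have [cx cy] := path_C1_ccont_der g.
  by rewrite /coordp; case: (b).
have P2 : pwcc (fun u => H.[coordp b sg u] * cderive (coordp b sg) u)
    (bad1 ++ bad2) (M1 + eta * Mz) x y.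
  move=> u xu uy ub; have [g i _ _] := zb u xu uy ub; have [dz cz'] := cz u g; split.
    by apply: ccontM; [apply: ccont_poly; exact: cder_cont dz|exact: cz'].
  rewrite -[X in normc X](subrK (integrand A B sg u)) addrC.
  apply: (le_trans (le_normcD _ _)); apply: lerD => //.
  by rewrite normcB; exact: D.
rewrite /line_int -/sg -(@cint_FTC _ (fun u => G.[coordp b sg u]) _ _ _ _ _ (ltW xy) P2).
- rewrite -(cintB P1 P2).
  have P3 : pwcc (fun u => integrand A B sg u - H.[coordp b sg u] * cderive (coordp b sg) u)
     (bad1 ++ bad2) (eta * Mz) x y.
    move=> u xu uy ub; split; last exact: D.
    have [k1 _] := P1 u xu uy ub; have [k2 _] := P2 u xu uy ub.
    by apply: ccontD; [exact: k1|exact: ccontN].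
  apply: (le_trans (cint_bound (ltW xy) P3)).
  by rewrite le_eqVlt; apply/orP; left; apply/eqP; ring.
- by move=> u; apply: ccont_poly; apply: (ccont_itv_within (sline_ccont_itv b inS noo')).
- move=> u xu uy ub; have [g _ _ _] := zb u xu uy ub; have [dz _] := cz u g.
  by rewrite -GH; exact: cder_poly.
Qed.

Variables (a0 a1 b0 b1 Q : V) (c : R -> R).
Hypothesis hc : forall t, 0 <= t -> t <= 1 ->
  (1 - t) *: a1 + t *: b1 = c t *: Q /\ `|c t| <= 1.

(** A bilinear square in the simplex: lines of the simplex in both directions. The
    horizontal ones, of fixed t, all have direction Q and speed c t, so that the
    estimates for one direction apply to all of them. *)
Definition pt (u t : R) : V := (1 - t) *: (a0 + u *: a1) + t *: (b0 + u *: b1).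

Hypothesis inS : forall u t, 0 <= u -> u <= 1 -> 0 <= t -> t <= 1 -> in_splx (pt u t).

Lemma hor_pt t u : 0 <= t -> t <= 1 ->
  line ((1 - t) *: a0 + t *: b0) Q (c t) u = pt u t.
Proof.
move=> t0 t1; rewrite /line mulrC -scalerA -(hc t0 t1).1 /pt !scalerDr !scalerA.
by rewrite [u * _]mulrC [u * _]mulrC addrACA.
Qed.

Definition ver_dir u : V := (b0 + u *: b1) - (a0 + u *: a1).

Lemma ver_pt t u : line (a0 + u *: a1) (ver_dir u) 1 t = pt u t.
Proof.
rewrite /line /ver_dir /pt mul1r; move: (a0 + _) (b0 + _) => a b.
by rewrite scalerBr scalerBl scale1r addrA addrAC.
Qed.

Definition hor_int t x y := line_int ((1 - t) *: a0 + t *: b0) Q (c t) x y.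
Definition ver_int u x y := line_int (a0 + u *: a1) (ver_dir u) 1 x y.
Definition rect x y x' y' := hor_int x' x y + ver_int y x' y' - hor_int y' x y - ver_int x x' y'.

Lemma pt_continuous : continuous (fun z : R * R => pt z.1 z.2).
Proof.
move=> z; have c1 : {for z, continuous (fun z : R * R => z.1)} by exact: cvg_fst.
have c2 : {for z, continuous (fun z : R * R => z.2)} by exact: cvg_snd.
have cc (w : V) : {for z, continuous (fun=> w)} by exact: cst_continuous.
have c3 : {for z, continuous (fun z : R * R => 1 - z.2)}.
  by apply: continuousB => //; exact: cst_continuous.
have c4 (w w' : V) : {for z, continuous (fun z : R * R => w + z.1 *: w')}.
  exact: continuousD (cc w) (continuousZ c1 (cc w')).
exact: continuousD (continuousZ c3 (c4 a0 a1)) (continuousZ c2 (c4 b0 b1)).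
Qed.

Definition zc (b : bool) (o : option (C * C)) : C :=
  if o is Some p then (if b then p.1 else p.2) else 0.

Lemma rect_local u0 t0 : 0 <= u0 -> u0 <= 1 -> 0 <= t0 -> t0 <= 1 ->
  spt s (pt u0 t0) <> None -> exists2 d, 0 < d & forall x y x' y',
    u0 - d < x -> x <= y -> y < u0 + d -> 0 <= x -> y <= 1 ->
    t0 - d < x' -> x' <= y' -> y' < t0 + d -> 0 <= x' -> y' <= 1 -> rect x y x' y' = 0.
Proof.
move=> u00 u01 t00 t01; case Ep : (spt s (pt u0 t0)) => [p0|] // _.
have [b [e [e0 Hloc]]] := curve_local_exact l0 l1 A B (spt_curve Ep).
have := adm_cont adm (Sub (pt u0 t0) (inS u00 u01 t00 t01) : splx n) 0 e0.
rewrite -[s _]spt_val SubK Ep => N1.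
have := @pt_continuous (u0, t0) _ N1 => /nbhs_ballP [d /= d0 Hd].
exists d => // x y x' y' dx xy dy x0 y1 dx' xy' dy' x0' y1'.
have near_pt u t : x <= u -> u <= y -> x' <= t -> t <= y' ->
    exists p : C * C, [/\ spt s (pt u t) = Some p,
      normc (p.1 - p0.1) < e & normc (p.2 - p0.2) < e].
  move=> xu uy xt ty; have := Hd (u, t).
  have bl : ball (u0, t0) d (u, t).
    split; rewrite /ball /= ltr_distlC; apply/andP; split.
    - exact: lt_le_trans xu.
    - exact: le_lt_trans dy.
    - exact: lt_le_trans xt.
    - exact: le_lt_trans dy'.
  move=> /(_ bl) [|_ H]; last exact: H.
  apply: inS => /=; [exact: le_trans xu|exact: le_trans y1|
    exact: le_trans xt|exact: le_trans y1'].
have zcE p q k u : coordp b (sline p q k) u = zc b (sline p q k u) by case: (b).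
have hor t : x' <= t -> t <= y' -> exists2 L, 0 <= L & forall eta (H G : {poly C}),
    0 < eta -> deriv G = H ->
    form_approx l A B p0 e b H eta ->
    normc (hor_int t x y - (G.[zc b (spt s (pt y t))] - G.[zc b (spt s (pt x t))])) <= eta * L.
  move=> xt ty; have t0_ : 0 <= t by exact: le_trans xt.
  have t1_ : t <= 1 by exact: le_trans y1'.
  have [||L L0' HL] := @side_approx ((1 - t) *: a0 + t *: b0) Q (c t) x y b e p0 (hc t0_ t1_).2 xy e0.
  - by move=> u xu uy; rewrite hor_pt //; apply: inS => //; [exact: le_trans xu|exact: le_trans y1].
  - by move=> u xu uy; rewrite /sline hor_pt //; apply: near_pt.
  exists L => // eta H G eta0 GH HH; have := HL eta H G eta0 GH HH.
  by rewrite !zcE /sline !hor_pt.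
have ver u : x <= u -> u <= y -> exists2 L, 0 <= L & forall eta (H G : {poly C}),
    0 < eta -> deriv G = H ->
    form_approx l A B p0 e b H eta ->
    normc (ver_int u x' y' - (G.[zc b (spt s (pt u y'))] - G.[zc b (spt s (pt u x'))])) <= eta * L.
  move=> xu uy; have n1 : `|1 : R| <= 1 by rewrite normr1.
  have u0_ : 0 <= u by exact: le_trans xu.
  have u1_ : u <= 1 by exact: le_trans y1.
  have [||L L0' HL] := @side_approx (a0 + u *: a1) (ver_dir u) 1 x' y' b e p0 n1 xy' e0.
  - by move=> t xt ty; rewrite ver_pt //; apply: inS => //; [exact: le_trans xt|exact: le_trans y1'].
  - by move=> t xt ty; rewrite /sline ver_pt //; apply: near_pt.
  exists L => // eta H G eta0 GH HH; have := HL eta H G eta0 GH HH.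
  by rewrite !zcE /sline !ver_pt.
have [L1 L10 S1] := hor x' (lexx _) xy'.
have [L2 L20 S2] := ver y xy (lexx _).
have [L3 L30 S3] := hor y' xy' (lexx _).
have [L4 L40 S4] := ver x (lexx _) xy.
have small eta : 0 < eta -> normc (rect x y x' y') <= eta * (L1 + L2 + L3 + L4).
  move=> eta0; have [H HH] := Hloc eta eta0; have [G GH] := poly_antideriv H.
  have := S1 _ _ _ eta0 GH HH; have := S2 _ _ _ eta0 GH HH.
  have := S3 _ _ _ eta0 GH HH; have := S4 _ _ _ eta0 GH HH.
  set g1 := G.[zc b (spt s (pt x x'))]; set g2 := G.[zc b (spt s (pt y x'))].
  set g3 := G.[zc b (spt s (pt x y'))]; set g4 := G.[zc b (spt s (pt y y'))].
  rewrite /rect; move: (hor_int x' x y) (ver_int y x' y') (hor_int y' x y) (ver_int x x' y') g1 g2 g3 g4.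
  move=> j1 j2 j3 j4 g1 g2 g3 g4 h4 h3 h2 h1.
  have -> : j1 + j2 - j3 - j4 = (j1 - (g2 - g1)) + (j2 - (g4 - g2)) -
     (j3 - (g4 - g3)) - (j4 - (g3 - g1)) by ring.
  have := lerD (lerD (lerD h1 h2) h3) h4; rewrite -!mulrDr; apply: le_trans.
  apply: (le_trans (le_normcB _ _)); rewrite lerD2r.
  apply: (le_trans (le_normcB _ _)); rewrite lerD2r.
  exact: le_normcD.
apply/eqP; rewrite -normc_eq0; apply/eqP/le_anti; rewrite normc_ge0 andbT.
apply/ler_addgt0Pr => d' d'0; rewrite add0r.
have S0 : 0 < L1 + L2 + L3 + L4 + 1 by rewrite ltr_wpDl // !addr_ge0.
apply: (le_trans (small (d' / (L1 + L2 + L3 + L4 + 1)) (divr_gt0 d'0 S0))).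
by rewrite mulrAC ler_pdivrMr // ler_pM2l // lerDl.
Qed.

(** Rectangles on which the boundary integral vanishes can be stacked, first in t,
    then in u. *)
Lemma rect_zero tm : 0 <= tm -> tm < 1 ->
  (forall u t, 0 <= u -> u <= 1 -> tm <= t -> t <= 1 -> spt s (pt u t) <> None) ->
  rect 0 1 tm 1 = 0.
Proof.
move=> tm0 tm1 noo.
have hor_split t x y z : tm <= t -> t <= 1 -> 0 <= x -> x <= y -> y <= z -> z <= 1 ->
    hor_int t x z = hor_int t x y + hor_int t y z.
  move=> t0 t1 x0 xy yz z1; have t0_ := le_trans tm0 t0.
  have [xz|zx] := ltP x z; last first.
    have E1 : x = y by lra.
    have E2 : y = z by lra.
    by rewrite E1 E2 /hor_int !line_int_xx addr0.
  have [||bad [M [P _]]] := @adm_pwcc _ _ _ s adm A B ((1 - t) *: a0 + t *: b0) Q (c t) x z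
     (hc t0_ t1).2 xz.
  - by move=> u xu uz; rewrite hor_pt //; apply: inS; lra.
  - by move=> u xu uz; rewrite hor_pt //; apply: noo; lra.
  exact: cint_split P.
have ver_split u x y z : 0 <= u -> u <= 1 -> tm <= x -> x <= y -> y <= z -> z <= 1 ->
    ver_int u x z = ver_int u x y + ver_int u y z.
  move=> u0 u1 x0 xy yz z1.
  have [xz|zx] := ltP x z; last first.
    have E1 : x = y by lra.
    have E2 : y = z by lra.
    by rewrite E1 E2 /ver_int !line_int_xx addr0.
  have n1 : `|1 : R| <= 1 by rewrite normr1.
  have [||bad [M [P _]]] := @adm_pwcc _ _ _ s adm A B (a0 + u *: a1) (ver_dir u) 1 x z n1 xz.
  - by move=> t xt tz; rewrite ver_pt //; apply: inS; lra.
  - by move=> t xt tz; rewrite ver_pt //; apply: noo; lra.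
  exact: cint_split P.
have strip u0 : 0 <= u0 -> u0 <= 1 -> exists2 d, 0 < d & forall x y,
    u0 - d < x -> x <= y -> y < u0 + d -> 0 <= x -> y <= 1 -> rect x y tm 1 = 0.
  move=> u00 u01.
  pose P a b := exists2 d, 0 < d & forall x y,
    u0 - d < x -> x <= y -> y < u0 + d -> 0 <= x -> y <= 1 -> rect x y a b = 0.
  have loc t0 : tm <= t0 -> t0 <= 1 -> exists2 d, 0 < d & forall x y x' y',
    u0 - d < x -> x <= y -> y < u0 + d -> 0 <= x -> y <= 1 ->
    t0 - d < x' -> x' <= y' -> y' < t0 + d -> 0 <= x' -> y' <= 1 -> rect x y x' y' = 0.
    move=> t0m t01; apply: rect_local => //; first exact: le_trans t0m.
    exact: noo.
  apply: (cousin_lr (P := P)) => //.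
  - move=> a b d am ab bd d1 [e1 e10 H1] [e2 e20 H2].
    exists (Num.min e1 e2); first by rewrite lt_min e10.
    move=> x y hx xy hy x0 y1.
    have h1 : Num.min e1 e2 <= e1 by rewrite ge_min lexx.
    have h2 : Num.min e1 e2 <= e2 by rewrite ge_min lexx orbT.
    have lo e' : Num.min e1 e2 <= e' -> u0 - e' < x.
      by move=> h; apply: le_lt_trans hx; rewrite lerD2l lerN2.
    have hi e' : Num.min e1 e2 <= e' -> y < u0 + e'.
      by move=> h; apply: (lt_le_trans hy); rewrite lerD2l.
    have r1 : rect x y a b = 0 by apply: H1 => //; [exact: lo|exact: hi].
    have r2 : rect x y b d = 0 by apply: H2 => //; [exact: lo|exact: hi].
    have y0 : 0 <= y by exact: le_trans xy.
    have x1 : x <= 1 by exact: le_trans y1.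
    have sy := ver_split y a b d y0 y1 am (ltW ab) (ltW bd) d1.
    have sx := ver_split x a b d x0 x1 am (ltW ab) (ltW bd) d1.
    move: r1 r2; rewrite /rect sy sx.
    move: (ver_int y a b) (ver_int y b d) (ver_int x a b) (ver_int x b d)
      (hor_int a x y) (hor_int b x y) (hor_int d x y).
    by move=> v1 v2 v3 v4 h3 h4 h5 r1 r2; rewrite -[RHS](addr0 0) -{1}r1 -r2; ring.
  - move=> t0 t0m t01; have [d d0 H] := loc t0 t0m (ltW t01).
    exists d => // t ht1 ht2 ht3; exists d => // x y hx xy hy x0 y1.
    apply: H => //; [by rewrite ltrBlDr ltrDl|exact: ltW|exact: le_trans t0m].
  - move=> t0 t0m t01; have [d d0 H] := loc t0 (ltW t0m) t01.
    exists d => // t ht1 ht2 ht3; exists d => // x y hx xy hy x0 y1.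
    apply: H => //; [exact: ltW|by rewrite ltrDl|exact: le_trans ht3].
apply: (cousin_lr (P := fun x y => rect x y tm 1 = 0) ltr01).
- move=> x y z x0 xy yz z1 r1 r2.
  have sm := hor_split tm x y z (lexx _) (ltW tm1) x0 (ltW xy) (ltW yz) z1.
  have s1 := hor_split 1 x y z (ltW tm1) (lexx _) x0 (ltW xy) (ltW yz) z1.
  move: r1 r2; rewrite /rect sm s1.
  move: (hor_int tm x y) (hor_int tm y z) (hor_int 1 x y) (hor_int 1 y z)
    (ver_int x tm 1) (ver_int y tm 1) (ver_int z tm 1).
  by move=> v1 v2 v3 v4 h3 h4 h5 r1 r2; rewrite -[RHS](addr0 0) -{1}r1 -r2; ring.
- move=> u0 h0 h1; have [d d0 H] := strip u0 h0 (ltW h1).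
  exists d => // u hu1 hu2 hu3.
  by apply: H => //; [rewrite ltrBlDr ltrDl|exact: ltW].
- move=> u0 h0 h1; have [d d0 H] := strip u0 (ltW h0) h1.
  exists d => // u hu1 hu2 hu3.
  by apply: H => //; [exact: ltW|rewrite ltrDl].
Qed.

End Stokes.

(** * Stokes on squares with a side at oo *)

Section StokesTriangle.
Context {R : realType}.
Local Notation C := R[i].
Local Notation PC := {poly {poly C}}.

Lemma pwcc_ext (h g : R -> C) (B B' : seq R) (M M' a b : R) : a <= b ->
  pwcc h B M a b -> pwcc g B' M' a b ->
  (forall u, a < u -> u < b -> u \notin B -> u \notin B' -> h u = g u) ->
  cint a b h = cint a b g.
Proof.
move=> ab H G E.
have H' : pwcc h (B ++ B') M a b.
  by apply: (pwccW (lexx a) (lexx b) (lexx M) _ H) => x xB; rewrite mem_cat xB.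
have G' : pwcc g (B ++ B') M' a b.
  by apply: (pwccW (lexx a) (lexx b) (lexx M') _ G) => x xB; rewrite mem_cat xB orbT.
have D : pwcc (fun u => h u - g u) (B ++ B') 0 a b.
  move=> u au ub uB; have [c1 _] := H' u au ub uB; have [c2 _] := G' u au ub uB.
  split; first by apply: ccontD; [exact: c1|exact: ccontN].
  by move: uB; rewrite mem_cat negb_or => /andP[u1 u2]; rewrite E // subrr normc0.
have := cint_bound ab D; rewrite mulr0 mul0r (cintB H' G') => h0.
apply/eqP; rewrite -subr_eq0 -normc_eq0; apply/eqP/le_anti.
by rewrite h0 normc_ge0.
Qed.

Lemma integrand_cst (A B : PC) (o : option (C * C)) u : integrand A B (fun=> o) u = 0.
Proof.
rewrite /integrand (@cder_derive _ (px (fun=> o)) u 0); last exact: cder_cst.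
by rewrite (@cder_derive _ (py (fun=> o)) u 0) ?mulr0 ?addr0 ?mulr0 //; exact: cder_cst.
Qed.

Lemma cint_cst_path (A B : PC) (o : option (C * C)) a b : a <= b ->
  cint a b (integrand A B (fun=> o)) = 0.
Proof.
move=> ab; apply: (@cint_eq0 _ _ [::]) => // u _ _ _.
by apply: (@filterE _ (nbhs u)) => v; exact: integrand_cst.
Qed.

Variables (n : nat) (l : C) (s : @sing R n).
Hypotheses (l0 : l != 0) (l1 : l != 1) (adm : admissible l s).
Local Notation V := ('rV[R]_n.+1).
Variables (A B : PC).
Implicit Types (p q w : V).

Section Square.
Variables (a0 a1 b0 b1 Q : V) (c : R -> R).
Hypothesis hc : forall t, 0 <= t -> t <= 1 ->
  (1 - t) *: a1 + t *: b1 = c t *: Q /\ `|c t| <= 1.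
Local Notation sqpt := (pt a0 a1 b0 b1).
Local Notation hside := (hor_int s A B a0 b0 Q c).
Local Notation vside := (ver_int s A B a0 a1 b0 b1).
Hypothesis inS : forall u t, 0 <= u -> u <= 1 -> 0 <= t -> t <= 1 -> in_splx (sqpt u t).

(** Near a point sent to oo the integrand is small on all horizontal lines, and
    [0, 1] is compact. *)
Lemma bottom_small (e : R) : 0 < e ->
  (forall u t, 0 <= u -> u <= 1 -> 0 < t -> t <= 1 -> spt s (sqpt u t) <> None) ->
  (forall u, 0 <= u -> u <= 1 -> spt s (sqpt u 0) = None) ->
  exists2 d, 0 < d & forall t, 0 < t -> t < d -> t <= 1 -> normc (hside t 0 1) <= e.
Proof.
move=> e0 noo oo; have e20 : 0 < e / 2 by rewrite divr_gt0.
have [m [aa [cov sm]]] := adm_cover adm.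
pose P x y := exists2 d, 0 < d & forall t, 0 < t -> t < d -> t <= 1 ->
  normc (hside t x y) <= e * (y - x).
have loc u0 : 0 <= u0 -> u0 <= 1 -> exists2 d, 0 < d & forall x y t,
    u0 - d < x -> x <= y -> y < u0 + d -> 0 <= x -> y <= 1 -> 0 < t -> t < d -> t <= 1 ->
    normc (hside t x y) <= e * (y - x).
  move=> u00 u01.
  pose v : splx n := Sub (sqpt u0 0) (inS u00 u01 (lexx _) ler01).
  have sv : s v = None by rewrite -spt_val SubK; exact: oo.
  have := adm_bound_oo adm A B Q sm sv e20; rewrite SubK => N1.
  have := @pt_continuous _ _ a0 a1 b0 b1 (u0, 0) _ N1 => /nbhs_ballP [d /= d0 Hd].
  exists d => // x y t hx xy hy x0 y1 t0 td t1.
  have -> : e * (y - x) = 2 * (e / 2) * (y - x) by field.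
  have [bad Hbad] : exists bad : seq R, forall u, x < u -> u < y -> u \notin bad ->
    exists j, \forall u' \near u, cell (aa j) (line ((1 - t) *: a0 + t *: b0) Q (c t) u').
    apply: line_cover => u xu uy; apply: cov; rewrite (hor_pt a0 b0 hc) ?(ltW t0) //.
    by apply: inS => //; [exact: le_trans (ltW xu)|exact: le_trans (ltW uy) y1|exact: ltW].
  apply: (cint_bound (B := bad) xy) => u xu uy ub.
  have ux0 : 0 <= u by exact: le_trans (ltW xu).
  have uy1 : u <= 1 by apply: le_trans y1; exact: ltW.
  have [j Kj] := Hbad u xu uy ub.
  have bl : ball (u0, 0) d (u, t).
    split; rewrite /ball /=; last by rewrite sub0r normrN gtr0_norm.
    by rewrite ltr_distlC (lt_trans hx) //= (lt_trans uy).
  have hp := hor_pt a0 b0 hc u (ltW t0) t1.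
  have [|g b] := Hd (u, t) bl j _ (c t) u (hc (ltW t0) t1).2 hp Kj.
    exact: noo.
  by split; [exact: path_C1_ccont|exact: b].
have : P 0 1.
  apply: cousin_lr => //.
  - move=> x y z x0 xy yz z1 [d1 d10 H1] [d2 d20 H2].
    exists (Num.min d1 d2); first by rewrite lt_min d10.
    move=> t t0; rewrite lt_min => /andP[td1 td2] t1.
    have -> : hside t x z = hside t x y + hside t y z.
      have xz : x < z := lt_trans xy yz.
      have [||bad [M [Pw _]]] := @adm_pwcc _ _ _ s adm A B ((1 - t) *: a0 + t *: b0) Q (c t) x z
         (hc (ltW t0) t1).2 xz.
      + move=> u xu uz; rewrite (hor_pt a0 b0 hc) ?(ltW t0) //.
        by apply: inS => //; [exact: le_trans xu|exact: le_trans z1|exact: ltW].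
      + move=> u xu uz; rewrite (hor_pt a0 b0 hc) ?(ltW t0) //.
        by apply: noo => //; [exact: le_trans (ltW xu)|exact: le_trans (ltW uz) z1].
      exact: (cint_split (ltW xy) (ltW yz) Pw).
    apply: (le_trans (le_normcD _ _)).
    have -> : e * (z - x) = e * (y - x) + e * (z - y) by ring.
    by apply: lerD; [exact: H1|exact: H2].
  - move=> u0 h0 h1; have [d d0 H] := loc u0 h0 (ltW h1).
    exists d => // u hu1 hu2 hu3; exists d => // t t0 td t1.
    by apply: H => //; [rewrite ltrBlDr ltrDl|exact: ltW].
  - move=> u0 h0 h1; have [d d0 H] := loc u0 (ltW h0) h1.
    exists d => // u hu1 hu2 hu3; exists d => // t t0 td t1.
    by apply: H => //; [exact: ltW|rewrite ltrDl].
by move=> [d d0 H]; exists d => // t t0 td t1; have := H t t0 td t1; rewrite subr0 mulr1.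
Qed.

(** Stokes above the line t, for t -> 0. The bottom side tends to 0 by bottom_small,
    and the parts of the vertical sides below t tend to 0 since the integrands on
    them are bounded. *)
Lemma square_oo :
  (forall u t, 0 <= u -> u <= 1 -> 0 < t -> t <= 1 -> spt s (sqpt u t) <> None) ->
  (forall u, 0 <= u -> u <= 1 -> spt s (sqpt u 0) = None) ->
  vside 0 0 1 + hside 1 0 1 = vside 1 0 1.
Proof.
move=> noo oo.
have side u : 0 <= u -> u <= 1 -> exists (bad : seq R) M,
    pwcc (integrand A B (sline s (a0 + u *: a1) (ver_dir a0 a1 b0 b1 u) 1)) bad M 0 1.
  move=> u0 u1; have n1 : `|1 : R| <= 1 by rewrite normr1.
  have [||bad [M [P _]]] := @adm_pwcc _ _ _ s adm A B (a0 + u *: a1)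
     (ver_dir a0 a1 b0 b1 u) 1 0 1 n1 ltr01.
  - by move=> t t0 t1; rewrite ver_pt; exact: inS.
  - by move=> t t0 t1; rewrite ver_pt; apply: noo => //; exact: ltW.
  by exists bad, M.
have [bad0 [M0 P0]] := side 0 (lexx _) ler01.
have [bad1 [M1 P1]] := side 1 ler01 (lexx _).
pose M := `|M0| + `|M1| + 1.
have M00 : 0 < M by rewrite ltr_wpDl // addr_ge0.
apply/eqP; rewrite -subr_eq0 -normc_eq0; apply/eqP/le_anti; rewrite normc_ge0 andbT.
apply/ler_addgt0Pr => e e0; rewrite add0r.
have e30 : 0 < e / 3 by rewrite divr_gt0.
have [d d0 Hd] := bottom_small e30 noo oo.
pose t := Num.min (d / 2) (Num.min (2^-1) (e / 3 / (2 * M))).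
have t0 : 0 < t.
  by rewrite !lt_min invr_gt0 ltr0n /= !divr_gt0 // mulr_gt0.
have td : t < d by rewrite gt_min; apply/orP; left; rewrite ltr_pdivrMr // ltr_pMr // ltr1n.
have t1 : t < 1.
  by rewrite !gt_min; apply/orP; right; apply/orP; left; rewrite invf_lt1 // ltr1n.
have tM : 2 * M * t <= e / 3.
  rewrite mulrC -ler_pdivlMr ?mulr_gt0 // !ge_min; apply/orP; right.
  by apply/orP; right.
have hb := Hd t t0 td (ltW t1).
have vsplit u bad M' : pwcc (integrand A B (sline s (a0 + u *: a1)
     (ver_dir a0 a1 b0 b1 u) 1)) bad M' 0 1 -> M' <= M ->
   exists2 r, vside u 0 1 = r + vside u t 1 & normc r <= e / 3.
  move=> Pu MM; exists (vside u 0 t); first exact: (cint_split (ltW t0) (ltW t1) Pu).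
  have Pt := pwccW (lexx 0) (ltW t1) MM (fun x xB => xB) Pu.
  by apply: le_trans tM; have := cint_bound (ltW t0) Pt; rewrite subr0.
have [|r0 E0 n0] := vsplit 0 _ _ P0.
  by apply: (le_trans (ler_norm _)); rewrite /M -addrA lerDl addr_ge0.
have [|r1 E1 n1] := vsplit 1 _ _ P1.
  by apply: (le_trans (ler_norm _)); rewrite /M addrAC lerDr addr_ge0.
have := @rect_zero _ _ _ s l0 l1 adm A B a0 a1 b0 b1 Q c hc inS t (ltW t0) t1.
move=> /(_ (fun u t' u0 u1 tt' t1' => noo u t' u0 u1 (lt_le_trans t0 tt') t1')).
rewrite /rect E0 E1; move: hb n0 n1; clear E0 E1.
move: (hside t 0 1) (hside 1 0 1) (vside 1 t 1) (vside 0 t 1) r0 r1 => h h1 v1 v0 r0 r1 nh nr0 nr1 E.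
have -> : r0 + v0 + h1 - (r1 + v1) = (r0 - r1 + h).
  by rewrite -[RHS](subr0 _) -E; ring.
apply: (le_trans (le_normcD _ _)).
have -> : e = (e / 3 + e / 3) + e / 3 by field.
apply: lerD => //; apply: (le_trans (le_normcB _ _)); exact: lerD.
Qed.

Lemma square_away : a1 = 0 ->
  (forall u t, 0 <= u -> u <= 1 -> 0 <= t -> t <= 1 -> spt s (sqpt u t) <> None) ->
  vside 0 0 1 + hside 1 0 1 = vside 1 0 1.
Proof.
move=> a10 noo.
have := @rect_zero _ _ _ s l0 l1 adm A B a0 a1 b0 b1 Q c hc inS 0 (lexx _) ltr01 noo.
have h0 : hside 0 0 1 = 0.
  have [cQ _] := hc (lexx 0) ler01.
  rewrite /hor_int /line_int (_ : sline s _ Q (c 0) = fun=> spt s a0); first exact: cint_cst_path.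
  apply/funext => u; rewrite /sline /line mulrC -scalerA -cQ a10.
  by rewrite subr0 !scale1r !scale0r !addr0 scaler0 addr0.
rewrite /rect h0; move: (hside 1 0 1) (vside 1 0 1) (vside 0 0 1) => h1 v1 v0 E.
by rewrite -[LHS](addr0 _) -E; ring.
Qed.

End Square.
End StokesTriangle.

(** * Stokes on triangles *)

Section Triangle.
Context {R : realType}.
Local Notation C := R[i].
Local Notation PC := {poly {poly C}}.
Variables (n : nat) (l : C) (s : @sing R n).
Hypotheses (l0 : l != 0) (l1 : l != 1) (adm : admissible l s).
Local Notation V := ('rV[R]_n.+1).
Variables (A B : PC).

Definition vtx (i : 'I_n.+1) : V := delta_mx 0 i.

Definition edge_int (i j : 'I_n.+1) : C := line_int s A B (vtx i) (vtx j - vtx i) 1 0 1.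

Lemma vtxE (i j : 'I_n.+1) : vtx i 0 j = (i == j)%:R.
Proof. by rewrite mxE eqxx eq_sym. Qed.

Lemma vtx_in_splx i : in_splx (vtx i).
Proof.
apply/in_splxP; split=> [j|]; first by rewrite vtxE ler0n.
rewrite (bigD1 i) //= vtxE eqxx big1 ?addr0 // => j /negPf ji.
by rewrite vtxE eq_sym ji.
Qed.

Lemma edge_in_splx i j (u : R) : 0 <= u -> u <= 1 -> in_splx (vtx i + u *: (vtx j - vtx i)).
Proof.
move=> u0 u1; have -> : vtx i + u *: (vtx j - vtx i) = (1 - u) *: vtx i + u *: vtx j.
  by rewrite scalerBr scalerBl scale1r addrA addrAC.
by apply: in_splx_convex; rewrite ?u0 ?vtx_in_splx.
Qed.

Lemma edgeE i j (u : R) k :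
  (vtx i + u *: (vtx j - vtx i)) 0 k = (1 - u) * (i == k)%:R + u * (j == k)%:R.
Proof. by rewrite !mxE !eqxx /= ![k == _]eq_sym; ring. Qed.

Variable F : {set 'I_n.+1}.
Hypothesis FP : forall v : splx n, s v = None <-> (forall i, i \notin F -> val v 0 i = 0).

Lemma spt_None (w : V) : in_splx w ->
  (spt s w = None <-> (forall i, i \notin F -> w 0 i = 0)).
Proof. by move=> wS; have := FP (Sub w wS); rewrite -spt_val SubK. Qed.

Lemma near01 (u : R) : 0 < u -> u < 1 -> \forall v \near u, 0 < v /\ v < 1.
Proof.
move=> u0 u1; have : u \in `]0, 1[%R by rewrite in_itv /= u0.
by move/near_in_itvoo; apply: filterS => v; rewrite in_itv /= => /andP[].
Qed.

Lemma edge_integrand_oo A' B' i j (u : R) : i \in F -> j \in F -> 0 < u -> u < 1 ->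
  integrand A' B' (sline s (vtx i) (vtx j - vtx i) 1) u = 0.
Proof.
move=> iF jF u0 u1; set sg := sline _ _ _ _.
have N (v : R) : 0 < v -> v < 1 -> sg v = None.
  move=> v0 v1; rewrite /sg /sline /line mul1r.
  apply/spt_None; first by apply: edge_in_splx; exact: ltW.
  move=> k kF; rewrite edgeE.
  rewrite (_ : (i == k) = false); last by apply: contraNF kF => /eqP <-.
  rewrite (_ : (j == k) = false); last by apply: contraNF kF => /eqP <-.
  by rewrite !mulr0 addr0.
have Nu : \forall w \near u, sg w = None.
  by apply: filterS (near01 u0 u1) => w [w0 w1]; exact: N.
rewrite /integrand.
have -> : cderive (px sg) u = 0.
  by apply: cder_derive; apply: cder_near (cder_cst 0 u); apply: filterS Nu => w E; rewrite /px E.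
have -> : cderive (py sg) u = 0.
  by apply: cder_derive; apply: cder_near (cder_cst 0 u); apply: filterS Nu => w E; rewrite /py E.
by rewrite !mulr0 addr0 mulr0.
Qed.

Lemma edge_int_oo i j : i \in F -> j \in F -> edge_int i j = 0.
Proof.
move=> iF jF; apply: (@cint_eq0 _ _ [::]) => // u u0 u1 _.
by apply: filterS (near01 u0 u1) => v [v0 v1]; exact: edge_integrand_oo.
Qed.

Lemma edge_pwcc A' B' i j : i != j -> ~~ ((i \in F) && (j \in F)) ->
  exists (bad : seq R) M, pwcc (integrand A' B' (sline s (vtx i) (vtx j - vtx i) 1)) bad M 0 1 /\
    forall u, 0 < u -> u < 1 -> u \notin bad -> path_C1 (sline s (vtx i) (vtx j - vtx i) 1) u.
Proof.
move=> ij nF; have n1 : `|1 : R| <= 1 by rewrite normr1.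
have [||bad [M [P G]]] := @adm_pwcc _ _ _ s adm A' B' (vtx i) (vtx j - vtx i) 1 0 1 n1 ltr01.
- by move=> u u0 u1; rewrite /line mul1r; exact: edge_in_splx.
- move=> u u0 u1; rewrite /line mul1r => /(spt_None (edge_in_splx i j (ltW u0) (ltW u1))) H.
  move: nF; rewrite negb_and => /orP[/H|/H]; rewrite edgeE eqxx.
    rewrite [j == i]eq_sym (negPf ij) mulr1 mulr0 addr0 => /eqP.
    by rewrite subr_eq0 => /eqP E; rewrite -E ltxx in u1.
  by rewrite (negPf ij) mulr1 mulr0 add0r => E; rewrite E ltxx in u0.
by exists bad, M.
Qed.

Lemma edge_pwcc_all A' B' i j : i != j -> exists (bad : seq R) M,
  pwcc (integrand A' B' (sline s (vtx i) (vtx j - vtx i) 1)) bad M 0 1.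
Proof.
move=> ij; have [/andP[iF jF]|nF] := boolP ((i \in F) && (j \in F)); last first.
  by have [bad [M [P _]]] := edge_pwcc A' B' ij nF; exists bad, M.
exists [::], 0 => u u0 u1 _; rewrite edge_integrand_oo // normc0; split; last exact: lexx.
apply: ccont_near (ccont_cst 0 u); apply: filterS (near01 u0 u1) => v [v0 v1].
by rewrite edge_integrand_oo.
Qed.

Lemma sline_rev i j (u : R) :
  sline s (vtx j) (vtx i - vtx j) 1 u = sline s (vtx i) (vtx j - vtx i) 1 (1 - u).
Proof.
rewrite /sline /line !mul1r; congr spt.
rewrite scalerBl scale1r -[vtx i - vtx j]opprB scalerN addrA.
by rewrite addrCA subrr addr0.
Qed.

Lemma edge_int_rev i j : i != j -> edge_int j i = - edge_int i j.
Proof.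
move=> ij; have [/andP[iF jF]|nF] := boolP ((i \in F) && (j \in F)).
  by rewrite !edge_int_oo // oppr0.
have [bad [M [P G]]] := edge_pwcc A B ij nF.
have ji : j != i by rewrite eq_sym.
have nF' : ~~ ((j \in F) && (i \in F)) by rewrite andbC.
have [bad' [M' [P' G']]] := edge_pwcc A B ji nF'.
rewrite /edge_int /line_int -(cint_rev P).
pose B'' := map (fun x : R => 1 - x) bad.
have Pr : pwcc (fun u => - integrand A B (sline s (vtx i) (vtx j - vtx i) 1) (1 - u)) B'' M 0 1.
  move=> u u0 u1 uB; have [|||c1 m1] := P (1 - u).
  - by rewrite subr_gt0.
  - by rewrite ltrBlDr ltrDl.
  - by apply: contra uB => uB; apply/mapP; exists (1 - u); rewrite // opprB addrC subrK.
  split; last by rewrite normcN.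
  apply: ccontN; apply: (ccont_comp (f := fun v : R => 1 - v)) => //.
  by apply: cvgB; [exact: cvg_cst|exact: cvg_id].
apply: (pwcc_ext ler01 P' Pr) => u u0 u1 uB uB'.
have g : path_C1 (sline s (vtx i) (vtx j - vtx i) 1) (1 - u).
  apply: G; [by rewrite subr_gt0|by rewrite ltrBlDr ltrDl|].
  by apply: contra uB' => uB'; apply/mapP; exists (1 - u); rewrite // opprB addrC subrK.
have [dx dy] := path_C1_cder g.
have d : is_derive u 1 (fun v : R => 1 - v) (-1 : R).
  by rewrite -[X in is_derive _ _ _ X]sub0r; exact: is_deriveB.
have rev_der (f : R -> C) x : cder f (1 - u) x -> cder (fun v => f (1 - v)) u (- x).
  move=> [f1 f2]; split; rewrite ?reN ?imN -mulrN1.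
    exact: (is_derive1_comp (f := fun x => re (f x))).
  exact: (is_derive1_comp (f := fun x => im (f x))).
rewrite /integrand.
have Ex : px (sline s (vtx j) (vtx i - vtx j) 1) =
    fun v => px (sline s (vtx i) (vtx j - vtx i) 1) (1 - v).
  by apply/funext => v; rewrite /px sline_rev.
have Ey : py (sline s (vtx j) (vtx i - vtx j) 1) =
    fun v => py (sline s (vtx i) (vtx j - vtx i) 1) (1 - v).
  by apply/funext => v; rewrite /py sline_rev.
rewrite Ex Ey (cder_derive (rev_der _ _ dx)) (cder_derive (rev_der _ _ dy)).
by rewrite !mulrN -opprD mulrN.
Qed.

Section Labelled.
Variables (i j k : 'I_n.+1).
Hypotheses (ij : i != j) (ik : i != k) (jk : j != k).

Local Notation sqV := (pt (vtx i) 0 (vtx j) (vtx k - vtx j)).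

Lemma vertex_ptE u t h : sqV u t 0 h =
  (1 - t) * (i == h)%:R + t * ((1 - u) * (j == h)%:R + u * (k == h)%:R).
Proof. by rewrite !mxE !eqxx /= ![h == _]eq_sym; ring. Qed.

(** The triangle is swept by the segments from the vertex i to the opposite side:
    the square has the constant i as its bottom side. If i is at oo, all the other
    points of the square are in U. *)
Lemma triangle_vertex : j \notin F -> k \notin F ->
  edge_int i j + edge_int j k = edge_int i k.
Proof.
move=> jF kF.
have inS u t : 0 <= u -> u <= 1 -> 0 <= t -> t <= 1 -> in_splx (sqV u t).
  move=> u0 u1 t0 t1; rewrite /pt scaler0 addr0; apply: in_splx_convex; first by rewrite t0.
    exact: vtx_in_splx.
  exact: edge_in_splx.
have hc (t : R) : 0 <= t -> t <= 1 ->
    (1 - t) *: (0 : V) + t *: (vtx k - vtx j) = t *: (vtx k - vtx j) /\ `|t| <= 1.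
  by move=> t0 t1; rewrite scaler0 add0r ger0_norm.
have noo u t : 0 <= u -> u <= 1 -> 0 < t -> t <= 1 -> spt s (sqV u t) <> None.
  move=> u0 u1 t0 t1 /(spt_None (inS u t u0 u1 (ltW t0) t1)) H.
  have := H j jF; have := H k kF; rewrite !vertex_ptE !eqxx (negPf ij) (negPf ik) (negPf jk).
  rewrite [k == j]eq_sym (negPf jk) !mulr0 !mulr1 !add0r addr0 => /eqP.
  rewrite mulf_eq0 gt_eqF //= => /eqP ->.
  by rewrite subr0 mulr1 => E; rewrite E ltxx in t0.
have : ver_int s A B (vtx i) 0 (vtx j) (vtx k - vtx j) 0 0 1 +
    hor_int s A B (vtx i) (vtx j) (vtx k - vtx j) id 1 0 1 =
    ver_int s A B (vtx i) 0 (vtx j) (vtx k - vtx j) 1 0 1.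
  have [iF|iF] := boolP (i \in F).
    apply: (square_oo l0 l1 adm A B hc inS noo) => u u0 u1.
    apply/(spt_None (inS u 0 u0 u1 (lexx _) ler01)) => h hF; rewrite vertex_ptE mul0r addr0.
    by rewrite (_ : (i == h) = false) ?mulr0 //; apply: contraNF hF => /eqP <-.
  apply: (square_away l0 l1 adm A B hc inS) => // u t u0 u1 t0 t1.
  move: t0; rewrite le_eqVlt => /orP[/eqP <-|t0]; last exact: noo.
  move/(spt_None (inS u 0 u0 u1 (lexx _) ler01))/(_ i iF).
  by rewrite vertex_ptE eqxx mul0r addr0 subr0 mulr1 => /eqP; rewrite oner_eq0.
rewrite /ver_int /hor_int /ver_dir !scaler0 !addr0 !scale0r !addr0 subrr scale0r add0r !scale1r.
by have -> : vtx j + (vtx k - vtx j) = vtx k by rewrite addrC subrK.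
Qed.

Local Notation sqE := (pt (vtx i) (vtx j - vtx i) (vtx k) 0).

Lemma edge_ptE u t h : sqE u t 0 h =
  (1 - t) * ((1 - u) * (i == h)%:R + u * (j == h)%:R) + t * (k == h)%:R.
Proof. by rewrite !mxE !eqxx /= ![h == _]eq_sym; ring. Qed.

(** The triangle is swept by the segments from its side at oo to the opposite
    vertex; that side contributes 0. *)
Lemma triangle_edge : i \in F -> j \in F -> k \notin F ->
  edge_int i k = edge_int j k.
Proof.
move=> iF jF kF.
have inS u t : 0 <= u -> u <= 1 -> 0 <= t -> t <= 1 -> in_splx (sqE u t).
  move=> u0 u1 t0 t1; rewrite /pt scaler0 addr0; apply: in_splx_convex; first by rewrite t0.
    exact: edge_in_splx.
  exact: vtx_in_splx.
have hc (t : R) : 0 <= t -> t <= 1 ->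
    (1 - t) *: (vtx j - vtx i) + t *: (0 : V) = (1 - t) *: (vtx j - vtx i) /\ `|1 - t| <= 1.
  by move=> t0 t1; rewrite scaler0 addr0 ger0_norm ?subr_ge0 // lerBlDr lerDl.
have noo u t : 0 <= u -> u <= 1 -> 0 < t -> t <= 1 -> spt s (sqE u t) <> None.
  move=> u0 u1 t0 t1 /(spt_None (inS u t u0 u1 (ltW t0) t1)) /(_ k kF).
  rewrite edge_ptE eqxx (negPf ik) (negPf jk) !mulr0 !addr0 mulr0 add0r mulr1 => E.
  by rewrite E ltxx in t0.
have oo u : 0 <= u -> u <= 1 -> spt s (sqE u 0) = None.
  move=> u0 u1; apply/(spt_None (inS u 0 u0 u1 (lexx _) ler01)) => h hF.
  rewrite edge_ptE mul0r addr0.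
  rewrite (_ : (i == h) = false); last by apply: contraNF hF => /eqP <-.
  rewrite (_ : (j == h) = false); last by apply: contraNF hF => /eqP <-.
  by rewrite !mulr0 addr0 mulr0.
have := square_oo l0 l1 adm A B hc inS noo oo.
have -> : hor_int s A B (vtx i) (vtx k) (vtx j - vtx i) (fun t => 1 - t) 1 0 1 = 0.
  rewrite /hor_int /line_int subrr (_ : sline s _ _ 0 = fun=> spt s (vtx k)); first exact: cint_cst_path.
  by apply/funext => u; rewrite /sline /line mul0r !scale0r add0r addr0 scale1r.
rewrite addr0 /ver_int /ver_dir !scaler0 !addr0 !scale0r !addr0 !scale1r.
by have -> : vtx i + (vtx j - vtx i) = vtx j by rewrite addrC subrK.
Qed.

End Labelled.
End Triangle.

Section StokesSimplex.
Context {R : realType}.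
Local Notation C := R[i].
Local Notation PC := {poly {poly C}}.
Variables (l : C) (s : @sing R 2).
Hypotheses (l0 : l != 0) (l1 : l != 1) (adm : admissible l s).
Variables (A B : PC).
Let o0 : 'I_3 := @Ordinal 3 0 isT.
Let o1 : 'I_3 := @Ordinal 3 1 isT.
Let o2 : 'I_3 := @Ordinal 3 2 isT.

(** The part at oo is a face: empty, a vertex or a side. The sweeping is chosen
    so that it is the bottom of the square. *)
Theorem stokes_triangle : edge_int s A B o0 o1 + edge_int s A B o1 o2 = edge_int s A B o0 o2.
Proof.
have [_ _ [F FP] nc _] := adm.
have rev i j := @edge_int_rev _ _ _ _ adm A B F FP i j.
have oo i j := @edge_int_oo _ _ s A B F FP i j.
have ve i j k := @triangle_vertex _ _ _ _ l0 l1 adm A B F FP i j k.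
have ed i j k := @triangle_edge _ _ _ _ l0 l1 adm A B F FP i j k.
move: (edge_int s A B) rev oo ve ed => E rev oo ve ed.
have [f0|f0] := boolP (o0 \in F); have [f1|f1] := boolP (o1 \in F);
  have [f2|f2] := boolP (o2 \in F).
- case: nc => v; apply/FP => i; move: f0 f1 f2; case: i => -[|[|[|//]]] hi f0 f1 f2.
  + by rewrite (_ : Ordinal hi = o0) ?f0 //; exact: val_inj.
  + by rewrite (_ : Ordinal hi = o1) ?f1 //; exact: val_inj.
  + by rewrite (_ : Ordinal hi = o2) ?f2 //; exact: val_inj.
- by rewrite (oo o0 o1) // add0r (ed o0 o1 o2).
- by rewrite (oo o0 o2) // (ed o0 o2 o1) // (rev o1 o2) // addNr.
- exact: ve.
- rewrite (oo o1 o2) // addr0; apply: oppr_inj.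
  by rewrite -(rev o0 o1) // -(rev o0 o2) //; exact: ed.
- have := ve o1 o0 o2 isT isT isT f0 f2; rewrite (rev o0 o1) // => <-.
  by rewrite addNKr.
- have := ve o2 o0 o1 isT isT isT f0 f1; rewrite (rev o0 o2) // (rev o1 o2) // => H.
  by rewrite -[E o1 o2]opprK -H; ring.
- exact: ve.
Qed.

End StokesSimplex.

(** * Periods and boundaries *)

Section Freeg.
Variables (A : comNzRingType) (K : choiceType) (M : lmodType A) (f : K -> M).

Lemma fgliftB (D E : {freeg K / A}) : fglift f (D - E) = fglift f D - fglift f E.
Proof. exact: lift_is_additive. Qed.

Lemma fglift0 : fglift f 0 = 0.
Proof. by rewrite -(subrr 0) fgliftB subrr. Qed.

Lemma fgliftD (D E : {freeg K / A}) : fglift f (D + E) = fglift f D + fglift f E.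
Proof. by rewrite -{1}[E]opprK fgliftB -[- E]sub0r fgliftB fglift0 sub0r opprK. Qed.

Lemma fglift_sum (I : Type) (r : seq I) (P : pred I) (D : I -> {freeg K / A}) :
  fglift f (\sum_(i <- r | P i) D i) = \sum_(i <- r | P i) fglift f (D i).
Proof. exact: (big_morph _ fgliftD fglift0). Qed.

Lemma fglift_dom (D : {freeg K / A}) :
  fglift f D = \sum_(x <- dom D) coeff x D *: f x.
Proof.
by rewrite -{1}(freeg_sumE D) fglift_sum; apply: eq_bigr => x _; rewrite liftU.
Qed.

Lemma fgliftZ c (D : {freeg K / A}) : fglift f (c *: D) = c *: fglift f D.
Proof.
rewrite [c *: D]/(fgscale c D) /fgscale fglift_sum fglift_dom scaler_sumr.
by apply: eq_bigr => x _; rewrite liftU scalerA.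
Qed.

End Freeg.

Lemma eq_fglift (A : comNzRingType) (K : choiceType) (M : lmodType A) (f g : K -> M)
    (D : {freeg K / A}) :
  (forall x, x \in dom D -> f x = g x) -> fglift f D = fglift g D.
Proof.
move=> E; rewrite !fglift_dom !big_seq.
by apply: eq_bigr => x xD; rewrite E.
Qed.

Lemma fglift_eq0 (A : comNzRingType) (K : choiceType) (M : lmodType A) (f : K -> M)
    (D : {freeg K / A}) : (forall x, x \in dom D -> f x = 0) -> fglift f D = 0.
Proof.
move=> E; rewrite fglift_dom big_seq big1 // => x xD.
by rewrite E // scaler0.
Qed.

Lemma fglift_comp (A : comNzRingType) (K L : choiceType) (M : lmodType A)
    (f : K -> {freeg L / A}) (g : L -> M) (D : {freeg K / A}) :
  fglift g (fglift f D) = fglift (fun x => fglift g (f x)) D.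
Proof.
rewrite (fglift_dom f) fglift_sum [RHS]fglift_dom; apply: eq_bigr => x _.
by rewrite fgliftZ.
Qed.

Section Periods.
Context {R : realType} {k : fieldType} (iota : {rmorphism k -> R[i]}).
Local Notation C := R[i].
Local Notation PC := {poly {poly C}}.
Local Notation PK := {poly {poly k}}.
Local Notation mapG := (map_poly (map_poly iota)).
Variable (l : C).
Hypotheses (l0 : l != 0) (l1 : l != 1).

Let z0 : 'I_2 := @Ordinal 2 0 isT.
Let z1 : 'I_2 := @Ordinal 2 1 isT.

Lemma path_pt_sline (sg : @sing R 1) :
  path_pt sg = sline sg (vtx z0) (vtx z1 - vtx z0) 1.
Proof.
apply/funext => u; rewrite /path_pt /sline /spt; congr (obind _ (insub _)).
apply/rowP => j; rewrite mxE /line mul1r edgeE.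
by case: j => -[|[|//]] hj /=; rewrite !mulr1n ?mulr1 ?mulr0 ?addr0 ?add0r.
Qed.

Lemma admissible_F n (s : @sing R n) : admissible l s -> exists2 F : {set 'I_n.+1},
  (forall v : splx n, s v = None <-> (forall i, i \notin F -> val v 0 i = 0)) &
  exists i, i \notin F.
Proof.
move=> [_ _ [F FP] nc _]; exists F => //.
apply: contrapT => H; apply: nc => v; apply/FP => i iF.
by exfalso; apply: H; exists i.
Qed.

Lemma path_pwcc (sg : @sing R 1) A B : admissible l sg -> exists (bad : seq R) M,
  pwcc (integrand A B (path_pt sg)) bad M 0 1 /\
  forall u, 0 < u -> u < 1 -> u \notin bad -> path_C1 (path_pt sg) u.
Proof.
move=> adm; have [F FP [i iF]] := admissible_F adm.
rewrite path_pt_sline; apply: (edge_pwcc adm FP) => //.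
apply: contra iF => /andP[]; case: i => -[|[|//]] hi h0 h1.
  by rewrite (_ : Ordinal hi = z0) //; exact: val_inj.
by rewrite (_ : Ordinal hi = z1) //; exact: val_inj.
Qed.

Lemma path_integralE (om : Defs.form k) (sg : @sing R 1) : admissible l sg ->
  path_integral iota om sg = cint 0 1 (integrand (mapG om.1) (mapG om.2) (path_pt sg)).
Proof.
move=> adm; have [bad [M [P _]]] := path_pwcc (mapG om.1) (mapG om.2) adm.
exact: (cintegral_oo P).
Qed.

Lemma path_integral_edge (om : Defs.form k) (sg : @sing R 1) : admissible l sg ->
  path_integral iota om sg = edge_int sg (mapG om.1) (mapG om.2) z0 z1.
Proof. by move=> adm; rewrite /edge_int /line_int -path_pt_sline; exact: path_integralE. Qed.

Lemma mapG_dx (g : PK) : mapG (dx g) = pdx (mapG g).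
Proof. by rewrite /dx /pdx deriv_map. Qed.

Lemma mapG_dy (g : PK) : mapG (dy g) = pdy (mapG g).
Proof.
rewrite /dy /pdy; apply/polyP => i.
by rewrite !coef_map /= ?coef_map /= deriv_map.
Qed.

Lemma edge_pval (G : PC) (sg : @sing R 1) : admissible l sg ->
  edge_int sg (pdx G) (pdy G + G) z0 z1 =
    pval G (spt sg (vtx z1)) - pval G (spt sg (vtx z0)).
Proof.
move=> adm; have [bad [M]] := path_pwcc (pdx G) (pdy G + G) adm.
rewrite path_pt_sline => -[P gd].
rewrite /edge_int /line_int (@cint_FTC _ (fun u => pval G (sline sg (vtx z0) (vtx z1 - vtx z0) 1 u))
  _ _ _ _ _ ler01 P).
- rewrite /sline /line !mul1r scale0r addr0 scale1r.
  by rewrite [_ + (_ - _)]addrC subrK.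
- apply: ccont_itv_within; apply: (adm_pval_ccont_itv adm) => u u0 u1.
  by rewrite /line mul1r; exact: edge_in_splx.
- by move=> u u0 u1 uB; apply: path_C1_pval; exact: gd.
Qed.

Definition spt0 : @splx R 0 := Sub (vtx ord0) (vtx_in_splx ord0).

Lemma splx0 (v : @splx R 0) : v = spt0.
Proof.
apply: val_inj; apply/rowP => j; rewrite SubK vtxE (ord1 j) eqxx.
by have /in_splxP [_ <-] := valP v; rewrite big_ord_recl big_ord0 addr0.
Qed.

Lemma face_row_vtx n (i : 'I_n.+2) (j : 'I_n.+1) :
  face_row i (vtx j : 'rV[R]_n.+1) = vtx (fintype.lift i j).
Proof.
apply/rowP => h; rewrite mxE vtxE; case: unliftP => [h' ->|->].
  by rewrite vtxE (inj_eq lift_inj).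
by rewrite eq_sym (negPf (neq_lift _ _)).
Qed.

Lemma face_rowD n (i : 'I_n.+2) (v w : 'rV[R]_n.+1) c :
  face_row i (v + c *: w) = face_row i v + c *: face_row i w.
Proof.
apply/rowP => h; rewrite !mxE; case: unlift => [h'|]; first by rewrite !mxE.
by rewrite mulr0 addr0.
Qed.

Lemma face_in_splx n (i : 'I_n.+2) (w : 'rV[R]_n.+1) :
  in_splx (face_row i w) = in_splx w.
Proof.
apply/in_splxP/in_splxP => -[w0 w1]; split.
- by move=> j; have := w0 (fintype.lift i j); rewrite mxE liftK.
- rewrite -w1 (bigD1_ord i) //= mxE unlift_none add0r.
  by apply: eq_bigr => j _; rewrite mxE liftK.
- by move=> j; rewrite mxE; case: unlift.
- rewrite -w1 (bigD1_ord i) //= mxE unlift_none add0r.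
  by apply: eq_bigr => j _; rewrite mxE liftK.
Qed.

Lemma spt_face n (s : @sing R n.+1) (i : 'I_n.+2) (w : 'rV[R]_n.+1) :
  spt (s \o face_splx i) w = spt s (face_row i w).
Proof.
rewrite /spt; case: insubP => [v vS vw|wS] /=.
  rewrite insubT ?face_in_splx // => h /=; congr s.
  by apply: val_inj; rewrite SubK /= vw.
by case: insubP => //= v; rewrite face_in_splx (negPf wS).
Qed.

Definition val0 (G : PC) (s : @sing R 0) : C^o := pval G (s spt0).

Lemma const_oo0 (s : @sing R 0) : const_oo s <-> s spt0 = None.
Proof. by split=> [H|H v]; [exact: H|rewrite (splx0 v)]. Qed.

Lemma val0_face (G : PC) (sg : @sing R 1) i :
  fglift (val0 G) (if `[< const_oo (sg \o face_splx i) >] then 0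
     else << (-1) ^+ i *g (sg \o face_splx i : @sing R 0) >>) =
  (-1) ^+ i * pval G (spt sg (vtx (fintype.lift i ord0))).
Proof.
have E : (sg \o face_splx i) spt0 = spt sg (vtx (fintype.lift i ord0)).
  by rewrite -(spt_val (sg \o face_splx i)) spt_face SubK face_row_vtx.
case: asboolP => [/const_oo0|_]; last by rewrite liftU /val0 E.
by rewrite E fglift0 => ->; rewrite mulr0.
Qed.

(** On the horizontal section exp y the form nabla g is d (g exp y), and the ends at
    oo contribute nothing, as in the boundary. *)
Lemma period_nabla (g : PK) (c : chain C 1) : admissible_chain l c ->
  period iota c (nabla g) = fglift (val0 (mapG g)) (bd c).
Proof.
move=> adm; rewrite /period /bd fglift_comp; apply: eq_fglift => s sc.
rewrite fglift_sum big_ord_recl big_ord_recl big_ord0 addr0 !val0_face.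
rewrite (path_integral_edge _ (adm s sc)) /nabla /= rmorphD /= mapG_dx mapG_dy.
rewrite (edge_pval _ (adm s sc)) expr0 mul1r expr1 mulN1r.
by congr (pval _ (spt s (vtx _)) - pval _ (spt s (vtx _))); apply: val_inj.
Qed.

Lemma path_integral_cst (om : Defs.form k) (sg : @sing R 1) q :
  path_pt sg = (fun=> q) -> path_integral iota om sg = 0.
Proof.
move=> E; rewrite /path_integral.
have D c s : cderive (fun=> c : C) s = 0 :> C by rewrite /cderive !derive1_cst.
rewrite (_ : (fun _ : R => _) = fun=> 0).
  rewrite /cintegral /= Rintegral_cst ?mul0r //; exact: measurable_itv.
apply/funext => s.
have -> : path_x sg = fun=> path_x sg s by apply/funext => u; rewrite /path_x E.
have -> : path_y sg = fun=> path_y sg s by apply/funext => u; rewrite /path_y E.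
by rewrite !D !mulr0 addr0 mulr0.
Qed.

Lemma sum_faces (om : Defs.form k) (s : @sing R 2) : admissible l s ->
  fglift (path_integral iota om : @sing R 1 -> C^o) (\sum_(i < 3)
    (if `[< const_oo (s \o face_splx i) >] then 0
     else << (-1) ^+ i *g (s \o face_splx i : @sing R 1) >>)) = 0.
Proof.
move=> adm; have [F FP _] := admissible_F adm.
pose A := mapG om.1; pose B := mapG om.2.
have face_E (i : 'I_3) (a b : 'I_3) : fintype.lift i z0 = a -> fintype.lift i z1 = b -> a != b ->
    path_integral iota om (s \o face_splx i) = edge_int s A B a b.
  move=> ia ib ab.
  have E : path_pt (s \o face_splx i) = sline s (vtx a) (vtx b - vtx a) 1.
    rewrite path_pt_sline; apply/funext => u; rewrite /sline spt_face /line !mul1r.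
    rewrite -scaleN1r face_rowD face_rowD !face_row_vtx ia ib.
    by rewrite scaleN1r.
  have [bad [M P]] := edge_pwcc_all adm FP A B ab.
  rewrite -E in P; rewrite /edge_int /line_int -E.
  exact: (cintegral_oo P).
have term (i : 'I_3) : fglift (path_integral iota om : @sing R 1 -> C^o)
    (if `[< const_oo (s \o face_splx i) >] then 0
     else << (-1) ^+ i *g (s \o face_splx i : @sing R 1) >>) =
    (-1) ^+ i * path_integral iota om (s \o face_splx i).
  case: asboolP => [co|_]; last by rewrite liftU.
  rewrite fglift0 (@path_integral_cst om _ None) ?mulr0 //.
  by apply/funext => u; rewrite /path_pt; case: insub => //= v; exact: co.
pose o0 : 'I_3 := @Ordinal 3 0 isT; pose o1 : 'I_3 := @Ordinal 3 1 isT.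
pose o2 : 'I_3 := @Ordinal 3 2 isT.
have e00 : fintype.lift o0 z0 = o1 by exact: val_inj.
have e01 : fintype.lift o0 z1 = o2 by exact: val_inj.
have e10 : fintype.lift o1 z0 = o0 by exact: val_inj.
have e11 : fintype.lift o1 z1 = o2 by exact: val_inj.
have e20 : fintype.lift o2 z0 = o0 by exact: val_inj.
have e21 : fintype.lift o2 z1 = o1 by exact: val_inj.
pose p i := path_integral iota om (s \o face_splx i).
have p0 : p o0 = edge_int s A B o1 o2 := face_E _ _ _ e00 e01 isT.
have p1 : p o1 = edge_int s A B o0 o2 := face_E _ _ _ e10 e11 isT.
have p2 : p o2 = edge_int s A B o0 o1 := face_E _ _ _ e20 e21 isT.
have := stokes_triangle l0 l1 adm A B; rewrite -/o0 -/o1 -/o2 -p0 -p1 -p2 => H.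
rewrite fglift_sum.
apply: etrans (eq_bigr (fun i : 'I_3 => (-1) ^+ i * p i) (fun i _ => term i)) _.
move: H {p0 p1 p2 term face_E}; move: p => p H.
have S3 (f : 'I_3 -> C) : \sum_i f i = f o0 + f o1 + f o2.
  rewrite !big_ord_recl big_ord0 addr0 addrA.
  by congr (f _ + f _ + f _); exact: val_inj.
rewrite S3 -H /=; ring.
Qed.

(** A period depends only on the class of a cycle. *)
Lemma period_bd (om : Defs.form k) (b : chain C 2) : admissible_chain l b ->
  period iota (bd b) om = 0.
Proof.
move=> adm; rewrite /period /bd fglift_comp; apply: fglift_eq0 => s sb.
by apply: sum_faces; exact: adm.
Qed.

End Periods.

(** * Periods of relative cycles *)

Section Isolated.
Context {R : realType}.
Local Notation C := R[i].

Lemma isolated (xs : seq C) (c : C) :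
  exists2 e, 0 < e & forall a, a \in xs -> normc (a - c) < e -> a = c.
Proof.
elim: xs => [|x xs [e e0 IH]]; first by exists 1.
have [->|xc] := eqVneq x c.
  by exists e => // a; rewrite inE => /orP[/eqP //|]; exact: IH.
exists (Num.min e (normc (x - c))); first by rewrite lt_min e0 normc_gt0 subr_eq0.
move=> a; rewrite inE => /orP[/eqP ->|ax]; rewrite lt_min => /andP[]; last by move=> + _; exact: IH.
by rewrite ltxx.
Qed.

Lemma ccont_finite_valued (T : topologicalType) (f : T -> C) (xs : seq C) t :
  ccont f t -> (\forall w \near t, f w \in xs) -> \forall w \near t, f w = f t.
Proof.
move=> /ccontP cf fx; have [e e0 H] := isolated xs (f t).
by apply: filterS2 (cf e e0) fx => w /[swap]; exact: H.
Qed.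

End Isolated.

Section PeriodRelations.
Context {R : realType} {k : fieldType} (iota : {rmorphism k -> R[i]}) (lam : k).
Local Notation C := R[i].
Local Notation PC := {poly {poly C}}.
Local Notation PK := {poly {poly k}}.
Local Notation mapG := (map_poly (map_poly iota)).
Let l : C := iota lam.
Hypotheses (l0 : l != 0) (l1 : l != 1).

Lemma cint_zero (h : R -> C) B M : pwcc h B M 0 1 ->
  (forall u, 0 < u -> u < 1 -> u \notin B -> h u = 0) -> cint 0 1 h = 0.
Proof.
move=> H h0; rewrite (@cint_FTC _ (fun=> 0) _ _ _ _ _ ler01 H) ?subrr //.
  by move=> u; exact: ccont_cst.
by move=> u u0 u1 ub; rewrite h0 //; exact: cder_cst.
Qed.

Lemma map_curve_eq (p : C * C) : (mapG (curve_eq lam)).[p.1, p.2] = p.2 ^+ 2 - (cubic l).[p.1].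
Proof.
have -> : mapG (curve_eq lam) = 'Y ^+ 2 - (cubic l) ^:P.
  rewrite /curve_eq rmorphB rmorphXn /= map_polyC /= map_polyX; congr (_ - _).
  apply/polyP => i; rewrite !coef_map /= map_polyC /=; congr (_%:P).
  have -> : cubic l = map_poly iota (cubic lam).
    by rewrite /cubic !rmorphM !rmorphB /= map_polyX rmorph1 map_polyC.
  by rewrite coef_map.
by rewrite hornerD hornerN horner_map /= -rmorphXn /= !hornerC hornerD hornerN hornerXn hornerC.
Qed.

Lemma path_curve (sg : @sing R 1) : admissible l sg ->
  forall u p, path_pt sg u = Some p -> curve l p.
Proof.
move=> [cv _ _ _ _] u p; rewrite /path_pt; case: insubP => //= v _ _; exact: cv.
Qed.

Lemma path_integral_form_rel (om : Defs.form k) (sg : @sing R 1) :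
  admissible l sg -> form_rel lam om -> path_integral iota om sg = 0.
Proof.
move=> adm [c [e1 [e2 omE]]].
have [bad [M [P gd]]] := path_pwcc (mapG om.1) (mapG om.2) adm.
rewrite (path_integralE _ _ adm); apply: (cint_zero P) => u u0 u1 ub.
rewrite omE /= !rmorphD !rmorphM /= mapG_dx mapG_dy.
have g := gd _ u0 u1 ub; apply: path_C1_integrand0 => //.
apply: filterS (path_C1_some g) => v E; apply: etrans (map_curve_eq (_, _)) _ => /=.
by have := path_curve adm E; rewrite /curve /= => ->; rewrite subrr.
Qed.

(** A path in a finite set is locally constant where it is continuous. *)
Lemma path_integral_finite (S : seq (C * C)) (om : Defs.form k) (sg : @sing R 1) :
  admissible l sg -> (forall v, exists2 p, p \in S & sg v = Some p) ->
  path_integral iota om sg = 0.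
Proof.
move=> adm inS.
have [bad [M [P gd]]] := path_pwcc (mapG om.1) (mapG om.2) adm.
rewrite (path_integralE _ _ adm); apply: (cint_zero P) => u u0 u1 ub.
have g := gd _ u0 u1 ub; have [dx dy] := path_C1_cder g.
have N : \forall v \near u, (px (path_pt sg) v, py (path_pt sg) v) \in S.
  apply: filterS (path_C1_some g) => v E.
  have [p pS pE] : exists2 p, p \in S & path_pt sg v = Some p.
    move: E; rewrite /path_pt; case: insubP => //= w _ _ _; exact: inS.
  by move: E; rewrite pE => -[<-].
have X0 : cderive (px (path_pt sg)) u = 0.
  apply: cder_derive; apply: cder_near (cder_cst (px (path_pt sg) u) u).
  have := @ccont_finite_valued _ _ _ (map fst S) _ (cder_cont dx).
  move=> H; apply: filterS (H _) => [v -> //|].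
  by apply: filterS N => v /(map_f fst).
have Y0 : cderive (py (path_pt sg)) u = 0.
  apply: cder_derive; apply: cder_near (cder_cst (py (path_pt sg) u) u).
  have := @ccont_finite_valued _ _ _ (map snd S) _ (cder_cont dy).
  move=> H; apply: filterS (H _) => [v -> //|].
  by apply: filterS N => v /(map_f snd).
by rewrite /integrand X0 Y0 !mulr0 addr0 mulr0.
Qed.

Lemma period_form_rel (om : Defs.form k) (c : chain C 1) :
  admissible_chain l c -> form_rel lam om -> period iota c om = 0.
Proof.
by move=> adm H; apply: fglift_eq0 => s sc; apply: path_integral_form_rel => //; exact: adm.
Qed.

Lemma path_integral_lin (a : k) (om om' : Defs.form k) (sg : @sing R 1) :
  admissible l sg -> path_integral iota (a%:P%:P *: om + om') sg =
  iota a * path_integral iota om sg + path_integral iota om' sg.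
Proof.
move=> adm; rewrite !(path_integralE _ _ adm).
have [bad [M [P _]]] := path_pwcc (mapG om.1) (mapG om.2) adm.
have [bad' [M' [P' _]]] := path_pwcc (mapG om'.1) (mapG om'.2) adm.
have s1 : {subset bad <= bad ++ bad'} by move=> u; rewrite mem_cat => ->.
have s2 : {subset bad' <= bad ++ bad'} by move=> u; rewrite mem_cat orbC => ->.
have Q := pwccW (lexx _) (lexx _) (lexx _) s1 P.
have Q' := pwccW (lexx _) (lexx _) (lexx _) s2 P'.
rewrite -(cintZ (iota a) Q) -(cintD (pwccZ (iota a) Q) Q').
congr cint; apply/funext => u; rewrite !rmorphD /= !rmorphM /= !map_polyC /= map_polyC /=.
rewrite integrandD; congr (_ + _).
by rewrite /integrand !hornerXYM !hornerC; ring.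
Qed.

Lemma period_lin (a : k) (om om' : Defs.form k) (c : chain C 1) :
  admissible_chain l c -> period iota c (a%:P%:P *: om + om') =
  iota a * period iota c om + period iota c om'.
Proof.
move=> adm; rewrite /period !fglift_dom mulr_sumr -big_split /= !big_seq.
apply: eq_bigr => s sc; rewrite path_integral_lin; last exact: adm.
by rewrite scalerDr; congr (_ + _); rewrite [LHS]mulrCA.
Qed.

Lemma period_om0 (c : chain C 1) : admissible_chain l c -> period iota c 0 = 0.
Proof.
move=> adm; have := period_lin 1 0 0 adm; rewrite scaler0 addr0 rmorph1 mul1r.
by move/eqP; rewrite -[X in X == _]addr0 (inj_eq (addrI _)) eq_sym => /eqP.
Qed.

Lemma period_sum n (a : 'I_n -> k) (om : 'I_n -> Defs.form k) (c : chain C 1) :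
  admissible_chain l c -> period iota c (\sum_i (a i)%:P%:P *: om i) =
  \sum_i iota (a i) * period iota c (om i).
Proof.
move=> adm; elim/big_rec2: _ => [|i x y _ IH]; first exact: period_om0.
by rewrite period_lin // IH.
Qed.

Lemma fglift_val0_supported (S : set (C * C)) (g : PK) (e : chain C 0) :
  vanishing iota S g -> supported S e -> fglift (val0 (mapG g)) e = 0.
Proof.
move=> gS eS; apply: fglift_eq0 => s /eS /(_ spt0) [p Sp sp].
by rewrite /val0 sp /pval -/(ev iota g p) gS // mul0r.
Qed.

Lemma period_trivial (S : set (C * C)) (om : Defs.form k) (c : chain C 1) :
  rel_cycle l S c -> dR_trivial iota lam S om -> period iota c om = 0.
Proof.
move=> [adm bdS] [g gS H].
have -> : om = 1%:P%:P *: (om - nabla g) + nabla g by rewrite !rmorph1 scale1r subrK.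
rewrite period_lin // (period_form_rel adm H) mulr0 add0r.
by rewrite (period_nabla _ _ adm) (fglift_val0_supported gS bdS).
Qed.

Lemma period_rel_boundary (S : set (C * C)) (xs : seq (C * C)) (om : Defs.form k)
    (c : chain C 1) : (forall p, S p -> p \in xs) -> rel_boundary l S c ->
  period iota c om = 0.
Proof.
move=> Sxs [b [e [admb adme eS ->]]].
rewrite /period fgliftD -!/(period _ _ _) (period_bd _ l0 l1) // add0r.
apply: fglift_eq0 => s se; apply: (@path_integral_finite xs); first exact: adme.
by move=> v; have [p /Sxs ? ?] := eS s se v; exists p.
Qed.

Lemma period_mod_boundary (S : set (C * C)) (xs : seq (C * C)) (om : Defs.form k) n
    (c : chain C 1) (a : 'I_n -> C) (d : 'I_n -> chain C 1) :
  (forall p, S p -> p \in xs) -> rel_boundary l S (c - \sum_i a i *: d i) ->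
  period iota c om = \sum_i a i * period iota (d i) om.
Proof.
move=> Sxs /(period_rel_boundary om Sxs)/eqP.
rewrite /period fgliftB subr_eq0 => /eqP ->; rewrite fglift_sum.
by apply: eq_bigr => i _; rewrite fgliftZ.
Qed.

Lemma period_mod_trivial (S : set (C * C)) (c : chain C 1) n (om : Defs.form k)
    (a : 'I_n -> k) (v : 'I_n -> Defs.form k) : rel_cycle l S c ->
  dR_trivial iota lam S (om - \sum_i (a i)%:P%:P *: v i) ->
  period iota c om = \sum_i iota (a i) * period iota c (v i).
Proof.
move=> cyc /(period_trivial cyc) H; have [adm _] := cyc.
have E : om = 1%:P%:P *: (om - \sum_i (a i)%:P%:P *: v i) + \sum_i (a i)%:P%:P *: v i.
  by rewrite !rmorph1 scale1r subrK.
by rewrite E period_lin // H mulr0 add0r period_sum.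
Qed.

End PeriodRelations.

(** * Smooth functions of a real variable *)

Section SmoothCurves.
Context {R : realType}.
Local Notation C := R[i].
Implicit Types f g h : R -> C.

(** Smooth complex functions on the whole real line. Paths are built from these,
    since the charts of a smooth simplex have to be defined and smooth everywhere. *)
Fixpoint csmoothn (r : nat) h : Prop :=
  if r is r'.+1 then exists2 h', (forall u, cder h u (h' u)) & csmoothn r' h'
  else forall u, ccont h u.

Definition csmooth h := forall r, csmoothn r h.

Lemma csmoothn_cont r h : csmoothn r h -> forall u, ccont h u.
Proof. by case: r => //= r [h' dh _] u; exact: cder_cont (dh u). Qed.

Lemma csmoothnS r h : csmoothn r.+1 h -> csmoothn r h.
Proof.
elim: r h => [|r IH] h; first exact: csmoothn_cont.
by move=> [h' dh /IH sh]; exists h'.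
Qed.

Lemma csmoothn_cst r (c : C) : csmoothn r (fun=> c).
Proof.
elim: r c => [|r IH] c /=; first by move=> u; exact: ccont_cst.
by exists (fun=> 0) => // u; exact: cder_cst.
Qed.

Lemma csmooth_cst (c : C) : csmooth (fun=> c).
Proof. by move=> r; exact: csmoothn_cst. Qed.

Lemma csmooth_id : csmooth (fun u => u%:C).
Proof.
case=> [|r] /=; first by move=> u; exact: cder_cont (cder_id u).
by exists (fun=> 1); [move=> u; exact: cder_id|exact: csmoothn_cst].
Qed.

Lemma csmoothnD r f g : csmoothn r f -> csmoothn r g -> csmoothn r (fun u => f u + g u).
Proof.
elim: r f g => [|r IH] f g /=; first by move=> cf cg u; exact: ccontD.
move=> [f' df sf] [g' dg sg]; exists (fun u => f' u + g' u); last exact: IH.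
by move=> u; exact: cderD.
Qed.

Lemma csmoothnM r f g : csmoothn r f -> csmoothn r g -> csmoothn r (fun u => f u * g u).
Proof.
elim: r f g => [|r IH] f g; first by move=> cf cg u; exact: ccontM.
move=> F G; case: (F) => f' df sf; case: (G) => g' dg sg.
exists (fun u => f' u * g u + f u * g' u); first by move=> u; exact: cderM.
by apply: csmoothnD; apply: IH => //; exact: csmoothnS.
Qed.

Lemma csmoothD f g : csmooth f -> csmooth g -> csmooth (fun u => f u + g u).
Proof. by move=> F G r; exact: csmoothnD. Qed.

Lemma csmoothM f g : csmooth f -> csmooth g -> csmooth (fun u => f u * g u).
Proof. by move=> F G r; exact: csmoothnM. Qed.

Lemma csmoothB f g : csmooth f -> csmooth g -> csmooth (fun u => f u - g u).
Proof.
move=> F G; have H := csmoothD F (csmoothM (csmooth_cst (-1)) G).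
by move: H; under eq_fun do rewrite mulN1r.
Qed.

Lemma csmoothX f n : csmooth f -> csmooth (fun u => f u ^+ n).
Proof.
move=> F; elim: n => [|n IH]; first exact: csmooth_cst.
by under eq_fun do rewrite exprS; exact: csmoothM.
Qed.

Lemma csmoothV f : (forall u, f u != 0) -> csmooth f -> csmooth (fun u => (f u)^-1).
Proof.
move=> f0 F; elim=> [|r IH] /=; first by move=> u; apply: ccontV => //; exact: (F 0%N).
have [f' df sf] := F r.+1; exists (fun u => - f' u / f u ^+ 2).
  by move=> u; exact: cderV.
have -> : (fun u => - f' u / f u ^+ 2) = (fun u => -1 * (f' u * ((f u)^-1 * (f u)^-1))).
  by apply/funext => u; rewrite mulN1r -mulNr -invfM -expr2.
by apply: csmoothnM; [exact: csmoothn_cst|do 2 apply: csmoothnM => //].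
Qed.

Lemma csmooth_exp f : csmooth f -> csmooth (fun u => cexp (f u)).
Proof.
move=> F; elim=> [|r IH] /=; first by move=> u; apply: ccont_exp; exact: (F 0%N).
have [f' df sf] := F r.+1; exists (fun u => f' u * cexp (f u)); last exact: csmoothnM.
by move=> u; exact: cder_exp.
Qed.

Lemma csmooth_poly (p : {poly C}) f : csmooth f -> csmooth (fun u => p.[f u]).
Proof.
move=> F; elim/poly_ind: p => [|p c IH].
  by under eq_fun do rewrite horner0; exact: csmooth_cst.
under eq_fun do rewrite hornerMXaddC.
by apply: csmoothD; [exact: csmoothM|exact: csmooth_cst].
Qed.

Lemma csmooth_der f : csmooth f -> exists2 f', (forall u, cder f u (f' u)) & csmooth f'.
Proof.
move=> F; have [f1 d1 _] := F 1%N; exists f1 => // r.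
have [f2 d2 s2] := F r.+1; suff -> : f1 = f2 by [].
by apply/funext => u; rewrite -(cder_derive (d1 u)) -(cder_derive (d2 u)).
Qed.

Lemma csmooth_prim f F : csmooth f -> (forall u, cder F u (f u)) -> csmooth F.
Proof.
move=> sf dF [|r] /=; first by move=> u; exact: cder_cont (dF u).
by exists f.
Qed.

Lemma ccont_bounded f a b : a <= b -> (forall u, ccont f u) ->
  exists M, forall u, a <= u <= b -> normc (f u) <= M.
Proof.
move=> ab cf; pose h u := re (f u) * re (f u) + im (f u) * im (f u).
have ch : continuous h.
  move=> u; have [c1 c2] := cf u.
  exact: continuousD (continuousM c1 c1) (continuousM c2 c2).
have [c _ H] := EVT_max ab (continuous_subspaceT ch).
exists (2 + h c) => u uab; apply: (le_trans (normc_le_reim _)).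
have : h u <= h c by apply: H; rewrite in_itv.
have sq (x : R) : `|x| <= 1 + x * x.
  by rewrite ler_norml; apply/andP; split; nra.
move: (h c) (sq (re (f u))) (sq (im (f u))) => m; rewrite /h.
move: (re (f u)) (im (f u)) => x y; lra.
Qed.

(** The primitive from 0. Integrals are taken over intervals [- N, u] and the
    value at 0 is subtracted, which does not depend on N. *)
Lemma csmooth_antider f : csmooth f -> exists2 F, csmooth F & forall u, cder F u (f u).
Proof.
move=> sf; have cf : forall u, ccont f u := sf 0%N.
pose G N u := cint (- N) u f - cint (- N) 0 f.
have pf a b : exists M, pwcc f [::] M a b.
  have [ba|ab] := ltP b a.
    by exists 0 => u au ub; have := lt_trans ba au; rewrite ltNge (ltW ub).
  have [M HM] := ccont_bounded ab cf.
  by exists M => u au ub _; split => //; apply: HM; rewrite !ltW.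
have indep N N' u : 0 <= N -> N <= N' -> - N <= u -> G N u = G N' u.
  move=> N0 NN Nu; have [M P] := pf (- N') (Num.max u 0).
  have N'N : - N' <= - N by rewrite lerN2.
  have Nm0 : - N <= 0 by rewrite oppr_le0.
  have um : u <= Num.max u 0 by rewrite le_max lexx.
  have zm : 0 <= Num.max u 0 by rewrite le_max lexx orbT.
  rewrite /G (cint_split N'N Nu (pwccW (lexx _) um (lexx _) (fun x xB => xB) P)).
  rewrite (cint_split N'N Nm0 (pwccW (lexx _) zm (lexx _) (fun x xB => xB) P)).
  move: (cint _ _ _) (cint _ _ _) (cint _ _ _) => x y z; ring.
have dG N u : - N < u -> u < N -> cder (G N) u (f u).
  move=> Nu uN; have NN : - N <= N by exact: ltW (lt_trans Nu uN).
  have [M P] := pf (- N) N; have [_ /(_ u Nu uN isT) d] := cint_primitive NN P.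
  by apply: cder_eq (cderD d (cder_cst _ u)) _; rewrite addr0.
pose F u := G (`|u| + 1) u; have dF u : cder F u (f u).
  have [h1 h2] : - (`|u| + 2) < u /\ u < `|u| + 2.
    by apply/andP; rewrite -ltr_norml ltrDl.
  apply: cder_near (dG _ _ h1 h2); near=> v; rewrite /F.
  have vu : `|v| <= `|u| + 1.
    have -> : v = u + (v - u) by rewrite addrC subrK.
    apply: (le_trans (ler_normD _ _)); rewrite lerD2l.
    by rewrite ltW // distrC; near: v; exact: (@cvgr_dist_lt _ _ _ _ _ id u).
  symmetry; apply: indep; first by rewrite addr_ge0.
    by move: vu; move: (`|v|) (`|u|) => x y; lra.
  by have := ler_norm (- v); rewrite normrN => ?; lra.
by exists F => //; apply: csmooth_prim sf dF.
Unshelve. all: by end_near. Qed.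

(** A lift through the square: S = s exp (1/2 int h' / h). *)
Lemma csmooth_sqrt h (s : C) u0 : csmooth h -> (forall u, h u != 0) -> s ^+ 2 = h u0 ->
  exists S, [/\ csmooth S, forall u, S u ^+ 2 = h u & S u0 = s].
Proof.
move=> sh h0 sE; have [h' dh sh'] := csmooth_der sh.
have s0 : s != 0 by apply: contraNneq (h0 u0) => s0; rewrite -sE s0 expr0n.
have sq : csmooth (fun u => 2^-1 * (h' u * (h u)^-1)).
  by apply: csmoothM; [exact: csmooth_cst|apply: csmoothM => //; exact: csmoothV].
have [F sF dF] := csmooth_antider sq.
pose S u := s * cexp (F u - F u0); exists S; split.
- by apply: csmoothM; [exact: csmooth_cst|apply: csmooth_exp; apply: csmoothB => //; exact: csmooth_cst].
- move=> u; pose q v := S v ^+ 2 * (h v)^-1.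
  have dq v : cder q v 0.
    have dS := cderX 2 (cderM (cder_cst s v) (cder_exp (cderD (dF v) (cder_cst (- F u0) v)))).
    apply: cder_eq (cderM dS (cderV (h0 v) (dh v))) _.
    rewrite /= expr1 /q /S; move: (cexp _) => e; have := h0 v.
    by move: (h v) (h' v) => a b a0; field.
  have qE : q u = q u0.
    apply/eqP; rewrite eq_complex; apply/andP; split; apply/eqP.
      by apply: (@is_derive_0_is_cst _ (fun v => re (q v))) => v; exact: (dq v).1.
    by apply: (@is_derive_0_is_cst _ (fun v => im (q v))) => v; exact: (dq v).2.
  move: qE; rewrite /q {2}/S subrr cexp0 mulr1 sE divff // => qE.
  by rewrite -[LHS]mulr1 -(mulVf (h0 u)) mulrA qE mul1r.
- by rewrite /S subrr cexp0 mulr1.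
Qed.

Lemma is_derive_line (f : R -> R) n (w v : 'rV[R]_n.+1) i (d : R) :
  is_derive (w 0 i) 1 f d ->
  derivable (fun w : 'rV[R]_n.+1 => f (w 0 i)) w v /\
  'D_v (fun w : 'rV[R]_n.+1 => f (w 0 i)) w = v 0 i * d.
Proof.
move=> [df dE]; have E : (fun h : R => h^-1 *: (f ((h *: v + w) 0 i) - f (w 0 i))) =
  (fun h : R => h^-1 *: (f (h *: v 0 i + w 0 i) - f (w 0 i))).
  by apply/funext => h; rewrite !mxE.
have dd : differentiable f (w 0 i) by apply/derivable1_diffP.
have D : derivable f (w 0 i) (v 0 i) by exact: diff_derivable.
split; first by rewrite /derivable E.
by rewrite /derive E -[lim _]/('D_(v 0 i) f (w 0 i)) deriveE // diff1E // derive1E dE.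
Qed.

Lemma csmoothn_diffclass r h n (i : 'I_n.+1) : csmoothn r h ->
  diffclass r (fun w : 'rV[R]_n.+1 => re (h (w 0 i))) /\
  diffclass r (fun w : 'rV[R]_n.+1 => im (h (w 0 i))).
Proof.
elim: r h => [|r IH] h sh.
  have ch w : ccont (fun w : 'rV[R]_n.+1 => h (w 0 i)) w.
    apply: ccont_comp; last exact: sh.
    exact: coord_continuous.
  by split; split => // w; have [] := ch w.
have ch w : ccont (fun w : 'rV[R]_n.+1 => h (w 0 i)) w.
  apply: ccont_comp; last exact: csmoothn_cont sh _.
  exact: coord_continuous.
case: (sh) => h' dh sh'.
have key (v : 'rV[R]_n.+1) : csmoothn r (fun u => (v 0 i)%:C * h' u).
  by apply: csmoothnM => //; exact: csmoothn_cst.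
split; split; try by move=> w; have [] := ch w.
  move=> v; have D (w : 'rV[R]_n.+1) := is_derive_line v (dh (w 0 i)).1.
  split=> [w|]; first by have [] := D w.
  have [+ _] := IH _ (key v); congr diffclass; apply/funext => w.
  by have [_ ->] := D w; rewrite reM /= mul0r subr0.
move=> v; have D (w : 'rV[R]_n.+1) := is_derive_line v (dh (w 0 i)).2.
split=> [w|]; first by have [] := D w.
have [_] := IH _ (key v); congr diffclass; apply/funext => w.
by have [_ ->] := D w; rewrite imM /= mul0r addr0.
Qed.

Lemma csmooth_Csmooth h n (i : 'I_n.+1) : csmooth h -> Csmooth (fun w : 'rV[R]_n.+1 => h (w 0 i)).
Proof. by move=> sh r; exact: csmoothn_diffclass. Qed.

End SmoothCurves.

(** * Integral chains and paths on the curve *)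

Section Complexify.
Context {R : realType}.
Local Notation C := R[i].

Lemma coeff_complexify n (c : @chain R int n) s :
  coeff s (complexify c) = (coeff s c)%:~R.
Proof.
rewrite /complexify raddf_sum /=.
under eq_bigr do rewrite coeffU.
have [sc|sc] := boolP (s \in dom c); last first.
  rewrite (coeff_outdom sc) big_seq big1 // => t tc.
  by case: eqP => [E|]; rewrite ?mulr0 //; rewrite -E tc in sc.
rewrite (bigD1_seq s) ?uniq_dom //= eqxx mulr1 big1 ?addr0 // => t /negPf ->.
by rewrite mulr0.
Qed.

Lemma chainP (A : nzRingType) n (c d : @chain R A n) :
  (forall s, coeff s c = coeff s d) -> c = d.
Proof. by move=> H; apply/eqP/freeg_eqP. Qed.

Lemma complexifyD n (c d : @chain R int n) :
  complexify (c + d) = complexify c + complexify d.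
Proof. by apply: chainP => s; rewrite !(coeff_complexify, coeffD) rmorphD. Qed.

Lemma complexifyU n (z : int) (s : @sing R n) : complexify << z *g s >> = << z%:~R *g s >>.
Proof. by apply: chainP => t; rewrite coeff_complexify !coeffU rmorphM /= rmorph_nat. Qed.

Lemma bdD (A : comNzRingType) n (c d : @chain R A n.+1) : bd (c + d) = bd c + bd d.
Proof. exact: fgliftD. Qed.

Lemma admissible_chainD (A : nzRingType) (l : C) n (c d : @chain R A n) :
  admissible_chain l c -> admissible_chain l d -> admissible_chain l (c + d).
Proof. by move=> ac ad s /domD_subset; rewrite mem_cat => /orP[/ac|/ad]. Qed.

Lemma admissible_chainU (A : nzRingType) (l : C) n (z : A) (s : @sing R n) :
  admissible l s -> admissible_chain l << z *g s >>.
Proof.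
move=> adm t; have [->|z0] := eqVneq z 0; first by rewrite freegU0 dom0.
by rewrite domU // inE => /eqP ->.
Qed.

(** An end at oo is dropped from the boundary. *)
Lemma bd_path (sg : @sing R 1) (q0 q1 : option (C * C)) :
  (forall v : @splx R 1, val v 0 (@Ordinal 2 1 isT) = 1 -> sg v = q1) ->
  (forall v : @splx R 1, val v 0 (@Ordinal 2 1 isT) = 0 -> sg v = q0) ->
  bd << (1 : C) *g sg >> =
  (if q1 is Some p then << 1 *g (fun=> Some p : option (C * C)) >> else 0) -
  (if q0 is Some p then << 1 *g (fun=> Some p : option (C * C)) >> else 0) :> @chain R C 0.
Proof.
move=> H1 H0; rewrite /bd liftU scale1r big_ord_recl big_ord_recl big_ord0 addr0.
have E1 : sg \o face_splx ord0 = fun=> q1.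
  apply/funext => v /=; apply: H1; rewrite (splx0 v) SubK face_row_vtx vtxE.
  by rewrite (_ : _ == _) //; apply/eqP; exact: val_inj.
have E0 : sg \o face_splx (fintype.lift ord0 ord0) = fun=> q0.
  apply/funext => v /=; apply: H0; rewrite (splx0 v) SubK face_row_vtx vtxE.
  by rewrite (_ : _ == _ = false) //; apply/eqP => /(congr1 val).
rewrite E1 E0 /= expr0 expr1.
have T (q : option (C * C)) (z : C) :
    (if `[< const_oo ((fun=> q) : @sing R 0) >] then 0
     else << z *g ((fun=> q) : @sing R 0) >>) =
    if q is Some p then << z *g (fun=> Some p : option (C * C)) >> else 0 :> @chain R C 0.
  case: asboolP; case: q {H0 H1 E0 E1} => [p|] //; first by move=> /(_ spt0).
  by case; move.
rewrite !T; congr (_ + _); case: q0 {H0 E0 E1} => [p|]; last by rewrite oppr0.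
by rewrite freegUN.
Qed.

End Complexify.

Section PathsOnCurve.
Context {R : realType}.
Local Notation C := R[i].
Variable (l : C).
Let i1 : 'I_2 := @Ordinal 2 1 isT.

Definition par (v : @splx R 1) : R := val v 0 i1.

Lemma par01 v : 0 <= par v <= 1.
Proof.
have /in_splxP [v0 v1] := valP v; rewrite /par v0 /= -v1 big_ord_recl big_ord_recl big_ord0 addr0.
rewrite (_ : fintype.lift ord0 ord0 = i1); last exact: val_inj.
by rewrite lerDr.
Qed.

(** One piece, the whole simplex, and one chart are enough for the paths below. *)
Lemma piecewise_smooth_global (s : @sing R 1) (a b : R -> C) : csmooth a -> csmooth b ->
  (forall v, s v = Some (a (par v), b (par v))) \/
  (forall v, chart_oo (s v) (a (par v)) (b (par v))) -> piecewise_smooth s.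
Proof.
move=> sa sb H; exists 1%N, (fun _ i => Sub (vtx i) (vtx_in_splx i)); split=> [v|_ v _].
  exists ord0; exists v; rewrite {1}[val v]row_sum_delta.
  by apply: eq_bigr => i _; rewrite SubK.
exists (fun w => a (w 0 i1)), (fun w => b (w 0 i1)); split; try exact: csmooth_Csmooth.
by case: H => H; [left|right]; apply: (@filterE _ (nbhs (val v : 'rV[R]_2))) => w u <- _; exact: H.
Qed.

Lemma admissible_affine (x y : R -> C) : csmooth x -> csmooth y ->
  (forall u, y u ^+ 2 = (cubic l).[x u]) ->
  admissible l (fun v : @splx R 1 => Some (x (par v), y (par v))).
Proof.
move=> sx sy cv; split.
- by move=> v p [<-]; exact: cv.
- by apply: (piecewise_smooth_global sx sy); left.
- exists finset.set0 => v; split => // v0; exfalso.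
  have /in_splxP [_] := valP v; rewrite big1 => [/esym/eqP|i _]; first by rewrite oner_eq0.
  by apply: v0; rewrite finset.in_set0.
- move=> /(_ (Sub (vtx i1) (vtx_in_splx i1))) //.
- move=> N; have [M HM] := ccont_bounded ler01 (sy 0%N).
  exists (M + 1) => v p [<-] /=; rewrite normE lecR => h.
  by have := HM _ (par01 v); rewrite leNgt (lt_le_trans _ h) // ltrDl.
Qed.

Definition oo_path (K S : R -> C) : @sing R 1 := fun v =>
  if par v == 0 then None else Some ((K (par v) ^+ 2)^-1, S (par v) / K (par v) ^+ 3).

(** Along oo_path the chart at oo is (x / y, 1 / y) = (K / S, K^3 / S), which is
    smooth up to the point K = 0. *)
Lemma admissible_oo_path (K S : R -> C) : csmooth K -> csmooth S ->
  (forall u, S u ^+ 2 = (1 - K u ^+ 2) * (1 - l * K u ^+ 2)) ->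
  (forall u, S u != 0) -> (forall u, 0 <= u <= 1 -> (K u == 0) = (u == 0)) ->
  rapid_decay (oo_path K S) -> admissible l (oo_path K S).
Proof.
move=> sK sS cv S0 K0 rd; split => //.
- move=> v p; rewrite /oo_path; case: ifP => // v0 [<-]; rewrite /curve /= cubicE.
  have k0 : K (par v) != 0 by rewrite K0 ?v0 // par01.
  rewrite expr_div_n cv; move: (K _) k0 => k k0.
  by field; rewrite k0.
- apply: (@piecewise_smooth_global _ (fun u => K u / S u) (fun u => K u ^+ 3 / S u)).
  + by apply: csmoothM => //; exact: csmoothV.
  + by apply: csmoothM; [exact: csmoothX|exact: csmoothV].
  right => v; rewrite /oo_path; case: ifPn => v0 /=.
    have : K (par v) == 0 by rewrite K0 // par01.
    by move=> /eqP ->; rewrite expr0n /= !mul0r.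
  have k0 : K (par v) != 0 by rewrite K0 // par01.
  have := S0 (par v); move: (K _) (S _) k0 => k s k0 s0; split.
  - by rewrite mulf_neq0 // invr_eq0 expf_neq0.
  - by field; rewrite k0.
  - by rewrite invfM invrK mulrC.
- exists [set ord0]%SET => v; rewrite /oo_path; split=> [|H].
    case: ifP => // /eqP v0 _ i; rewrite finset.inE => i0.
    have -> // : i = i1; apply: val_inj; move: i0; case: i => -[|[|//]] //.
  by rewrite ifT // /par H // finset.inE.
- move=> /(_ (Sub (vtx i1) (vtx_in_splx i1))); rewrite /oo_path /par SubK vtxE eqxx oner_eq0 //.
Qed.

End PathsOnCurve.

(** * A chain from oo to a point of U *)

Section Delta.
Context {R : realType}.
Local Notation C := R[i].
Let i1 : 'I_2 := @Ordinal 2 1 isT.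

(** The path from x1 to x0 is bent by the term i c u (1 - u). The real part
    determines the parameter u at which it could meet z, and then the imaginary
    part excludes all values of c but one. *)
Lemma avoid (zs : seq C) (x0 x1 : C) : x0 \notin zs -> re x0 < re x1 ->
  (forall z, z \in zs -> re z < re x1) -> exists c : R, forall u : R,
  x1 + u%:C * (x0 - x1) + 'i * (c * u * (1 - u))%:C \notin zs.
Proof.
move=> x0z x01 zx1; pose d := x0 - x1.
have d0 : re d != 0 by rewrite /d reD reN lt_eqF // subr_lt0.
pose uz z := (re z - re x1) / re d.
pose cz z := (im z - im x1 - uz z * im d) / (uz z * (1 - uz z)).
exists (1 + \sum_(z <- zs) `|cz z|) => u; apply/negP.
set c := 1 + _; set z := _ + _ => zz.
have cc : cz z < c.
  apply: (le_lt_trans (ler_norm _)); rewrite /c (big_rem z) //=.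
  by rewrite addrCA ltrDl ltr_pwDl // sumr_ge0.
have rz : re z = re x1 + u * re d.
  by rewrite /z -/d 2!reD !reM /=; ring.
have iz : im z = im x1 + u * im d + c * u * (1 - u).
  by rewrite /z -/d 2!imD !imM /=; ring.
have uE : uz z = u by rewrite /uz rz; field.
have [u0|u0] := eqVneq u 0.
  by have := zx1 z zz; rewrite rz u0 mul0r addr0 ltxx.
have [u1|u1] := eqVneq u 1.
  move: zz; rewrite /z u1 subrr mulr0 !mulr0 addr0 mul1r addrC subrK.
  by rewrite (negPf x0z).
suff E : cz z = c by move: cc; rewrite E ltxx.
rewrite /cz uE iz; field; rewrite u0 andbT.
by rewrite subr_eq0 eq_sym.
Qed.

Variable l : C.

(** The path in the x-plane avoids the branch points 0, 1 and l, so that it lifts to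
    the curve from p on. Which of the two points over x1 it reaches is not
    controlled. *)
Lemma affine_path (p : C * C) (x1 : C) : curve l p -> p.2 != 0 ->
  re p.1 < re x1 -> 1 < re x1 -> re l < re x1 -> exists (y1 : C) (sg : @sing R 1),
  [/\ curve l (x1, y1), admissible l sg,
      forall v, par v = 1 -> sg v = Some p & forall v, par v = 0 -> sg v = Some (x1, y1)].
Proof.
case: p => x0 y0 /= cp y00 r0 r1 rl.
have root_mem x : (cubic l).[x] = 0 -> x \in [:: 0; 1; l].
  rewrite cubicE => /eqP; rewrite !mulf_eq0 !inE !subr_eq0 -!orbA.
  by case/or3P => ->; rewrite ?orbT.
have x0z : x0 \notin [:: 0; 1; l].
  apply: contraNN y00; rewrite !inE => H; suff : y0 ^+ 2 == 0 by rewrite expf_eq0.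
  rewrite cp cubicE.
  by case/or3P: H => /eqP ->; rewrite ?subrr ?mulr0 ?mul0r.
have zx1 z : z \in [:: 0; 1; l] -> re z < re x1.
  by rewrite !inE => /or3P[] /eqP -> //=; exact: lt_trans r1.
have [c av] := avoid x0z r0 zx1.
pose x u : C := x1 + u%:C * (x0 - x1) + 'i * (c * u * (1 - u))%:C.
have sx : csmooth x.
  have -> : x = fun u => x1 + u%:C * (x0 - x1) + 'i * (c%:C * u%:C * (1 - u%:C)).
    by apply/funext => u; rewrite /x !rmorphM rmorphB rmorph1.
  have sc := csmooth_cst; have si := csmooth_id.
  apply: csmoothD; first by apply: csmoothD; [exact: sc|apply: csmoothM; [exact: si|exact: sc]].
  apply: csmoothM; first exact: sc.
  by apply: csmoothM; [apply: csmoothM|apply: csmoothB].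
have x1E : x 1 = x0 by rewrite /x subrr !mulr0 addr0 mul1r addrC subrK.
have x0E : x 0 = x1 by rewrite /x mulr0 mul0r mulr0 mul0r !addr0.
have f0 u : (cubic l).[x u] != 0 by apply: contra (av u) => /eqP /root_mem.
have [Y [sY Y2 Y1]] := @csmooth_sqrt _ (fun u => (cubic l).[x u]) y0 1
  (csmooth_poly _ sx) f0 (etrans cp (congr1 _ (esym x1E))).
exists (Y 0), (fun v => Some (x (par v), Y (par v))); split.
- by rewrite /curve /= Y2 x0E.
- exact: admissible_affine.
- by move=> v ->; rewrite x1E Y1.
- by move=> v ->; rewrite x0E.
Qed.

Lemma exp_small (N : nat) : exists2 r0 : R, 0 < r0 & forall r, 0 < r -> r < r0 ->
  expR (- (2 * r ^+ 3)^-1) <= (r / 4) ^+ N.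
Proof.
exists (8 * N.+1%:R)^-1 => [|r r_gt0 rr0]; first by rewrite invr_gt0 mulr_gt0.
have n0 : (0 : R) < N.+1%:R by [].
have n1 : (1 : R) <= N.+1%:R by rewrite ler1n.
have r1 : r <= 1.
  by apply/ltW/(lt_le_trans rr0); rewrite invf_le1 ?mulr_gt0 //; lra.
set a := (2 * r ^+ 3)^-1; pose b := a / N.+1%:R.
have r30 : 0 < r ^+ 3 by rewrite exprn_gt0.
have b4 : 4 / r <= b.
  rewrite /b /a -invfM ler_pdivrMr // mulrC ler_pdivlMr ?mulr_gt0 //.
  have -> : 4 * (2 * r ^+ 3 * N.+1%:R) = (r * (8 * N.+1%:R)) * (r * r) by ring.
  have h : r * (8 * N.+1%:R) <= 1.
    by rewrite -ler_pdivlMr ?mulr_gt0 // div1r ltW.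
  have rge0 := ltW r_gt0.
  have rr : r * r <= r by rewrite ler_piMr.
  apply: le_trans rr; rewrite -[leRHS]mul1r; apply: ler_pM => //.
    by rewrite !mulr_ge0.
  exact: mulr_ge0.
have b0 : 0 < 4 / r by rewrite divr_gt0.
have aE : a = N.+1%:R * b by rewrite mulrC /b divfK // gt_eqF.
rewrite expRN aE expRM_natl.
have r4 : r / 4 = (4 / r)^-1 by rewrite invf_div.
rewrite r4 exprVn lef_pV2 ?posrE ?exprn_gt0 ?expR_gt0 //.
have eb : 4 / r <= expR b by apply: (le_trans b4); apply: le_trans (expR_ge1Dx b); rewrite lerDr.
apply: (@le_trans _ _ (expR b ^+ N)); first by rewrite lerXn2r // ?nnegrE ?ltW ?expR_gt0.
apply: ler_weXn2l => //.
by rewrite -expR0 ler_expR (le_trans _ b4) // ltW.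
Qed.

(** The two directions in which oo can be left, for the two points of the curve
    over a large abscissa: with K = om r and r > 0 small, y = S / K^3 is negative to
    leading order if S = - om^3. *)
Lemma half_turn (b : bool) : exists om : C,
  [/\ normc om = 1, 2^-1 <= re om & om ^+ 3 = (-1) ^+ b].
Proof.
case: b; last by exists 1; rewrite normc1 expr1n /=; split => //; lra.
pose s : R := Num.sqrt 3; have s2 : s ^+ 2 = 3 by rewrite sqr_sqrtr.
exists (2^-1 +i* (s / 2)); split => //=.
  rewrite -[RHS]sqrtr1; congr Num.sqrt.
  by rewrite !exprMn s2; field.
rewrite expr1; apply/eqP; rewrite eq_complex; apply/andP; split; apply/eqP.
  rewrite !exprS expr0 mulr1 !reM !imM /=.
  have -> : 2^-1 * (2^-1 * 2^-1 - s / 2 * (s / 2)) - s / 2 * (2^-1 * (s / 2) + s / 2 * 2^-1) =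
    8^-1 - 3 / 8 * s ^+ 2 by field.
  by rewrite s2; field.
rewrite !exprS expr0 mulr1 !imM !reM /=.
have -> : 2^-1 * (2^-1 * (s / 2) + s / 2 * 2^-1) + s / 2 * (2^-1 * 2^-1 - s / 2 * (s / 2)) =
  s * (3 / 8 - s ^+ 2 / 8) by field.
by rewrite s2 oppr0; field.
Qed.

(** A parameter of [0, 1] that stays bounded on the whole line, so that K remains
    in a small disc there and the square root of (1 - K^2) (1 - l K^2) exists as a
    smooth function on the line. *)
Definition mpar (u : R) : R := 2 * u / (1 + u ^+ 2).

Lemma mpar_den u : 0 < 1 + u ^+ 2 :> R.
Proof. by rewrite ltr_pwDl // sqr_ge0. Qed.

Lemma mpar0 : mpar 0 = 0. Proof. by rewrite /mpar mulr0 mul0r. Qed.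
Lemma mpar1 : mpar 1 = 1. Proof. by rewrite /mpar expr1n mulr1 divff. Qed.

Lemma mpar_le1 u : `|mpar u| <= 1.
Proof.
rewrite /mpar normrM normfV (gtr0_norm (mpar_den u)) ler_pdivrMr ?mpar_den // mul1r.
have := sqr_ge0 (1 - u); have := sqr_ge0 (1 + u); rewrite ler_norml => h1 h2.
by apply/andP; split; nra.
Qed.

Lemma mpar_ge u : 0 <= u -> u <= 1 -> u <= mpar u.
Proof.
move=> u0 u1; rewrite /mpar ler_pdivlMr ?mpar_den // mulrC ler_wpM2r //.
by nra.
Qed.

Lemma csmooth_mpar : csmooth (fun u => (mpar u)%:C).
Proof.
have -> : (fun u => (mpar u)%:C) = (fun u => 2 * u%:C * (1 + u%:C ^+ 2)^-1).
  by apply/funext => u; rewrite /mpar rmorphM fmorphV rmorphM rmorph_nat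
    (rmorphD _ 1 (u ^+ 2)) rmorph1 rmorphXn.
apply: (@csmoothM _ (fun u => 2 * u%:C) (fun u => (1 + u%:C ^+ 2)^-1)).
  by apply: csmoothM; [exact: csmooth_cst|exact: csmooth_id].
apply: csmoothV => [u|].
  rewrite -(rmorph1 (real_complex R)) -rmorphXn -rmorphD /=.
  by rewrite (fmorph_eq0 (real_complex R)) gt_eqF // mpar_den.
by apply: csmoothD; [exact: csmooth_cst|apply: csmoothX; exact: csmooth_id].
Qed.

(** With r = rho m and Z = S / W^3 one has y = r^-3 Z, where Z is close to -1 near
    oo, hence Re y <= - r^-3 / 2; and x / y = r W / S is at least r / 4 in absolute
    value. *)
Lemma oo_path_decay (rho : R) (W S : R -> C) : 0 < rho ->
  (forall u, 0 <= u <= 1 -> 2^-1 <= normc (W u)) ->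
  (forall u, normc (S u) <= 2) -> (forall u, S u != 0) ->
  ccont (fun u => S u / W u ^+ 3) 0 -> S 0 / W 0 ^+ 3 = -1 ->
  rapid_decay (oo_path (fun u => (rho * mpar u)%:C * W u) S).
Proof.
move=> rho0 W2 S2 S0 cZ Z0 N; have [r0 r0_gt0 Hr] := exp_small N.
have [d d0 Hd] : exists2 d, 0 < d & forall u, `|u| < d -> re (S u / W u ^+ 3) <= - 2^-1.
  have /ccontP/(_ 2^-1) := cZ; rewrite invr_gt0 ltr0n => /(_ isT)/nbhs_ballP[d /= d0 H].
  exists d => // u ud; have := H u; rewrite /ball /= sub0r normrN => /(_ ud).
  rewrite Z0 opprK => h; have := le_norm_re (S u / W u ^+ 3 + 1).
  move/le_lt_trans => /(_ _ h); rewrite reD ltr_norml => /andP[_].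
  by rewrite [re 1]/=; move: (re (_ / _)) => x; lra.
pose e := Num.min r0 (rho * d); have e0 : 0 < e by rewrite lt_min r0_gt0 mulr_gt0.
exists (16 / e ^+ 3 + 1) => v p; rewrite /oo_path.
have /andP[v0 v1] := par01 v; move: (par v) v0 v1 => u u0 u1.
case: eqP => // /eqP un0 [<-] /=; rewrite normE lecR => big.
have mu := mpar_ge u0 u1; have m0 : 0 < mpar u by rewrite (lt_le_trans _ mu) // lt_neqAle eq_sym un0.
set r := rho * mpar u; have r_gt0 : 0 < r by rewrite mulr_gt0.
have w2 := W2 u; rewrite u0 u1 in w2; have {}w2 := w2 isT.
have w0 : W u != 0 by rewrite -normc_gt0 (lt_le_trans _ w2) // invr_gt0.
have rC0 : r%:C != 0 :> C by rewrite (fmorph_eq0 (real_complex R)) gt_eqF.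
have yE : S u / (r%:C * W u) ^+ 3 = (r ^- 3)%:C * (S u / W u ^+ 3).
  by rewrite exprMn fmorphV rmorphXn; field; rewrite w0 rC0.
have re_small : r < e.
  rewrite ltNge; apply/negP => er; move: big; rewrite leNgt => /negP; apply.
  apply: (@le_lt_trans _ _ (16 / e ^+ 3)); last by rewrite ltrDl.
  rewrite yE normcM normcR normcM normcV normcX ger0_norm; last by rewrite invr_ge0 exprn_ge0 // ltW.
  have h1 : r ^- 3 <= e ^- 3.
    by rewrite lef_pV2 ?posrE ?exprn_gt0 // lerXn2r // nnegrE ltW.
  have h2 : (normc (W u) ^+ 3)^-1 <= 8.
    rewrite -[leRHS]invrK lef_pV2 ?posrE ?exprn_gt0 ?invr_gt0 ?normc_gt0 //.
    have -> : 8^-1 = 2^-1 ^+ 3 :> R by field.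
    by rewrite lerXn2r // nnegrE ?normc_ge0 ?invr_ge0.
  rewrite [leRHS]mulrC; apply: ler_pM => //.
  - by rewrite invr_ge0 exprn_ge0 // ltW.
  - by rewrite mulr_ge0 ?normc_ge0 // invr_ge0 exprn_ge0 ?normc_ge0.
  have -> : 16 = 2 * 8 :> R by ring.
  by apply: ler_pM; rewrite ?normc_ge0 // invr_ge0 exprn_ge0 ?normc_ge0.
move: re_small; rewrite lt_min => /andP[rr0 rd].
have ud : `|u| < d.
  by rewrite ger0_norm // (le_lt_trans mu) // -(ltr_pM2l rho0).
have := Hr r r_gt0 rr0; rewrite -/r in big *.
rewrite !normE -[leRHS]/(_) => hexp.
have -> : (r%:C * W u) ^- 2 / (S u / (r%:C * W u) ^+ 3) = r%:C * (W u / S u).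
  by field; rewrite S0 w0 rC0.
rewrite -rmorphXn lecR normc_cexp yE reM /= mul0r subr0.
apply: (@le_trans _ _ (expR (- (2 * r ^+ 3)^-1))).
  have -> : - (2 * r ^+ 3)^-1 = r ^- 3 * - 2^-1 by rewrite mulrN -invfM mulrC.
  by rewrite ler_expR ler_wpM2l ?invr_ge0 ?exprn_ge0 ?(ltW r_gt0) //; exact: Hd.
apply: (le_trans hexp); rewrite lerXn2r ?nnegrE ?normc_ge0 ?divr_ge0 ?(ltW r_gt0) //.
rewrite normcM normcR gtr0_norm // ler_wpM2l ?(ltW r_gt0) // normcM normcV.
have -> : 4^-1 = 2^-1 * 2^-1 :> R by field.
apply: ler_pM; rewrite ?invr_ge0 //.
by rewrite lef_pV2 ?posrE ?normc_gt0.
Qed.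

(** The branch of S is prescribed at the end u = 1 of the path and its sign is
    needed at u = 0. *)
Lemma continuous_same_sign (f : R -> R) : continuous f -> (forall u, f u != 0) ->
  0 < f 1 -> 0 < f 0.
Proof.
move=> cf f0 f1; rewrite ltNge; apply/negP => h.
have [|c _ /eqP] := IVT (v := 0) ler01 (continuous_subspaceT cf).
  by rewrite ge_min h /= le_max (ltW f1) orbT.
by rewrite (negPf (f0 c)).
Qed.

(** In the parameter K with x = K^-2 the curve near oo is y = S / K^3 with
    S^2 = (1 - K^2) (1 - l K^2). The path K = rho m (om (1 - m) + m) leaves oo in the
    direction om, where exp y decays, and turns to end at K = rho. *)
Lemma path_from_oo (rho : R) (y1 : C) : 0 < rho ->
  18 * rho ^+ 2 * (1 + 2 * normc l) <= 1 -> curve l ((rho ^- 2)%:C, y1) ->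
  exists sg : @sing R 1, [/\ admissible l sg,
      forall v, par v = 1 -> sg v = Some ((rho ^- 2)%:C, y1) & forall v, par v = 0 -> sg v = None].
Proof.
move=> rho0 rhol c1; pose rC : C := rho%:C.
have rC0 : rC != 0 by rewrite (fmorph_eq0 (real_complex R)) gt_eqF.
have [om [om1 om2 om3]] := half_turn (0 < re (y1 * rC ^+ 3)).
pose W u : C := om * (1 - (mpar u)%:C) + (mpar u)%:C.
pose K u : C := (rho * mpar u)%:C * W u.
have sW : csmooth W.
  apply: csmoothD; last exact: csmooth_mpar.
  by apply: csmoothM; [exact: csmooth_cst|apply: csmoothB; [exact: csmooth_cst|exact: csmooth_mpar]].
have sK : csmooth K.
  rewrite (_ : K = fun u => rC * (mpar u)%:C * W u); last by apply/funext => u; rewrite /K rmorphM.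
  by apply: csmoothM => //; apply: csmoothM; [exact: csmooth_cst|exact: csmooth_mpar].
have W0 : W 0 = om by rewrite /W mpar0 subr0 mulr1 addr0.
have W1 : W 1 = 1 by rewrite /W mpar1 subrr mulr0 add0r.
have K1 : K 1 = rC by rewrite /K W1 mpar1 !mulr1.
have K_small u : normc (K u) <= 3 * rho.
  have m1 := mpar_le1 u; rewrite /K normcM normcR normrM (gtr0_norm rho0).
  have w3 : normc (W u) <= 3.
    apply: (le_trans (le_normcD _ _)); rewrite normcM om1 mul1r.
    apply: (le_trans (lerD (le_normcB _ _) (lexx _))).
    by rewrite normc1 normcR; move: (`|mpar u|) m1 => x; lra.
  rewrite mulrC; apply: ler_pM; rewrite ?normc_ge0 ?mulr_ge0 ?(ltW rho0) //.
  by rewrite ler_piMr // ltW.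
pose h u := (1 - K u ^+ 2) * (1 - l * K u ^+ 2).
have h1 u : normc (h u - 1) <= 2^-1.
  have -> : h u - 1 = K u ^+ 2 * (l * K u ^+ 2 - (1 + l)) by rewrite /h; ring.
  have k2 : normc (K u) ^+ 2 <= 9 * rho ^+ 2.
    have -> : 9 * rho ^+ 2 = (3 * rho) ^+ 2 by rewrite exprMn; congr (_ * _); ring.
    by rewrite lerXn2r // nnegrE ?normc_ge0 // mulr_ge0 // ltW.
  have nl := normc_ge0 l; have nk := exprn_ge0 2 (normc_ge0 (K u)).
  have r2 : 0 <= rho ^+ 2 by exact: sqr_ge0.
  have k21 : normc (K u) ^+ 2 <= 1.
    by move: rhol nl r2 k2; move: (rho ^+ 2) (normc l) (normc (K u) ^+ 2) => x y z; nra.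
  rewrite normcM normcX.
  have : normc (l * K u ^+ 2 - (1 + l)) <= 1 + 2 * normc l.
    apply: (le_trans (le_normcB _ _)); rewrite normcM normcX.
    have := le_normcD 1 l; rewrite normc1.
    have : normc l * normc (K u) ^+ 2 <= normc l by rewrite ler_piMr.
    lra.
  move=> h2; apply: (@le_trans _ _ (9 * rho ^+ 2 * (1 + 2 * normc l))).
    by apply: ler_pM => //; exact: normc_ge0.
  by move: rhol; move: (rho ^+ 2) (normc l) => x y; lra.
have re_h u : 2^-1 <= re (h u).
  have := le_trans (le_norm_re _) (h1 u); rewrite reD reN ler_norml => /andP[+ _].
  by rewrite [re 1]/=; lra.
have h0 u : h u != 0 by apply/eqP => E; have := re_h u; rewrite E /=; lra.
pose S1 := y1 * rC ^+ 3.
have S1E : S1 ^+ 2 = h 1.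
  rewrite /h K1 /S1 exprMn c1 cubicE /=.
  have -> : (rho ^- 2)%:C = rC ^- 2 by rewrite fmorphV rmorphXn.
  by field.
have sh : csmooth h.
  apply: csmoothM; apply: csmoothB; try exact: csmooth_cst; first exact: csmoothX.
  by apply: csmoothM; [exact: csmooth_cst|exact: csmoothX].
have [S [sS S2 SE]] := csmooth_sqrt sh h0 S1E.
have re_S u : re (S u) != 0.
  apply/eqP => E; have := re_h u; rewrite -S2 expr2 reM E mulr0 sub0r.
  by have := sqr_ge0 (im (S u)); rewrite expr2; lra.
have S0 u : S u != 0 by apply: contra (re_S u) => /eqP ->.
have K0 : K 0 = 0 by rewrite /K mpar0 mulr0 mul0r.
have S00 : S 0 ^+ 2 = 1 by rewrite S2 /h K0 expr0n /= mulr0 subr0 mulr1.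
have cS : continuous (fun u => re (S u)) by move=> u; have [] := sS 0%N u.
have cSN : continuous (fun u => - re (S u)) by move=> u; exact: continuousN (cS u).
have Z0 : S 0 / W 0 ^+ 3 = -1.
  rewrite W0 om3 -/S1 -SE; have /eqP := S00; rewrite -subr_eq0 subr_sqr_1 mulf_eq0.
  have [pos|neg] := ltP 0 (re (S 1)).
    have p0 := continuous_same_sign cS re_S pos.
    case/orP; rewrite ?subr_eq0 ?addr_eq0 => /eqP E; last first.
      by move: p0; rewrite E /= oppr_gt0 ltr10.
    by rewrite E expr1 div1r invrN invr1.
  have p1 : 0 < - re (S 1) by rewrite oppr_gt0 lt_neqAle re_S.
  have p0 : 0 < - re (S 0).
    by apply: (@continuous_same_sign (fun u => - re (S u))) => // u; rewrite oppr_eq0.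
  case/orP; rewrite ?subr_eq0 ?addr_eq0 => /eqP E.
    by move: p0; rewrite E /= oppr_gt0 ltr10.
  by rewrite E expr0 divr1.
have W_ge u : 0 <= u <= 1 -> 2^-1 <= normc (W u).
  move=> /andP[u0 u1]; apply: le_trans (le_norm_re _); apply: le_trans (ler_norm _).
  have m0 := le_trans u0 (mpar_ge u0 u1); have := le_trans (ler_norm _) (mpar_le1 u).
  rewrite /W reD reM /= oppr0 addr0 mulr0 subr0; move: (mpar u) (re om) om2 m0 => m a; nra.
exists (oo_path K S); split.
- apply: admissible_oo_path => // [u u01|].
    apply/eqP/eqP => [/eqP|->]; last exact: K0.
    have /andP[u0 u1] := u01.
    rewrite /K mulf_eq0 => /orP[|/eqP E]; last first.
      by have := W_ge u u01; rewrite E normc0; lra.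
    rewrite (fmorph_eq0 (real_complex R)) mulf_eq0 gt_eqF //= => /eqP E.
    by apply/eqP; rewrite eq_le u0 -E mpar_ge.
  apply: oo_path_decay => //.
  + move=> u; have : normc (S u) ^+ 2 <= 2 ^+ 2.
      rewrite -normcX S2; apply: (@le_trans _ _ (normc (h u - 1) + normc 1)).
        by rewrite -{1}[h u](subrK 1) le_normcD.
      by have := h1 u; rewrite normc1; lra.
    by rewrite ler_pXn2r ?nnegrE ?normc_ge0.
  + apply: ccontM; first exact: (sS 0%N).
    apply: ccontV; first by rewrite W0 om3 signr_eq0.
    by apply: ccontX; exact: (sW 0%N).
- move=> v v1; rewrite /oo_path v1 oner_eq0 K1 SE /S1 mulfK ?expf_neq0 //.
  by congr (Some (_, _)); rewrite fmorphV rmorphXn.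
- by move=> v v0; rewrite /oo_path v0 eqxx.
Qed.

(** The classes that split the boundary map onto H_0 of a finite set of points, with
    integral coefficients. *)
Lemma delta_exists (p : C * C) : curve l p -> p.2 != 0 -> exists c : @chain R int 1,
  admissible_chain l (complexify c) /\
  bd (complexify c) = << 1 *g ((fun=> Some p) : @sing R 0) >>.
Proof.
move=> cp p2; pose T := 20 * (1 + normc l + normc p.1); pose rho := T^-1.
have nl := normc_ge0 l; have np := normc_ge0 p.1.
have T20 : 20 <= T by rewrite /T; lra.
have T0 : 0 < T by exact: lt_le_trans T20.
have rho0 : 0 < rho by rewrite invr_gt0.
have rE : rho ^- 2 = T ^+ 2 by rewrite /rho exprVn invrK.
have big : 18 * rho ^+ 2 * (1 + 2 * normc l) <= 1.
  rewrite /rho exprVn mulrAC ler_pdivrMr ?exprn_gt0 // mul1r.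
  by rewrite /T; move: (normc l) (normc p.1) nl np => x y x0 y0; nra.
have T2 : T <= T ^+ 2 by rewrite expr2 ler_peMl ?(ltW T0) //; lra.
have lT z : normc z <= normc l + normc p.1 -> re z < re ((rho ^- 2)%:C : C).
  move=> h; rewrite rE /=; apply: lt_le_trans T2; apply: le_lt_trans (ler_norm _) _.
  by apply: (le_lt_trans (le_norm_re z)); rewrite /T; lra.
have r1 : re p.1 < re ((rho ^- 2)%:C : C) by apply: lT; lra.
have r2 : 1 < re ((rho ^- 2)%:C : C) by rewrite rE /=; apply: lt_le_trans T2; lra.
have r3 : re l < re ((rho ^- 2)%:C : C) by apply: lT; lra.
have [y1 [s1 [cy a1 e11 e10]]] := affine_path cp p2 r1 r2 r3.
have [s2 [a2 e21 e20]] := path_from_oo rho0 big cy.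
exists (<< 1 *g s1 >> + << 1 *g s2 >>); rewrite complexifyD !complexifyU; split.
  by apply: admissible_chainD; exact: admissible_chainU.
rewrite bdD (bd_path e11 e10) (bd_path e21 e20) /= subr0.
by rewrite subrK.
Qed.

End Delta.

(** * Bases modulo a subspace, and spaces of chains *)

Section BasesMod.
Variables (K : comNzRingType) (L : pzRingType) (phi : {rmorphism K -> L}) (V : lmodType L).
Variable (W : V -> Prop).
Hypotheses (W0 : W 0) (Wlin : forall a x y, W x -> W y -> W (phi a *: x + y)).

Lemma mod_add x y : W x -> W y -> W (x + y).
Proof. by move=> Wx Wy; have := Wlin 1 Wx Wy; rewrite rmorph1 scale1r. Qed.

Lemma mod_sum n (a : 'I_n -> K) (x : 'I_n -> V) :
  (forall i, W (x i)) -> W (\sum_i phi (a i) *: x i).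
Proof. by move=> Wx; elim/big_rec: _ => // i y _; exact: Wlin. Qed.

(** Modulo W the vector v i is the combination of the v k with coefficients the row
    i of A B; it is also itself, and such combinations are unique. The scalars are
    included by phi since those of a space of forms are in k, while the forms are a
    module over polynomials. *)
Lemma change_mx1 n n' (v : 'I_n -> V) (w : 'I_n' -> V)
    (A : 'M[K]_(n, n')) (B : 'M[K]_(n', n)) :
  (forall i (c : {ffun 'I_n -> K}), W (v i - \sum_k phi (c k) *: v k) ->
     c = [ffun k => (i == k)%:R]) ->
  (forall i, W (v i - \sum_j phi (A i j) *: w j)) ->
  (forall j, W (w j - \sum_i phi (B j i) *: v i)) -> A *m B = 1%:M.
Proof.
move=> uniq WA WB; apply/matrixP => i k.
suff /ffunP/(_ k) : [ffun k => (A *m B) i k] = [ffun k => (i == k)%:R].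
  by rewrite !ffunE => ->; rewrite mxE.
apply: uniq; have := mod_add (WA i) (mod_sum (A i) WB).
congr W; rewrite -addrA; congr (_ + _).
under [X in _ + X]eq_bigr do rewrite scalerBr.
rewrite sumrB addKr; congr (- _).
under eq_bigr do rewrite scaler_sumr.
rewrite exchange_big /=; apply: eq_bigr => h _.
rewrite ffunE mxE rmorph_sum scaler_suml; apply: eq_bigr => j _.
by rewrite scalerA rmorphM.
Qed.

End BasesMod.

Section ChainSpaces.
Context {R : realType}.
Local Notation C := R[i].
Variables (l : C) (S : set (C * C)).

Lemma coeffZ (A : nzRingType) n (a : A) (c : @chain R A n) s : coeff s (a *: c) = a * coeff s c.
Proof. exact: coeff_fgscale. Qed.

Lemma domZ (A : nzRingType) n (a : A) (c : @chain R A n) s : s \in dom (a *: c) -> s \in dom c.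
Proof. by rewrite !mem_dom coeffZ; apply: contraNneq => ->; rewrite mulr0. Qed.

Lemma admissible_lin n (a : C) (c d : @chain R C n) :
  admissible_chain l c -> admissible_chain l d -> admissible_chain l (a *: c + d).
Proof. by move=> H H'; apply: admissible_chainD => // s /domZ; exact: H. Qed.

Lemma supported_lin n (a : C) (c d : @chain R C n) :
  supported S c -> supported S d -> supported S (a *: c + d).
Proof.
by move=> H H' s /domD_subset; rewrite mem_cat => /orP[/domZ|]; [exact: H|exact: H'].
Qed.

Lemma bd_lin n (a : C) (c d : @chain R C n.+1) : bd (a *: c + d) = a *: bd c + bd d.
Proof. by rewrite /bd fgliftD fgliftZ. Qed.

Lemma admissible0 n : admissible_chain l (0 : @chain R C n).
Proof. by move=> s; rewrite dom0. Qed.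

Lemma supported0 n : supported S (0 : @chain R C n).
Proof. by move=> s; rewrite dom0. Qed.

Lemma bd0 n : bd (0 : @chain R C n.+1) = 0.
Proof. exact: fglift0. Qed.

Lemma bd_sum n m (a : 'I_m -> C) (c : 'I_m -> @chain R C n.+1) :
  bd (\sum_i a i *: c i) = \sum_i a i *: bd (c i).
Proof. by elim/big_rec2: _ => [|i x y _ <-]; rewrite ?bd0 ?bd_lin. Qed.

Lemma rel_boundary_lin (a : C) (c d : @chain R C 1) :
  rel_boundary l S c -> rel_boundary l S d -> rel_boundary l S (a *: c + d).
Proof.
move=> [b [e [ab ae se ->]]] [b' [e' [ab' ae' se' ->]]].
exists (a *: b + b'), (a *: e + e'); split;
  [exact: admissible_lin|exact: admissible_lin|exact: supported_lin|].
by rewrite bd_lin scalerDr addrACA.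
Qed.

Lemma rel_boundary0 : rel_boundary l S 0.
Proof.
exists 0, 0; split; [exact: admissible0|exact: admissible0|exact: supported0|].
by rewrite bd0 addr0.
Qed.

Lemma complexify0 n : complexify (0 : @chain R int n) = 0.
Proof. by apply: chainP => s; rewrite coeff_complexify !coeff0. Qed.

Lemma complexifyZ n (z : int) (c : @chain R int n) : complexify (z *: c) = z%:~R *: complexify c.
Proof. by apply: chainP => s; rewrite !(coeff_complexify, coeffZ) rmorphM. Qed.

Lemma complexify_sum n m (c : 'I_m -> @chain R int n) :
  complexify (\sum_i c i) = \sum_i complexify (c i).
Proof. exact: (big_morph _ (@complexifyD _ n) (complexify0 n)). Qed.

Lemma bd_complexify n (c : @chain R int n.+1) : bd (complexify c) = complexify (bd c).
Proof.
rewrite /bd (fglift_dom _ c) [complexify c]/complexify fglift_sum.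
rewrite (big_morph _ (@complexifyD _ n) (complexify0 n)); apply: eq_bigr => s _.
rewrite liftU complexifyZ complexify_sum; congr (_ *: _); apply: eq_bigr => i _.
case: asboolP => _; first by rewrite complexify0.
by rewrite complexifyU rmorphXn rmorphN1.
Qed.

End ChainSpaces.

(** * A basis of the de Rham cohomology *)

Section PeriodDeterminant.
Context {R : realType} {k : fieldType} (iota : {rmorphism k -> R[i]}) (lam : k).
Local Notation C := R[i].
Local Notation PK := {poly {poly k}}.
Local Notation mapG := (map_poly (map_poly iota)).
Local Notation form := (Defs.form k).
Local Notation kc := (polyC \o polyC : k -> PK).
Let l : C := iota lam.
Let Sg : set (C * C) := Sigma l.
Hypotheses (l0 : l != 0) (l1 : l != 1).

Lemma Sigma_y_neq0 p : Sg p -> curve l p /\ p.2 != 0.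
Proof.
move=> [cp [e re ye]]; split => //; apply/eqP => y0.
move: ye; rewrite y0 expr0n /= => /esym fe.
by have := cubic_smooth l0 l1 fe; rewrite (eqP re) eqxx.
Qed.

Lemma dy_lin (a : k) (g h : PK) : dy (kc a * g + h) = kc a * dy g + dy h.
Proof.
rewrite /dy; apply/polyP => i.
by rewrite coef_map !coefD !coefCM !coef_map /= derivD derivM derivC mul0r add0r.
Qed.

Lemma nabla_lin (a : k) (g h : PK) : nabla (kc a * g + h) = kc a *: nabla g + nabla h.
Proof.
rewrite /nabla; congr (_, _) => /=.
  by rewrite /dx derivD derivM derivC mul0r add0r.
by rewrite dy_lin scalerDr addrACA.
Qed.

Lemma form_rel_lin (a : k) (x y : form) :
  form_rel lam x -> form_rel lam y -> form_rel lam (kc a *: x + y).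
Proof.
move=> [c [e1 [e2 ->]]] [c' [e1' [e2' ->]]].
exists (kc a * c + c'), (kc a * e1 + e1'), (kc a * e2 + e2').
have Z (x' y' : PK) : x' *: (y' : PK^o) = x' * y' by [].
by congr (_, _); rewrite /= !Z; move: (a%:P%:P : PK) => b; ring.
Qed.

Lemma form_rel0 : form_rel lam (0 : form).
Proof. by exists 0, 0, 0; rewrite !mul0r !mulr0 !addr0. Qed.

Lemma ev_lin (a : k) (g h : PK) p : ev iota (kc a * g + h) p = iota a * ev iota g p + ev iota h p.
Proof.
by rewrite /ev rmorphD rmorphM /= !map_polyC /= map_polyC /= hornerXYD hornerXYM !hornerC.
Qed.

Lemma vanishing_lin (S : set (C * C)) (a : k) (g h : PK) :
  vanishing iota S g -> vanishing iota S h -> vanishing iota S (kc a * g + h).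
Proof. by move=> gS hS p Sp; rewrite ev_lin gS // hS // mulr0 addr0. Qed.

Lemma vanishing0 (S : set (C * C)) : vanishing iota S 0.
Proof. by move=> p _; rewrite /ev rmorph0 hornerXY0. Qed.

Lemma nabla0 : nabla (0 : PK) = 0.
Proof. by rewrite /nabla /dx /dy deriv0 raddf0 addr0. Qed.

Lemma dR_trivial_lin (S : set (C * C)) (a : k) (x y : form) :
  dR_trivial iota lam S x -> dR_trivial iota lam S y -> dR_trivial iota lam S (kc a *: x + y).
Proof.
move=> [g gS xg] [h hS yh]; exists (kc a * g + h); first exact: vanishing_lin.
have := form_rel_lin a xg yh; congr form_rel.
by rewrite nabla_lin scalerBr opprD addrACA.
Qed.

Lemma dR_trivial0 (S : set (C * C)) : dR_trivial iota lam S 0.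
Proof.
by exists 0; [exact: vanishing0|rewrite nabla0 subr0; exact: form_rel0].
Qed.

Lemma nabla_sum n (a : 'I_n -> k) (g : 'I_n -> PK) :
  nabla (\sum_i kc (a i) * g i) = \sum_i kc (a i) *: nabla (g i).
Proof.
elim/big_rec2: _ => [|i x y _ <-]; first exact: nabla0.
by rewrite nabla_lin.
Qed.

Lemma kbasis_rep (V : lmodType PK) (W : V -> Prop) n (v : 'I_n -> V) n' (u : 'I_n' -> V) :
  kbasis_mod W v -> exists A : 'M[k]_(n', n), forall i, W (u i - \sum_j kc (A i j) *: v j).
Proof.
move=> bv; have /choice[c Hc] : forall i, exists c : {ffun 'I_n -> k}, W (u i - \sum_j kc (c j) *: v j).
  by move=> i; have [c [Wc _]] := bv (u i); exists c.
exists (\matrix_(i, j) c i j) => i; have := Hc i; congr (W (_ - _)).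
by apply: eq_bigr => j _; rewrite mxE.
Qed.

Lemma kbasis_uniq (V : lmodType PK) (W : V -> Prop) n (v : 'I_n -> V) : W 0 ->
  kbasis_mod W v -> forall i (c : {ffun 'I_n -> k}), W (v i - \sum_j kc (c j) *: v j) ->
  c = [ffun j => (i == j)%:R].
Proof.
move=> W0 bv i c Wc; have [d [_ U]] := bv (v i); rewrite -(U c Wc); apply: U.
suff -> : \sum_j ([ffun j => (i == j)%:R] j : k)%:P%:P *: v j = v i by rewrite subrr.
rewrite (bigD1 i) //= ffunE eqxx !rmorph1 scale1r big1 ?addr0 // => j /negPf ji.
by rewrite ffunE eq_sym ji !rmorph0 scale0r.
Qed.

Lemma kbasis_free (V : lmodType PK) (W : V -> Prop) n (v : 'I_n -> V) : W 0 ->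
  kbasis_mod W v -> forall c : {ffun 'I_n -> k}, W (- \sum_j kc (c j) *: v j) -> forall j, c j = 0.
Proof.
move=> W0 bv c Wc j; have [d [_ U]] := bv 0.
have dc : d = c by apply: U; rewrite sub0r.
have d0 : d = [ffun=> 0].
  apply: U; rewrite sub0r big1 ?oppr0 // => h _.
  by rewrite ffunE !rmorph0 scale0r.
by rewrite -dc d0 ffunE.
Qed.

Section Bases.
Variables (m n0 : nat) (pt : 'I_m -> C * C) (g : 'I_m -> PK^o) (omU : 'I_n0 -> form).
Hypotheses (pt_inj : injective pt) (pt_Sigma : range pt = Sg).
Hypotheses (basis_g : kbasis_mod (vanishing iota Sg : PK^o -> Prop) g)
  (basis_omU : kbasis_mod (dR_trivial iota lam set0) omU).
Variables (delta : 'I_m -> @chain R int 1).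
Hypotheses (delta_adm : forall i, admissible_chain l (complexify (delta i)))
  (delta_bd : forall i, bd (complexify (delta i)) =
    << 1 *g ((fun=> Some (pt i)) : @sing R 0) >>).

Lemma period_delta i (h : PK) :
  period iota (complexify (delta i)) (nabla h) = ev iota h (pt i) * cexp (pt i).2.
Proof.
by rewrite (period_nabla _ _ (@delta_adm i)) delta_bd liftU scale1r.
Qed.

(** The period of nabla h along delta i is h exp y at the point pt i. *)
Lemma nabla_rel_vanishing (h : PK) : form_rel lam (nabla h) -> vanishing iota Sg h.
Proof.
move=> H p; rewrite -pt_Sigma => -[i _ <-].
have /esym/eqP := period_delta i h; rewrite (period_form_rel (@delta_adm i) H).
by rewrite mulf_eq0 (negPf (cexp_neq0 _)) orbF => /eqP.
Qed.

Definition formB (i : 'I_(m + n0)) : form :=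
  match fintype.split i with inl j => nabla (g j) | inr j => omU j end.

Lemma formB_l j : formB (lshift n0 j) = nabla (g j).
Proof. by rewrite /formB (unsplitK (inl j)). Qed.

Lemma formB_r j : formB (rshift m j) = omU j.
Proof. by rewrite /formB (unsplitK (inr j)). Qed.

Lemma formB_sum (c : 'I_(m + n0) -> k) : \sum_i kc (c i) *: formB i =
  nabla (\sum_i kc (c (lshift n0 i)) * g i) + \sum_i kc (c (rshift m i)) *: omU i.
Proof.
rewrite big_split_ord /= nabla_sum; congr (_ + _); apply: eq_bigr => i _.
  by rewrite formB_l.
by rewrite formB_r.
Qed.

(** If nabla (sum c_j g_j) + sum c_i omU_i is trivial relative to Sigma, then it is
    trivial on U, hence the c_i vanish; what is left is nabla_rel_vanishing. *)
Lemma formB_free (c : {ffun 'I_(m + n0) -> k}) :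
  dR_trivial iota lam Sg (- \sum_i kc (c i) *: formB i) -> c = [ffun=> 0].
Proof.
rewrite formB_sum => -[h hS H].
pose gs := \sum_i kc (c (lshift n0 i)) * g i.
have triv : dR_trivial iota lam set0 (- \sum_i kc ([ffun i => c (rshift m i)] i) *: omU i).
  exists (h + gs) => //; move: H; congr form_rel.
  under [in RHS]eq_bigr do rewrite ffunE.
  have := nabla_lin 1 h gs; rewrite !rmorph1 mul1r scale1r -/gs => ->.
  move: (nabla h) (nabla gs) (\sum_i _ *: _) => a b d.
  by rewrite !opprD [LHS]addrAC [LHS]addrC [- b + _]addrC.
have cr i : c (rshift m i) = 0.
  have := kbasis_free (dR_trivial0 set0) basis_omU triv i; by rewrite ffunE.
have van : vanishing iota Sg (- \sum_i kc ([ffun i => c (lshift n0 i)] i) *: g i : PK^o).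
  under eq_bigr do rewrite ffunE.
  have -> : - \sum_i kc (c (lshift n0 i)) *: g i = kc (-1) * (h + gs) + h :> PK.
    by rewrite !rmorphN1 mulN1r opprD addrAC addNr add0r.
  apply: vanishing_lin => //; apply: nabla_rel_vanishing.
  move: H; rewrite [X in - (_ + X)]big1 => [|i _]; last by rewrite cr !rmorph0 scale0r.
  rewrite addr0 -/gs => /(form_rel_lin (-1))/(_ form_rel0).
  congr form_rel; rewrite addr0 !rmorphN1 scaleN1r opprB opprK.
  by have := nabla_lin 1 h gs; rewrite !rmorph1 mul1r scale1r.
apply/ffunP => i; rewrite [RHS]ffunE -(splitK i); case: (fintype.split i) => j /=.
  have := kbasis_free (@vanishing0 Sg) basis_g van j; by rewrite ffunE.
exact: cr.
Qed.

Lemma formB_basis : kbasis_mod (dR_trivial iota lam Sg) formB.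
Proof.
move=> u; have [cU [[h _ H] _]] := basis_omU u; have [cg [van _]] := basis_g h.
pose c : {ffun 'I_(m + n0) -> k} :=
  [ffun i => match fintype.split i with inl j => cg j | inr j => cU j end].
have cl j : c (lshift n0 j) = cg j by rewrite ffunE (unsplitK (inl j)).
have cr j : c (rshift m j) = cU j by rewrite ffunE (unsplitK (inr j)).
have Hc : dR_trivial iota lam Sg (u - \sum_i kc (c i) *: formB i).
  exists (h - \sum_i kc (cg i) *: g i) => //; move: H; congr form_rel.
  rewrite formB_sum.
  under [in RHS]eq_bigr do rewrite cl.
  under [X in u - (_ + X)]eq_bigr do rewrite cr.
  set gs := \sum_i _ * _.
  have := nabla_lin (-1) gs h; rewrite !rmorphN1 mulN1r scaleN1r addrC => ->.
  move: (nabla h) (nabla gs) (\sum_i _ *: _) => a b d.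
  by rewrite !opprD opprK !addrA; congr (_ - _); rewrite [RHS]addrAC subrK.
exists c; split => // c' Hc'.
suff /ffunP E : [ffun i => c' i - c i] = [ffun=> 0].
  by apply/ffunP => i; have := E i; rewrite !ffunE => /eqP; rewrite subr_eq0 => /eqP ->.
apply: formB_free; have := dR_trivial_lin (-1) Hc (Hc').
congr dR_trivial.
under [in RHS]eq_bigr do rewrite ffunE rmorphB /= scalerBl.
rewrite sumrB !rmorphN1 scaleN1r opprB.
by rewrite addrA subrK opprB.
Qed.

End Bases.
End PeriodDeterminant.

(** * The homology and the period determinant *)

Lemma supported_sub {R : realType} (A : nzRingType) (S S' : set (R[i] * R[i])) n (c : chain A n) :
  S `<=` S' -> supported S c -> supported S' c.
Proof. by move=> SS H s sc v; have [p /SS Sp sv] := H s sc v; exists p. Qed.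

Section HomologySide.
Context {R : realType} {k : fieldType} (iota : {rmorphism k -> R[i]}) (lam : k).
Local Notation C := R[i].
Local Notation PK := {poly {poly k}}.
Local Notation form := (Defs.form k).
Let l : C := iota lam.
Let Sg : set (C * C) := Sigma l.
Hypotheses (l0 : l != 0) (l1 : l != 1).
Variables (m n0 : nat) (pt : 'I_m -> C * C) (gamU : 'I_n0 -> @chain R int 1).
Hypotheses (pt_inj : injective pt) (pt_Sigma : range pt = Sg).
Hypothesis basis_gamU : integral_basis l set0 gamU.
Variable delta : 'I_m -> @chain R int 1.
Hypotheses (delta_adm : forall i, admissible_chain l (complexify (delta i)))
  (delta_bd : forall i, bd (complexify (delta i)) =
    << 1 *g ((fun=> Some (pt i)) : @sing R 0) >>).

Let cst (p : C * C) : @sing R 0 := fun=> Some p.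

Lemma rel_boundaryW (c : @chain R C 1) : rel_boundary l set0 c -> rel_boundary l Sg c.
Proof.
by move=> [b [e [ab ae se ->]]]; exists b, e; split => //; exact: supported_sub se.
Qed.

Definition chainB (i : 'I_(m + n0)) : @chain R int 1 :=
  match fintype.split i with inl j => delta j | inr j => gamU j end.

Lemma chainB_l j : chainB (lshift n0 j) = delta j.
Proof. by rewrite /chainB (unsplitK (inl j)). Qed.

Lemma chainB_r j : chainB (rshift m j) = gamU j.
Proof. by rewrite /chainB (unsplitK (inr j)). Qed.

Lemma chainB_cycle i : rel_cycle l Sg (complexify (chainB i)).
Proof.
rewrite -(splitK i); case: (fintype.split i) => j /=.
  rewrite chainB_l; split; first exact: delta_adm.
  rewrite delta_bd => s; rewrite domU ?oner_eq0 // inE => /eqP -> v.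
  by exists (pt j) => //; rewrite -pt_Sigma; exists j.
rewrite chainB_r; have [/(_ j) [adm sup] _ _] := basis_gamU.
by split => //; exact: supported_sub sup.
Qed.

Lemma cst_inj : injective cst.
Proof. by move=> p q /(congr1 (fun s : @sing R 0 => s spt0)) [->]. Qed.

Lemma bd_cycle (c : @chain R int 1) : rel_cycle l Sg (complexify c) ->
  bd (complexify c) = \sum_j (coeff (cst (pt j)) (bd c))%:~R *: << 1 *g cst (pt j) >>.
Proof.
move=> [_ sup]; apply: chainP => s; rewrite raddf_sum /=.
under eq_bigr do rewrite coeffZ coeffU mul1r.
have [[j sj]|nos] := pselect (exists j, s = cst (pt j)).
  rewrite (bigD1 j) //= -sj eqxx mulr1 big1 ?addr0; last first.
    by move=> h hj; rewrite sj (inj_eq cst_inj) (inj_eq pt_inj) (negPf hj) mulr0.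
  by rewrite bd_complexify coeff_complexify.
rewrite coeff_outdom ?big1 // => [j _|].
  by case: eqP => [E|_]; rewrite ?mulr0 //; case: nos; exists j.
apply/negP => sd; have [p Sp sp] := sup s sd spt0; apply: nos.
move: Sp; rewrite -pt_Sigma => -[j _ jp]; exists j.
by apply/funext => v; rewrite (splx0 v) sp jp.
Qed.

(** The boundary of c is an integral combination of the points of Sigma; subtracting
    the same combination of the chains delta leaves a cycle of U. *)
Lemma chainB_span (c : @chain R int 1) : rel_cycle l Sg (complexify c) ->
  exists N : 'I_(m + n0) -> int,
  rel_boundary l Sg (complexify c - \sum_i (N i)%:~R *: complexify (chainB i)).
Proof.
move=> cyc; pose a j := coeff (cst (pt j)) (bd c).
pose c' := c - \sum_j a j *: delta j.
have c'E : complexify c' = complexify c - \sum_j (a j)%:~R *: complexify (delta j).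
  rewrite /c' complexifyD -scaleN1r complexifyZ complexify_sum rmorphN1 scaleN1r.
  by congr (_ - _); apply: eq_bigr => j _; rewrite complexifyZ.
have bdc' : bd (complexify c') = 0.
  rewrite c'E -scaleN1r addrC bd_lin bd_sum bd_cycle // scaleN1r.
  by under eq_bigr do rewrite delta_bd; rewrite addNr.
have cyc' : rel_cycle l set0 (complexify c').
  split; last by rewrite bdc' => s; rewrite dom0.
  rewrite c'E -scaleN1r addrC; apply: admissible_lin; last by case: cyc.
  by elim/big_rec: _ => [|j x _ ax]; [exact: admissible0|apply: admissible_lin => //; exact: delta_adm].
have [_ _ span] := basis_gamU; have [b Hb] := span c' cyc'.
exists (fun i => match fintype.split i with inl j => a j | inr j => b j end).
have := rel_boundaryW Hb; congr rel_boundary.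
rewrite big_split_ord /= opprD addrA c'E; congr (_ - _ - _); apply: eq_bigr => j _.
  by rewrite (unsplitK (inl j)) chainB_l.
by rewrite (unsplitK (inr j)) chainB_r scaler_int.
Qed.

End HomologySide.

Theorem corollary8 (R : realType) (k : fieldType)
    (iota : {rmorphism k -> R[i]}) (lam : k)
    (lam0 : lam != 0) (lam1 : lam != 1) (lam2 : lam ^+ 2 - lam + 1 != 0)
    (perUS perU perS : R[i])
    (hUS : is_per iota lam (Sigma (iota lam)) perUS)
    (hU : is_per iota lam set0 perU)
    (hS : is_per_pts iota (Sigma (iota lam)) perS) :
  exists2 c : k, c != 0 & perUS = iota c * (perU * perS).
Proof.
have l0 : iota lam != 0 by rewrite fmorph_eq0.
have l1 : iota lam != 1 by rewrite -(rmorph1 iota) (inj_eq (fmorph_inj iota)).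
case: hUS => n1 [gamS [omS [basis_gamS basis_omS ->]]].
case: hU => n0 [gamU [omU [basis_gamU basis_omU ->]]].
case: hS => m [pt [g [pt_inj pt_Sg basis_g ->]]].
set Sg := Sigma _ in basis_gamS basis_omS pt_Sg basis_g.
have /choice[delta Hd] : forall i, exists c : @chain R int 1,
    admissible_chain (iota lam) (complexify c) /\
    bd (complexify c) = << 1 *g ((fun=> Some (pt i)) : @sing R 0) >>.
  move=> i; have Sp : Sg (pt i) by rewrite -pt_Sg; exists i.
  by have [cp p2] := Sigma_y_neq0 l0 l1 Sp; exact: delta_exists.
have delta_adm i := (Hd i).1; have delta_bd i := (Hd i).2.
have basis_B := formB_basis pt_Sg basis_g basis_omU delta_adm delta_bd.
set B := formB g omU in basis_B; pose D := chainB gamU delta.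
pose kc : {rmorphism k -> {poly {poly k}}} := polyC \o polyC.
(* The change of basis in de Rham cohomology; it also shows n1 = m + n0. *)
have [A HA] := kbasis_rep omS basis_B; have [A' HA'] := kbasis_rep B basis_omS.
have W0 := @dR_trivial0 _ _ iota lam Sg.
have Wl := @dR_trivial_lin _ _ iota lam Sg.
have AA' : A *m A' = 1%:M.
  exact: (change_mx1 (phi := kc) W0 Wl (kbasis_uniq W0 basis_omS) HA HA').
have A'A : A' *m A = 1%:M.
  exact: (change_mx1 (phi := kc) W0 Wl (kbasis_uniq W0 basis_B) HA' HA).
have n1E : n1 = (m + n0)%N.
  by apply/anti_leq; rewrite (mulmx1_min AA') (mulmx1_min A'A).
subst n1.
have cycS i : rel_cycle (iota lam) Sg (complexify (gamS i)) by case: basis_gamS.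
have cycD i : rel_cycle (iota lam) Sg (complexify (D i)).
  by exact: (chainB_cycle pt_Sg basis_gamU delta_adm delta_bd).
(* In homology both changes of basis are integral, by chainB_span and by the third
   condition on gamS. *)
have /choice[N HN] : forall i, exists N : 'I_(m + n0) -> int,
    rel_boundary (iota lam) Sg (complexify (gamS i) - \sum_j (N j)%:~R *: complexify (D j)).
  by move=> i; exact: (chainB_span pt_inj pt_Sg basis_gamU delta_adm delta_bd (cycS i)).
have /choice[M HM] : forall i, exists M : 'I_(m + n0) -> int,
    rel_boundary (iota lam) Sg (complexify (D i) - \sum_j (M j)%:~R *: complexify (gamS j)).
  move=> i; have [_ _ /(_ _ (cycD i)) [a Ha]] := basis_gamS; exists a.
  by move: Ha; congr rel_boundary; congr (_ - _); apply: eq_bigr => j _; rewrite scaler_int.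
pose NC : 'M[int]_(m + n0) := \matrix_(i, j) N i j.
pose MC : 'M[int]_(m + n0) := \matrix_(i, j) M i j.
have NM : map_mx intr NC *m map_mx intr MC = 1%:M :> 'M[R[i]]_(m + n0).
  apply: (@change_mx1 _ _ idfun _ _ (rel_boundary0 (iota lam) Sg)
    (@rel_boundary_lin _ (iota lam) Sg) _ _
    (fun i => complexify (gamS i)) (fun i => complexify (D i))).
  - move=> i c Hc; have [_ /(_ _ (cycS i)) [d [_ U]] _] := basis_gamS.
    rewrite -(U c Hc); apply: U.
    rewrite (bigD1 i) //= ffunE eqxx scale1r big1 ?addr0 ?subrr; first exact: rel_boundary0.
    by move=> j /negPf ji; rewrite ffunE eq_sym ji scale0r.
  - by move=> i; move: (HN i); congr rel_boundary; congr (_ - _); apply: eq_bigr => j _; rewrite !mxE.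
  - by move=> i; move: (HM i); congr rel_boundary; congr (_ - _); apply: eq_bigr => j _; rewrite !mxE.
have detNM : \det NC * \det MC = 1.
  have := congr1 determinant NM; rewrite det_mulmx !det_map_mx det1 -rmorphM /=.
  by move/eqP; rewrite -(rmorph1 intr) eqr_int => /eqP.
exists ((\det NC)%:~R * \det A).
  rewrite mulf_neq0 //.
    by apply: contra_eq_neq (congr1 (fun z : int => z%:~R : k) detNM);
      rewrite rmorphM /= => ->; rewrite mul0r eq_sym oner_eq0.
  by apply: contra_eq_neq (congr1 determinant AA');
    rewrite det_mulmx det1 => ->; rewrite mul0r eq_sym oner_eq0.
pose per i j := period iota (complexify (D i)) (B j).
have perE : \matrix_(i, j) period iota (complexify (gamS i)) (omS j) =
    map_mx intr NC *m (\matrix_(i, j) per i j) *m (map_mx iota A)^T.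
  have finS p : Sg p -> p \in codom pt.
    by rewrite -pt_Sg => -[j _ <-]; exact: codom_f.
  apply/matrixP => i j; rewrite !mxE.
  rewrite (period_mod_trivial (cycS i) (HA j)); apply: eq_bigr => h _.
  rewrite (period_mod_boundary l0 l1 (B h) finS (HN i)) !mxE mulrC; congr (_ * _).
  by apply: eq_bigr => q _; rewrite !mxE.
rewrite perE !det_mulmx det_tr !det_map_mx rmorphM /= rmorph_int.
have -> : \matrix_(i, j) per i j = block_mx
    (\matrix_(i, j) (ev iota (g j) (pt i) * cexp (pt i).2))
    (\matrix_(i, j) period iota (complexify (delta i)) (omU j)) 0
    (\matrix_(i, j) period iota (complexify (gamU i)) (omU j)).
  apply/matrixP => i j; rewrite -(splitK i) -(splitK j) mxE /per /D /B.
  case: (fintype.split i) => {}i; case: (fintype.split j) => {}j /=;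
    rewrite ?chainB_l ?chainB_r ?formB_l ?formB_r.
  - by rewrite block_mxEul mxE (period_delta delta_adm delta_bd).
  - by rewrite block_mxEur mxE.
  - rewrite block_mxEdl mxE; have [/(_ i) [adm sup] _ _] := basis_gamU.
    by rewrite (period_nabla _ _ adm) (@fglift_val0_supported _ _ iota set0).
  - by rewrite block_mxEdr mxE.
rewrite det_ublock; ring.
Qed.
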